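(* Let $X=\mathbb{R}^2/\Lambda$ be a tropical abelian surface (i.e. a tropical abelian variety of dimension $2$) and let $D$ be a divisor on $X$. Then $$h^{0}(X,D)+h^{0}(X,-D)\ \geq\ \tfrac{1}{2}D^{2},$$ where $D^2$ denotes the self-intersection number of $D$.
   Context: Tropical torus: $X=\mathbb{R}^n/\Lambda$, where $\Lambda\subset\mathbb{R}^n$ is a lattice (discrete subgroup of rank $n$); its integral affine structure comes from the standard lattice $\mathbb{Z}^n\subset\mathbb{R}^n$ (not from $\Lambda$). It is a tropical abelian variety if there is a bilinear form $\Lambda\times\mathbb{Z}^n\to\mathbb{Z}$ whose $\mathbb{R}$-bilinear extension to $\mathbb{R}^n\times\mathbb{R}^n$ is symmetric and positive definite. Functions: a $\mathbb{Z}$-affine linear function is (locally) $x\mapsto a\cdot x+c$ with $a\in(\mathbb{Z}^n)^*$, $c\in\mathbb{R}$. A real-valued regular function on an open set is a continuous function that is locally a maximum of finitely many $\mathbb{Z}$-affine linear functions; a (real-valued) rational function is a continuous function that is locally a difference of two regular functions. Divisors: a divisor $D$ on $X$ is given by local data $\{(U_i,f_i)\}$ with $\{U_i\}$ an open cover of $X$ and $f_i:U_i\to\mathbb{R}$ rational such that $f_i-f_j$ is $\mathbb{Z}$-affine linear on $U_i\cap U_j$; two sets of data $\{(U_i,f_i)\}$, $\{(V_j,g_j)\}$ define the same divisor iff all $f_i-g_j$ are $\mathbb{Z}$-affine linear on $U_i\cap V_j$. Equivalently, $D$ is the balanced weighted rational polyhedral complex of pure dimension $n-1$ (up to subdivision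 and deletion of weight-zero cells) supported on the locus where the $f_i$ are not locally affine, the weight of an $(n-1)$-cell being plus (if $f_i$ is convex there) or minus (if concave) the lattice length (largest integer divisor) of the difference in $(\mathbb{Z}^n)^*$ of the slopes of $f_i$ on the two sides. Divisors are added by adding local functions; $-D$ is given by $\{(U_i,-f_i)\}$. $D$ and $D'$ are linearly equivalent if $D-D'$ is the divisor of a global rational function $X\to\mathbb{R}$. A divisor is effective if it has local data consisting of regular functions. $|D|$ is the set of effective divisors linearly equivalent to $D$. A divisor passes through a point $p$ if $p$ lies in its support. $h^0(X,D)$ is the minimum of the integers $k\ge 0$ such that there exist $k$ points $p_1,\dots,p_k\in X$ for which no $E\in|D|$ passes through all of $p_1,\dots,p_k$ (and $\infty$ if no such $k$ exists); in particular $h^0(X,D)=0$ iff $|D|=\emptyset$. Intersection number of $n$ divisors $D_1,\dots,D_n$ on the $n$-dimensional torus $X$: subdivide the $D_i$ so that $\bigcap_i D_i$ is a subcomplex of each, and let $S$ be the finite set of its vertices. For $p\in S$ choose an open neighborhood $U_i$ of $p$ in $D_i$ contained in the open star of $p$ (so $p$ is the only vertex in $\bigcap_i U_i$), and translate $U_i$ by generic sufficiently small vectors $v_i\in\mathbb{R}^n$, so that the translates either have empty common intersection or meet transversally in finitely many points, each lying in the relative interior of $(n-1)$-cells $E_1,\dots,E_n$ of the translates. Such a point $q$ has multiplicity $w_1\cdots w_n|\det(u_1,\dots,u_n)|$, where $w_i$ is the weight of $E_i$ and $u_i$ is a primitive integral vector orthogonal to $E_i$. The multiplicity of $p$ is the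 sum of these multiplicities ($0$ if the intersection is empty; it is independent of choices), and $D_1.D_2.\cdots.D_n$ is the sum of the multiplicities over $p\in S$. $D^n$ denotes $D.D.\cdots.D$ ($n$ times). *)

(* Defs.v *)
From HB Require Import structures.
From mathcomp Require Import all_boot all_order all_algebra.
From mathcomp Require Import all_classical all_reals all_analysis.

Set Implicit Arguments.
Unset Strict Implicit.
Unset Printing Implicit Defensive.

Import Order.TTheory GRing.Theory Num.Theory.
Import numFieldNormedType.Exports.

Local Open Scope classical_set_scope.
Local Open Scope ring_scope.
Local Open Scope quotient_scope.

Record lattice (R : realType) (n : nat) := Lattice {
  lattice_set : set 'rV[R]_n;
  lattice_0 : lattice_set 0;
  lattice_sub : forall x y, lattice_set x -> lattice_set y ->
    lattice_set (x - y);
  lattice_discrete : forall x, lattice_set x ->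
    \forall y \near x, lattice_set y -> y = x;
  lattice_rank : exists2 B : 'M[R]_n, B \in unitmx &
    forall i, lattice_set (row i B) }.

Section Torus.
Context {R : realType} {n : nat} (L : lattice R n).

Definition lattice_rel : rel 'rV[R]_n := fun x y => `[< lattice_set L (x - y) >].

Lemma lattice_rel_refl : reflexive lattice_rel.
Proof. by move=> x; apply/asboolP; rewrite subrr; exact: lattice_0. Qed.

Lemma lattice_rel_sym : symmetric lattice_rel.
Proof.
have H x y : lattice_rel x y -> lattice_rel y x.
  move=> /asboolP xy; apply/asboolP; rewrite -opprB -sub0r.
  exact: lattice_sub (lattice_0 L) xy.
by move=> x y; apply/idP/idP; exact: H.
Qed.

Lemma lattice_rel_trans : transitive lattice_rel.
Proof.
move=> y x z /asboolP xy; rewrite lattice_rel_sym => /asboolP zy.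
apply/asboolP; have -> : x - z = (x - y) - (z - y) by rewrite opprB addrA subrK.
exact: lattice_sub.
Qed.

Canonical lattice_equiv : equiv_rel 'rV[R]_n :=
  EquivRel lattice_rel lattice_rel_refl lattice_rel_sym lattice_rel_trans.

Definition torus := quotient_topology {eq_quot lattice_equiv}.
HB.instance Definition _ := Topological.on torus.
HB.instance Definition _ := Quotient.on torus.

Definition torus_pi (x : 'rV[R]_n) : torus := \pi_torus x.

(* A form on Λ × Z^n is given by its R-bilinear extension (x, y) |-> x Q y^T,
   which has to be integral on Λ × Z^n.  The second factor is the standard
   lattice Z^n, not Λ. *)
Definition tropical_abelian : Prop := exists Q : 'M[R]_n,
  [/\ forall (l : 'rV[R]_n) (z : 'rV[int]_n), lattice_set L l ->
        (l *m Q *m (map_mx intr z)^T) 0 0 \is a Num.int,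
      Q^T = Q &
      forall x : 'rV[R]_n, x != 0 -> 0 < (x *m Q *m x^T) 0 0].

Definition dot (a : 'rV[int]_n) (x : 'rV[R]_n) : R :=
  \sum_i (a 0 i)%:~R * x 0 i.

Definition affine_fun (l : 'rV[int]_n * R) (x : 'rV[R]_n) : R :=
  dot l.1 x + l.2.

Definition max_affine (l0 : 'rV[int]_n * R) (s : seq ('rV[int]_n * R))
    (x : 'rV[R]_n) : R :=
  \big[Num.max/affine_fun l0 x]_(l <- s) affine_fun l x.

(* Functions on an open set U of the torus are total functions whose values
   outside of U are irrelevant. *)
Definition affine_at (f : torus -> R) (x : 'rV[R]_n) : Prop :=
  exists l, \forall y \near x, f (torus_pi y) = affine_fun l y.

Definition affine_on (U : set torus) (f : torus -> R) : Prop :=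
  forall x, U (torus_pi x) -> affine_at f x.

Definition regular_on (U : set torus) (f : torus -> R) : Prop :=
  (forall p, U p -> {for p, continuous f}) /\
  forall x, U (torus_pi x) ->
    exists l0 s, \forall y \near x, f (torus_pi y) = max_affine l0 s y.

Definition rational_on (U : set torus) (f : torus -> R) : Prop :=
  (forall p, U p -> {for p, continuous f}) /\
  forall p, U p -> exists (W : set torus) (g h : torus -> R),
    [/\ open W, W p /\ W `<=` U, regular_on W g, regular_on W h &
        forall q, W q -> f q = g q - h q].

(* A divisor is represented by local data; equality of divisors is
   [same_divisor] below. *)
Record divisor := Divisor {
  div_index : Type;
  div_dom : div_index -> set torus;
  div_fun : div_index -> torus -> R;
  div_open : forall i, open (div_dom i);
  div_cover : forall p, exists i, div_dom i p;
  div_rational : forall i, rational_on (div_dom i) (div_fun i);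
  div_compat : forall i j, affine_on (div_dom i `&` div_dom j)
    (fun p => div_fun i p - div_fun j p) }.

Definition same_divisor (D E : divisor) : Prop :=
  forall (i : div_index D) (j : div_index E),
    affine_on (div_dom i `&` div_dom j) (fun p => div_fun i p - div_fun j p).

Lemma dotDl a b x : dot (a + b) x = dot a x + dot b x.
Proof.
rewrite -big_split; apply: eq_bigr => i _.
by rewrite mxE intrD mulrDl.
Qed.

Lemma dotNl a x : dot (- a) x = - dot a x.
Proof. by rewrite -sumrN; apply: eq_bigr => i _; rewrite mxE mulrNz mulNr. Qed.

Lemma affine_funD k l x :
  affine_fun (k.1 + l.1, k.2 + l.2) x = affine_fun k x + affine_fun l x.
Proof. by rewrite /affine_fun dotDl addrACA. Qed.

Lemma affine_funN l x : affine_fun (- l.1, - l.2) x = - affine_fun l x.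
Proof. by rewrite /affine_fun dotNl opprD. Qed.

Lemma affine_at_add f g h x : affine_at f x -> affine_at g x ->
  (forall p, h p = f p + g p) -> affine_at h x.
Proof.
move=> [k Hk] [l Hl] hE; exists (k.1 + l.1, k.2 + l.2); near=> y.
rewrite hE affine_funD; congr (_ + _); [near: y; exact: Hk|near: y; exact: Hl].
Unshelve. all: by end_near. Qed.

Lemma affine_at_opp f h x : affine_at f x ->
  (forall p, h p = - f p) -> affine_at h x.
Proof.
move=> [k Hk] hE; exists (- k.1, - k.2); near=> y.
by rewrite hE affine_funN; congr (- _); near: y.
Unshelve. all: by end_near. Qed.

Lemma affine_at0 h x : (forall p, h p = 0) -> affine_at h x.
Proof.
move=> hE; exists (0, 0); near=> y; rewrite hE /affine_fun /= addr0.
by rewrite /dot big1 // => i _; rewrite mxE mul0r.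
Unshelve. all: by end_near. Qed.

Lemma max_affineD k0 s l0 t : exists m0 r, forall x,
  max_affine k0 s x + max_affine l0 t x = max_affine m0 r x.
Proof.
pose ad (k l : 'rV[int]_n * R) := (k.1 + l.1, k.2 + l.2).
have adE k l x : affine_fun (ad k l) x = affine_fun k x + affine_fun l x.
  exact: affine_funD.
have add1 k : exists m0 r, forall x,
    affine_fun k x + max_affine l0 t x = max_affine m0 r x.
  exists (ad k l0), (map (ad k) t) => x; rewrite /max_affine big_map.
  elim: t => [|l t IH]; first by rewrite !big_nil adE.
  by rewrite !big_cons addr_maxr IH !adE.
elim: s => [|k s [m0 [r IH]]].
  have [m0 [r H]] := add1 k0; exists m0, r => x.
  by rewrite {1}/max_affine big_nil H.
have [m1 [r1 H1]] := add1 k; exists m0, (m1 :: r1 ++ r) => x.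
have -> : max_affine k0 (k :: s) x =
    Num.max (affine_fun k x) (max_affine k0 s x).
  by rewrite /max_affine big_cons.
rewrite addr_maxl IH H1 /max_affine.
elim: r1 {H1} => [|a r1 IHr] /=; first by rewrite big_nil big_cons.
by rewrite !big_cons -maxA IHr big_cons maxCA.
Qed.

Lemma regular_onD U f g : regular_on U f -> regular_on U g ->
  regular_on U (fun p => f p + g p).
Proof.
move=> [cf Hf] [cg Hg]; split=> [p Up|x Ux].
  by apply: continuousD; [exact: cf|exact: cg].
have [k0 [s Hs]] := Hf _ Ux; have [l0 [t Ht]] := Hg _ Ux.
have [m0 [r Hr]] := max_affineD k0 s l0 t; exists m0, r; near=> y.
rewrite -Hr; congr (_ + _); [near: y; exact: Hs|near: y; exact: Ht].
Unshelve. all: by end_near. Qed.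

Lemma regular_onS U V f : V `<=` U -> regular_on U f -> regular_on V f.
Proof. by move=> VU [cf Hf]; split=> x /VU; [exact: cf|exact: Hf]. Qed.

Lemma rational_onN U f : rational_on U f -> rational_on U (fun p => - f p).
Proof.
move=> [cf Hf]; split=> [p Up|p Up]; first by apply: continuousN; exact: cf.
have [W [g [h [oW WU rg rh E]]]] := Hf _ Up.
by exists W, h, g; split=> // q Wq; rewrite E // opprB.
Qed.

Lemma rational_onD U V f g : rational_on U f -> rational_on V g ->
  rational_on (U `&` V) (fun p => f p + g p).
Proof.
move=> [cf Hf] [cg Hg]; split=> [p [Up Vp]|p [Up Vp]].
  by apply: continuousD; [exact: cf|exact: cg].
have [W [f1 [f2 [oW [Wp WU] rf1 rf2 E]]]] := Hf _ Up.
have [Z [g1 [g2 [oZ [Zp ZV] rg1 rg2 F]]]] := Hg _ Vp.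
exists (W `&` Z), (fun p => f1 p + g1 p), (fun p => f2 p + g2 p); split.
- exact: openI.
- by split=> // q [Wq Zq]; split; [exact: WU|exact: ZV].
- apply: regular_onD; first exact: regular_onS rf1.
  by apply: regular_onS rg1; exact: subIsetr.
- apply: regular_onD; first exact: regular_onS rf2.
  by apply: regular_onS rg2; exact: subIsetr.
- by move=> q [Wq Zq]; rewrite E // F // opprD addrACA.
Qed.

Program Definition opp_divisor (D : divisor) : divisor := @Divisor
  (div_index D) (@div_dom D) (fun i p => - div_fun i p)
  (@div_open D) (@div_cover D) _ _.
Next Obligation. by move=> D i; apply: rational_onN; exact: div_rational. Qed.
Next Obligation.
move=> D i j x Ux; apply: affine_at_opp (div_compat Ux) _ => p /=.
by rewrite opprD.
Qed.

Program Definition add_divisor (D E : divisor) : divisor := @Divisor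
  (div_index D * div_index E)
  (fun ij => div_dom ij.1 `&` div_dom ij.2)
  (fun ij p => div_fun ij.1 p + div_fun ij.2 p) _ _ _ _.
Next Obligation. by move=> D E ij; apply: openI; exact: div_open. Qed.
Next Obligation.
move=> D E p; have [i Hi] := div_cover D p; have [j Hj] := div_cover E p.
by exists (i, j).
Qed.
Next Obligation. by move=> D E ij; apply: rational_onD; exact: div_rational. Qed.
Next Obligation.
move=> D E [i j] [k l] x /= [[Ui Uj] [Uk Ul]].
apply: affine_at_add (div_compat (conj Ui Uk)) (div_compat (conj Uj Ul)) _ => p.
by rewrite /= opprD addrACA.
Qed.

Program Definition principal_divisor (h : torus -> R)
    (hh : rational_on setT h) : divisor := @Divisor
  unit (fun=> setT) (fun=> h) (fun=> openT) _ (fun=> hh) _.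
Next Obligation. by move=> h hh p; exists tt. Qed.
Next Obligation.
by move=> h hh i j x _; apply: affine_at0 => p; rewrite subrr.
Qed.

Definition linearly_equivalent (D E : divisor) : Prop :=
  exists (h : torus -> R) (hh : rational_on setT h),
    same_divisor (add_divisor D (opp_divisor E)) (principal_divisor hh).

Definition effective (D : divisor) : Prop :=
  exists2 E : divisor, same_divisor D E &
    forall i : div_index E, regular_on (div_dom i) (div_fun i).

Definition linear_system (D : divisor) : set divisor :=
  [set E | effective E /\ linearly_equivalent E D].

(* [support D] is pulled back to the universal cover R^n. *)
Definition support (D : divisor) : set 'rV[R]_n :=
  [set x | exists2 i : div_index D,
    div_dom i (torus_pi x) & ~ affine_at (div_fun i) x].

Definition passes_through (E : divisor) (p : torus) : Prop :=
  exists2 x, torus_pi x = p & support E x.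

(* The infimum of a set of natural numbers is its minimum, and +oo if the set
   is empty. *)
Definition h0 (D : divisor) : \bar R :=
  ereal_inf [set (k%:R)%:E | k in [set k : nat |
    exists P : 'I_k -> torus,
      ~ exists2 E, linear_system D E & forall j, passes_through E (P j)]].

Definition lattice_length (a : 'rV[int]_n) : nat :=
  \big[gcdn/0%N]_j `|a 0%R j|%N.

Definition primitive (u : 'rV[int]_n) : Prop := lattice_length u = 1%N.

(* Near [q] the divisor is a piece of the hyperplane through [q] orthogonal to
   the primitive covector [u]; the slopes on the two sides are [a] and [b].
   As [u] points to the side of [a], the equation a - b = w u makes |w| the
   lattice length of a - b, with w > 0 exactly in the convex case. *)
Definition facet_at (D : divisor) (q : 'rV[R]_n) (u : 'rV[int]_n) (w : int) :
    Prop :=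
  [/\ primitive u, w != 0 &
    exists (i : div_index D) (a b : 'rV[int]_n),
    [/\ div_dom i (torus_pi q), a - b = w *: u &
      \forall y \near q, div_fun i (torus_pi y) = div_fun i (torus_pi q) +
        dot (if 0 <= dot u (y - q) then a else b) (y - q)]].

End Torus.

(* Intersection numbers on a surface.  Complexes and their local translates are
   considered in the universal cover R^2; a small neighbourhood of a point of
   the torus is identified with one of a lift of that point. *)
Section Intersection.
Context {R : realType} (L : lattice R 2).
Implicit Types (D : divisor L) (V : set (torus L)) (U : set 'rV[R]_2).
Implicit Types (p q v : 'rV[R]_2).

(* [V] is the set of vertices of a subdivision of [D]: finite, each point of
   the support outside V is interior to an edge, and following an edge in
   either direction one reaches a vertex. *)
Definition subdivision D V : Prop :=
  [/\ finite_set V,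
      forall q, V (torus_pi L q) -> support D q,
      forall q, support D q -> ~ V (torus_pi L q) ->
        exists u w, facet_at D q u w &
      forall q u w (d : 'rV[R]_2), ~ V (torus_pi L q) -> facet_at D q u w ->
        dot u d = 0 -> d != 0 ->
        exists2 t : R, 0 < t & V (torus_pi L (q + t *: d))].

(* The intersection of the supports is a subcomplex of both: the two complexes
   have the same vertices and the same edges there. *)
Definition common_subdivision D1 V1 D2 V2 : Prop :=
  [/\ subdivision D1 V1, subdivision D2 V2,
      forall q, support D1 q -> support D2 q ->
        (V1 (torus_pi L q) <-> V2 (torus_pi L q)) &
      forall q, support D1 q -> support D2 q -> ~ V1 (torus_pi L q) ->
        \forall y \near q, support D1 y <-> support D2 y].

Definition open_star D V p : set 'rV[R]_2 :=
  [set x | x = p \/ forall t : R, 0 < t <= 1 ->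
    support D (p + t *: (x - p)) /\ ~ V (torus_pi L (p + t *: (x - p)))].

Definition star_neighborhood D V p U : Prop :=
  U `<=` open_star D V p /\
  exists O : set 'rV[R]_2, [/\ open O, O p & U = O `&` support D].

Definition translate U v : set 'rV[R]_2 := [set q | U (q - v)].

(* [D1] at [q1] and [D2] at [q2] are interior to edges of different directions,
   and [m] is the multiplicity of their crossing after translation. *)
Definition transverse_mult D1 V1 q1 D2 V2 q2 (m : int) : Prop :=
  exists u1 w1 u2 w2,
    [/\ ~ V1 (torus_pi L q1) /\ facet_at D1 q1 u1 w1,
        ~ V2 (torus_pi L q2) /\ facet_at D2 q2 u2 w2,
        \det (col_mx u1 u2 : 'M[int]_2) != 0 &
        m = w1 * w2 * `|\det (col_mx u1 u2 : 'M[int]_2)|].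

Definition local_multiplicity D1 V1 D2 V2 p (m : int) : Prop :=
  exists U1 U2, [/\ star_neighborhood D1 V1 p U1,
    star_neighborhood D2 V2 p U2 &
    \forall v1 \near (0 : 'rV[R]_2) & v2 \near (0 : 'rV[R]_2),
      let I := translate U1 v1 `&` translate U2 v2 in
      forall mu : 'rV[R]_2 -> int, finite_set I ->
      (forall q, I q -> transverse_mult D1 V1 (q - v1) D2 V2 (q - v2) (mu q)) ->
      \sum_(q \in I) mu q = m].

Definition is_intersection_number D1 D2 (m : int) : Prop :=
  exists V1 V2 (mu : torus L -> int),
    [/\ common_subdivision D1 V1 D2 V2,
        forall p, V1 (torus_pi L p) -> V2 (torus_pi L p) ->
          local_multiplicity D1 V1 D2 V2 p (mu (torus_pi L p)) &
        m = \sum_(s \in V1 `&` V2) mu s].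

(* The number exists and does not depend on the choices; the default value 0
   is never used. *)
Definition intersection_number D1 D2 : int :=
  xget 0 [set m | is_intersection_number D1 D2 m].

Definition self_intersection D : int := intersection_number D D.

End Intersection.

(* Main.v *)
(* Lift [D] to a piecewise linear function [F] on the plane with
   [F (x + l) = F x + a l . x + b l] for [l] in the lattice.  The form [a l . m] is
   symmetric, because addition of periods is commutative.

   The self-intersection number of [D] is the sum, over the edges of [D] on the
   torus with both orientations, of the weight times the slope of [F] along the
   edge.  It is expressed by the periods of [F] by counting how often the edges meet
   a closed geodesic in a lattice direction: for a basis [b1, b2] of the lattice,
   [D^2 |det (b1, b2)| = 2 det (a bi . bj)], so [D^2 / 2 = |det (a b1, a b2)|] if
   [D^2 > 0].  In that case the form is definite, and after replacing [D] by [-D] we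
   may take it to be positive definite.  Then every choice of coefficients [c e],
   where [e] runs through representatives of the [D^2 / 2] classes of integral
   covectors modulo the slopes [a l], defines a theta series, the maximum of the
   translates of [e . x + c e] by the lattice, which is the lift of an effective
   divisor in [|D|].  It passes through [x] if two classes attain the maximum at [x];
   for fewer than [D^2 / 2] points this is a tropical linear system with more
   unknowns than equations, solved by the tropical Cramer rule. *)
Require Import Defs.
From mathcomp Require Import fingroup perm.
From mathcomp Require Import all_boot all_order all_algebra.
From mathcomp Require Import all_classical all_reals all_analysis.
From mathcomp Require Import ring lra zify.

Set Implicit Arguments.
Unset Strict Implicit.
Unset Printing Implicit Defensive.

Import Order.TTheory GRing.Theory Num.Theory.
Import numFieldNormedType.Exports.

Local Open Scope classical_set_scope.
Local Open Scope ring_scope.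
Local Open Scope quotient_scope.

(** An intersection number is accessible only through [is_intersection_number], where a multiplicity
    is asserted for all small translates. One pair of translates per vertex is enough: the first
    copy stays, the second moves along a vector off all rays. On a ray of the first copy the
    crossings add up the kinks of the tangent cone along a half-line, hence equal its slope at
    infinity minus its slope at the start. The starting slopes come from one linear function and
    cancel by balancing, which leaves weight times slope, summed over the rays.

    The slopes of an edge in its two orientations add up to the slope of a period, so the global sum
    depends only on the tensor of periods and directions of the edges. By balancing, the period of
    an edge may be replaced by the edge vector, which makes this tensor symmetric. It is therefore
    known once its diagonal is, and the count along closed geodesics yields the diagonal, here for
    [b1], [b2] and [b1 + b2].

    Since both values of [h0] are nonnegative, only a positive number needs an argument, and such a
    number is not the default value of [intersection_number]. *)

Section RealLine.
Context {R : realType}.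

Lemma nearP {V : normedModType R} (x : V) (P : set V) :
  (\forall y \near x, P y) <->
  exists2 e : R, 0 < e & forall y, `|y - x| < e -> P y.
Proof.
rewrite nbhs_normP; split=> -[e e0 Pe]; exists e => // y.
  by rewrite distrC => ye; exact: Pe.
by rewrite /= distrC => ye; exact: Pe.
Qed.

Lemma near_ball {V : normedModType R} (x : V) (e : R) : 0 < e ->
  \forall y \near x, `|y - x| < e.
Proof. by move=> e0; apply/nearP; exists e. Qed.

(** Connectedness of a segment, in the form of an induction principle. The supremum of the initial
    segments on which [P] holds satisfies [P] by the closure hypothesis, and the openness hypothesis
    then forces it to be [b]. *)
Lemma real_induction (P : R -> Prop) (a b : R) : a <= b -> P a ->
  (forall s, a <= s < b -> P s ->
    exists2 e, 0 < e & forall s', s < s' < s + e -> P s') ->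
  (forall s, a < s <= b -> (forall s', a <= s' < s -> P s') -> P s) ->
  forall s, a <= s <= b -> P s.
Proof.
move=> ab Pa Pr Pl.
pose S := [set s | a <= s <= b /\ forall s', a <= s' <= s -> P s'].
have Sa : S a.
  split=> [|s' /andP[h1 h2]]; first by rewrite lexx ab.
  by have -> : s' = a by apply/le_anti; rewrite h1 h2.
have hS : has_sup S by split; [exists a | exists b => s [/andP[]]].
have aS : a <= sup S by apply: ub_le_sup Sa; exact: hS.2.
have Sb : sup S <= b by apply: sup_le_ub; [exists a|move=> s [/andP[]]].
have below s' : a <= s' < sup S -> P s'.
  move=> /andP[h1 h2]; have [s [_ Hs] ss'] := sup_gt hS.1 h2.
  by apply: Hs; rewrite h1 ltW.
have PS : P (sup S).
  have [<-//|aS'] := eqVneq a (sup S).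
  by apply: Pl below; rewrite lt_neqAle aS' aS Sb.
have SS : S (sup S).
  split=> [|s' /andP[h1]]; first by rewrite aS.
  by rewrite le_eqVlt => /predU1P[->//|h2]; apply: below; rewrite h1.
suff E : sup S = b by rewrite -E; exact: SS.2.
apply/le_anti; rewrite Sb /= leNgt; apply/negP => Slt.
have [|e e0 He] := Pr (sup S) _ PS; first by rewrite aS.
pose s := Num.min b (sup S + e / 2).
have sgt : sup S < s by rewrite lt_min Slt ltrDl divr_gt0.
suff /(ub_le_sup hS.2) : S s by rewrite leNgt sgt.
split=> [|s' /andP[h1 h2]].
  by rewrite ge_min lexx (le_trans aS (ltW sgt)).
have [h3|h3] := leP s' (sup S); first by apply: SS.2; rewrite h1.
apply: He; rewrite h3 (le_lt_trans h2)// gt_min ltrD2l.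
by rewrite ltr_pdivrMr// mulr2n mulrDr mulr1 ltrDl e0 orbT.
Qed.

Lemma near_left (P : set R) (a s : R) : a < s ->
  (\forall t \near s, P t) -> exists2 t, a <= t < s & P t.
Proof.
move=> as_ /nearP[e e0 He].
exists (Num.max a (s - e / 2)).
  by rewrite le_max lexx/= gt_max as_/= gtrBl divr_gt0.
apply: He; have [h|h] := leP a (s - e / 2).
  by rewrite addrC addKr normrN gtr0_norm ?divr_gt0//; lra.
by rewrite ler0_norm; lra.
Qed.

Lemma near_eq_affine (a b a' b' s : R) :
  (\forall t \near s, a + b * t = a' + b' * t) -> a = a' /\ b = b'.
Proof.
move=> /nearP[e e0 He].
have h0 : a + b * s = a' + b' * s by apply: He; rewrite subrr normr0.
have h1 : a + b * (s + e / 2) = a' + b' * (s + e / 2).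
  by apply: He; rewrite addrC addKr gtr0_norm; lra.
have : (b - b') * (e / 2) = 0 by move: h1 h0; lra.
move=> /eqP; rewrite mulf_eq0 => /orP[|/eqP]; last by lra.
rewrite subr_eq0 => /eqP bb'; split=> //.
by move: h0; rewrite bb'; lra.
Qed.

(** An affine germ extends to neighbouring points and is determined by its values near any one of
    them, so the germ found at [a] is carried along the whole segment. *)
Lemma affine_segment (g : R -> R) (a b : R) : a <= b ->
  (forall s, a <= s <= b ->
    exists c d, \forall t \near s, g t = c + d * t) ->
  exists c d, forall s, a <= s <= b -> \forall t \near s, g t = c + d * t.
Proof.
move=> ab Hg.
have [|c [d Ha]] := Hg a; first by rewrite lexx.
exists c, d; apply: real_induction => //.
  move=> s _ /near_join/nearP[e e0 He]; exists e => // s' /andP[h1 h2].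
  by apply: He; rewrite gtr0_norm; lra.
move=> s /andP[h1 h2] Hs.
have [|c' [d' Hs']] := Hg s; first by rewrite ltW.
have [t ht Ht] := near_left h1 (near_join Hs').
have [] : c = c' /\ d = d'.
  apply: (@near_eq_affine _ _ _ _ t); near=> u.
  transitivity (g u); last by near: u.
  by symmetry; near: u; exact: Hs.
by move=> -> ->.
Unshelve. all: by end_near. Qed.

End RealLine.

Lemma continuous_atP {R : realType} {T : topologicalType} (f : T -> R) x :
  {for x, continuous f} <->
  forall e, 0 < e -> \forall y \near x, `|f x - f y| < e.
Proof. exact: cvgrPdist_lt. Qed.

(** * Germs of integral affine functions *)

Section Germs.
Context {R : realType} {n : nat}.
Implicit Types (a b u : 'rV[int]_n) (x y v : 'rV[R]_n) (l : 'rV[int]_n * R).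

Lemma near_rV x (e : R) : 0 < e -> \forall y \near x, `|y - x| < e.
Proof. exact: near_ball. Qed.

Lemma dotDr a x y : dot a (x + y) = dot a x + dot a y.
Proof. by rewrite -big_split; apply: eq_bigr => i _; rewrite mxE mulrDr. Qed.

Lemma dotZr a c x : dot a (c *: x) = c * dot a x.
Proof. by rewrite mulr_sumr; apply: eq_bigr => i _; rewrite mxE mulrCA. Qed.

Lemma dotNr a x : dot a (- x) = - dot a x.
Proof. by rewrite -scaleN1r dotZr mulN1r. Qed.

Lemma dotBr a x y : dot a (x - y) = dot a x - dot a y.
Proof. by rewrite dotDr dotNr. Qed.

Lemma dot0r a : dot a (0 : 'rV[R]_n) = 0.
Proof. by rewrite -(scale0r 0) dotZr mul0r. Qed.

Lemma dot0l x : dot 0 x = 0.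
Proof. by rewrite /dot big1 // => i _; rewrite mxE mul0r. Qed.

Lemma dotBl a b x : dot (a - b) x = dot a x - dot b x.
Proof. by rewrite dotDl dotNl. Qed.

Lemma dotZl (z : int) a x : dot (z *: a) x = z%:~R * dot a x.
Proof.
rewrite mulr_sumr; apply: eq_bigr => i _.
by rewrite mxE intrM mulrA.
Qed.

Lemma dot_inj a b : (forall x, dot a x = dot b x) -> a = b.
Proof.
move=> E; apply/rowP => i; apply/eqP; rewrite -(eqr_int R); apply/eqP.
have D c : dot c (delta_mx 0 i) = (c 0 i)%:~R :> R.
  rewrite /dot (bigD1 i)//= mxE !eqxx mulr1 big1 ?addr0// => j ji.
  by rewrite mxE (negbTE ji) andbF mulr0.
by rewrite -!D.
Qed.

Lemma coord_le_norm x i : `|x 0 i| <= `|x|.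
Proof.
rewrite [`|x|]mx_normE.
exact: (le_bigmax _ (fun ij : 'I_1 * 'I_n => `|x ij.1 ij.2|%:nng) (0, i)).
Qed.

Lemma norm_lt_coord x (e : R) : 0 < e ->
  (forall i, `|x 0 i| < e) -> `|x| < e.
Proof.
move=> e0 He; rewrite [`|x|]mx_normE.
have -> : e = (NngNum (ltW e0))%:num by [].
rewrite num_lt; apply/bigmax_ltP; split=> [|[i j] _]; rewrite -num_lt//=.
by rewrite ord1.
Qed.

Lemma dot_bound a : exists2 K : R, 0 < K & forall x, `|dot a x| <= K * `|x|.
Proof.
exists (1 + \sum_i `|(a 0 i)%:~R|).
  by rewrite ltr_pwDl// sumr_ge0.
move=> x; rewrite mulrDl mul1r (le_trans (ler_norm_sum _ _ _))//.
rewrite (le_trans (_ : _ <= \sum_i `|(a 0 i)%:~R| * `|x|)) //.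
  by apply: ler_sum => i _; rewrite normrM ler_wpM2l// coord_le_norm.
by rewrite -mulr_suml lerDr.
Qed.

Lemma dot_continuous a : continuous (dot a : 'rV[R]_n -> R).
Proof.
move=> x; apply/continuous_atP => e e0; apply/nearP.
have [K K0 HK] := dot_bound a; exists (e / K); first exact: divr_gt0.
move=> y; rewrite ltr_pdivlMr// -dotBr distrC => ye.
by apply: le_lt_trans ye; rewrite mulrC HK.
Qed.

Lemma affine_fun_at l x v : affine_fun l (x + v) = affine_fun l x + dot l.1 v.
Proof. by rewrite /affine_fun dotDr addrAC. Qed.

Lemma near_line x v (s : R) (P : set 'rV[R]_n) :
  (\forall y \near x + s *: v, P y) -> \forall t \near s, P (x + t *: v).
Proof.
move=> /nearP[e e0 He]; apply/nearP.
have v0 : 0 < `|v| + 1 by rewrite ltr_wpDl.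
exists (e / (`|v| + 1)); first exact: divr_gt0.
move=> t; rewrite ltr_pdivlMr// => te; apply: He.
rewrite opprD addrACA subrr add0r -scalerBl normrZ.
by apply: le_lt_trans te; rewrite ler_wpM2l// lerDl.
Qed.

Lemma near_line0 x v (P : set 'rV[R]_n) :
  (\forall y \near x, P y) -> \forall t \near (0 : R), P (x + t *: v).
Proof. by move=> H; apply: near_line; rewrite scale0r addr0. Qed.

Lemma near0_pos (P : set R) : (\forall t \near (0 : R), P t) ->
  exists2 e, 0 < e & forall t, `|t| <= e -> P t.
Proof.
move=> /nearP[e e0 He]; exists (e / 2); first exact: divr_gt0.
by move=> t te; apply: He; rewrite subr0; lra.
Qed.

(** A linear function that is nonpositive near 0 vanishes, as is seen by comparing at [x + v] and
    [x - v]. This is how a term of a maximum that touches an affine germ is identified with that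
    germ. *)
Lemma affine_le_near l l' x :
  (\forall y \near x, affine_fun l y <= affine_fun l' y) ->
  affine_fun l x = affine_fun l' x -> l = l'.
Proof.
move=> H E.
have D : l.1 = l'.1.
  apply: dot_inj => v; have [e e0 He] := near0_pos (near_line0 v H).
  have := He e; have := He (- e).
  rewrite !affine_fun_at E !lerD2l !dotZr.
  rewrite normrN gtr0_norm// => /(_ (lexx _)) h1 /(_ (lexx _)).
  rewrite ler_pM2l// => h2; apply/le_anti; rewrite h2 /=.
  by move: h1; rewrite !mulNr lerN2 ler_pM2l.
case: l l' E D {H} => [a c] [a' c'] /= + aa'; rewrite -aa' /affine_fun /=.
by move=> /addrI ->.
Qed.

Lemma affine_eq_near l l' x :
  (\forall y \near x, affine_fun l y = affine_fun l' y) -> l = l'.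
Proof.
move=> H; apply: (@affine_le_near _ _ x); last exact: nbhs_singleton H.
by apply: filterS H => y ->.
Qed.

Definition loc_affine (G : 'rV[R]_n -> R) x : Prop :=
  exists l, \forall y \near x, G y = affine_fun l y.

Lemma loc_affine_ext G H x : (\forall y \near x, G y = H y) ->
  loc_affine G x -> loc_affine H x.
Proof.
move=> E [l Hl]; exists l; near=> y; rewrite -(near E y)//; near: y.
exact: Hl.
Unshelve. all: by end_near. Qed.

Lemma loc_affine_fun l x : loc_affine (affine_fun l) x.
Proof. by exists l; near=> y. Unshelve. all: by end_near. Qed.

Lemma loc_affineD G H x : loc_affine G x -> loc_affine H x ->
  loc_affine (fun y => G y + H y) x.
Proof.
move=> [k Hk] [l Hl]; exists (k.1 + l.1, k.2 + l.2); near=> y.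
rewrite affine_funD; congr (_ + _); near: y; [exact: Hk|exact: Hl].
Unshelve. all: by end_near. Qed.

Lemma loc_affineN G x : loc_affine G x -> loc_affine (fun y => - G y) x.
Proof.
move=> [k Hk]; exists (- k.1, - k.2); near=> y.
by rewrite affine_funN; congr (- _); near: y.
Unshelve. all: by end_near. Qed.

Lemma loc_affineB G H x : loc_affine G x -> loc_affine H x ->
  loc_affine (fun y => G y - H y) x.
Proof. by move=> HG HH; apply: loc_affineD => //; exact: loc_affineN. Qed.

Lemma near_translate (P : set 'rV[R]_n) x v :
  (\forall y \near x + v, P y) <-> \forall y \near x, P (y + v).
Proof.
split=> /nearP[e e0 He]; apply/nearP; exists e => // y ye.
  by apply: He; rewrite opprD addrACA subrr addr0.
by rewrite -(subrK v y); apply: He; rewrite addrAC -addrA -opprD.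
Qed.

Lemma loc_affine_translate G x v :
  loc_affine G (x + v) -> loc_affine (fun y => G (y + v)) x.
Proof.
move=> [l /near_translate Hl]; exists (l.1, l.2 + dot l.1 v).
by apply: filterS Hl => y ->; rewrite affine_fun_at /affine_fun /= addrA addrAC.
Qed.

(** The germ at a base point is continued along the segment to [x], which stays in [A]. *)
Lemma loc_affine_convex (A : set 'rV[R]_n) G :
  (forall x y t, A x -> A y -> 0 <= t <= 1 -> A (x + t *: (y - x))) ->
  (forall x, A x -> loc_affine G x) ->
  exists l, forall x, A x -> \forall y \near x, G y = affine_fun l y.
Proof.
move=> cA HG.
have [[x0 Ax0]|A0] := pselect (A !=set0); last first.
  by exists (0, 0) => x Ax; exfalso; apply: A0; exists x.
have [l Hl] := HG _ Ax0; exists l => x Ax.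
suff /(_ 1) : forall s, 0 <= s <= 1 ->
    \forall y \near x0 + s *: (x - x0), G y = affine_fun l y.
  by rewrite scale1r subrKC lexx ler01; apply.
apply: real_induction => //; first by rewrite scale0r addr0.
  move=> s _ /near_join/near_line/nearP[e e0 He]; exists e => // t /andP[h1 h2].
  by apply: He; rewrite gtr0_norm; lra.
move=> s /andP[h1 h2] Hs.
have [|l' Hl'] := HG (x0 + s *: (x - x0)); first by apply: cA; rewrite // ltW.
have [t ht Ht] := near_left h1 (near_line (near_join Hl')).
suff -> : l = l' by [].
apply: (@affine_eq_near _ _ (x0 + t *: (x - x0))); near=> y.
transitivity (G y); last by near: y.
by symmetry; near: y; exact: Hs.
Unshelve. all: by end_near. Qed.

End Germs.

(** * The quotient map to the torus *)

Section TorusTopology.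
Context {R : realType} {n : nat} (L : lattice R n).
Implicit Types (x y v l : 'rV[R]_n) (p : torus L).
Local Notation pi := (@torus_pi R n L).

Lemma latticeN l : lattice_set L l -> lattice_set L (- l).
Proof. by rewrite -sub0r; apply: lattice_sub; exact: lattice_0. Qed.

Lemma latticeD l v : lattice_set L l -> lattice_set L v ->
  lattice_set L (l + v).
Proof. by move=> Ll Lv; rewrite -[v]opprK; apply/lattice_sub/latticeN. Qed.

Lemma latticeMn l k : lattice_set L l -> lattice_set L (l *+ k).
Proof.
move=> Ll; elim: k => [|k IH]; first exact: lattice_0.
by rewrite mulrS; exact: latticeD.
Qed.

Lemma latticeZ (z : int) l : lattice_set L l -> lattice_set L (z%:~R *: l).
Proof.
move=> Ll; case: z => k.
  by rewrite -pmulrn scaler_nat; exact: latticeMn.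
by rewrite NegzE mulrNz scaleNr -pmulrn scaler_nat; apply/latticeN/latticeMn.
Qed.

Lemma torus_piP x y : pi x = pi y <-> lattice_set L (x - y).
Proof.
split=> [/eqquotP/asboolP //|H].
exact/eqquotP/asboolP.
Qed.

Lemma torus_piD x l : lattice_set L l -> pi (x + l) = pi x.
Proof. by move=> Ll; apply/torus_piP; rewrite addrAC subrr add0r. Qed.

Lemma torus_pi_surj p : exists x, pi x = p.
Proof. by exists (repr p); rewrite /torus_pi reprK. Qed.

Lemma torus_pi_near (U : set (torus L)) x : open U -> U (pi x) ->
  \forall y \near x, U (pi y).
Proof.
move=> oU Ux; apply: (@pi_continuous _ {eq_quot lattice_equiv L} x).
exact: open_nbhs_nbhs.
Qed.

Lemma translate_open (O : set 'rV[R]_n) v : open O ->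
  open [set x | O (x + v)].
Proof.
rewrite !openE => oO x /= Ox; apply/(near_translate O x v).
exact: oO.
Qed.

Lemma torus_pi_open (O : set 'rV[R]_n) : open O -> open (pi @` O).
Proof.
move=> oO.
change (open (pi @^-1` (pi @` O))).
have -> : pi @^-1` (pi @` O) =
    \bigcup_(l in lattice_set L) [set x | O (x + l)].
  apply/seteqP; split=> x.
    move=> [y Oy /torus_piP yx]; exists (y - x) => //=.
    by rewrite subrKC.
  by move=> [l Ll /= Oxl]; exists (x + l) => //; exact: torus_piD.
by apply: bigcup_open => l _; exact: translate_open.
Qed.

Lemma torus_near_pi (x : 'rV[R]_n) (P : set (torus L)) :
  (\forall y \near x, P (pi y)) -> \forall q \near pi x, P q.
Proof.
rewrite /prop_near1 !nbhsE => -[W [oW Wx] WP].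
exists (pi @` W); last by move=> _ [y Wy <-]; exact: WP.
by split; [exact: torus_pi_open|exists x].
Qed.

Lemma torus_continuous (f : torus L -> R) x :
  (forall e, 0 < e -> \forall y \near x, `|f (pi x) - f (pi y)| < e) ->
  {for pi x, continuous f}.
Proof.
move=> H; apply/continuous_atP => e e0.
by apply: torus_near_pi; exact: H.
Qed.

Lemma lattice_separated :
  exists2 e : R, 0 < e & forall l, lattice_set L l -> `|l| < e -> l = 0.
Proof.
have /nearP[e e0 He] := lattice_discrete (lattice_0 L).
by exists e => // l Ll le; apply: He => //; rewrite subr0.
Qed.

End TorusTopology.

Lemma det_mx22 (T : comNzRingType) (A : 'M[T]_2) :
  \det A = A 0 0 * A 1 1 - A 0 1 * A 1 0.
Proof.
have E1 : lift (0 : 'I_2) 0 = 1 by exact: val_inj.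
have E2 : lift (1 : 'I_2) 0 = 0 by exact: val_inj.
rewrite (expand_det_row _ 0) !big_ord_recl big_ord0 addr0 E1 /cofactor.
by rewrite !det_mx11 !mxE E1 E2 expr0 expr1 mul1r mulN1r mulrN.
Qed.

(** * Bases of planar lattices *)

Section Plane.
Context {R : realType}.
Implicit Types (x y v : 'rV[R]_2).

Definition det2 x y : R := x 0 0 * y 0 1 - x 0 1 * y 0 0.

Lemma row2P x y : x 0 0 = y 0 0 -> x 0 1 = y 0 1 -> x = y.
Proof.
move=> h0 h1; apply/rowP => -[[|[|//]] i].
  by rewrite (_ : Ordinal i = 0) //; exact: val_inj.
by rewrite (_ : Ordinal i = 1) //; exact: val_inj.
Qed.

Lemma ord2P (P : 'I_2 -> Prop) : P 0 -> P 1 -> forall i, P i.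
Proof.
move=> h0 h1 [[|[|//]] i].
  by rewrite (_ : Ordinal i = 0) //; exact: val_inj.
by rewrite (_ : Ordinal i = 1) //; exact: val_inj.
Qed.

Lemma cramer2 x b1 b2 : det2 b1 b2 != 0 ->
  x = (det2 x b2 / det2 b1 b2) *: b1 + (det2 b1 x / det2 b1 b2) *: b2.
Proof.
by rewrite /det2 => d0; apply: row2P; rewrite !mxE; field.
Qed.

Lemma det2_lin (s t : R) b1 b2 : det2 (s *: b1 + t *: b2) b2 = s * det2 b1 b2.
Proof. by rewrite /det2 !mxE; ring. Qed.

Lemma det2_linr (s t : R) b1 b2 : det2 b1 (s *: b1 + t *: b2) = t * det2 b1 b2.
Proof. by rewrite /det2 !mxE; ring. Qed.

Lemma seq_argmin (T : eqType) (f : T -> R) (s : seq T) (x0 : T) : x0 \in s ->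
  exists2 x : T, x \in s & forall y : T, y \in s -> f x <= f y.
Proof.
elim: s x0 => // a s IH x0 _.
case: s IH => [|b s] IH.
  by exists a; rewrite ?inE// => y; rewrite inE => /eqP ->.
have [|x xs Hx] := IH b; first by rewrite inE eqxx.
have [h|h] := leP (f a) (f x).
  exists a; rewrite ?inE ?eqxx// => y; rewrite inE => /predU1P[->//|ys].
  by apply: le_trans h _; exact: Hx.
exists x; first by rewrite inE xs orbT.
by move=> y; rewrite inE => /predU1P[->|/Hx //]; exact: ltW.
Qed.

Lemma int_interval (M : nat) :
  exists s : seq int, forall z : int, (`|z| <= M%:Z) -> z \in s.
Proof.
exists [seq i%:Z - M%:Z | i <- iota 0 (M + M).+1] => z zM.
apply/mapP; exists (absz (z + M%:Z)); last by lia.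
by rewrite mem_iota; lia.
Qed.

Definition nearest_int (s : R) : int := Num.floor (s + 2^-1).

Lemma nearest_intP s : `|s - (nearest_int s)%:~R| <= 2^-1.
Proof.
have /andP[] := floor_itv (s + 2^-1); rewrite -/(nearest_int s) intrD.
by move=> h1 h2; rewrite ler_norml; lra.
Qed.

End Plane.

Section LatticeBasis.
Context {R : realType} (L : lattice R 2).
Implicit Types (x y v l : 'rV[R]_2).

(** A half-open square of side [e], the separation of the lattice, contains at most one lattice
    point. The list picks one point from each of the finitely many squares that can matter. *)
Lemma lattice_bounded_finite (r : R) :
  exists s : seq 'rV[R]_2, forall l, lattice_set L l -> `|l| <= r -> l \in s.
Proof.
have [e e0 He] := lattice_separated L.
pose fl (x : R) : int := Num.floor (x / e).
pose M := absz (fl r) + absz (fl (- r)).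
have [s Hs] := int_interval M.
pose P (ij : int * int) : set 'rV[R]_2 :=
  [set l | lattice_set L l /\ fl (l 0 0) = ij.1 /\ fl (l 0 1) = ij.2].
exists [seq xget 0 (P (i, j)) | i <- s, j <- s] => l Ll lr.
have fls i : fl (l 0 i) \in s.
  apply: Hs; have /(le_trans (coord_le_norm l i)) := lr.
  rewrite ler_norml => /andP[h1 h2].
  have g1 : (fl (- r) <= fl (l 0 i))%R by apply: le_floor; rewrite ler_pM2r ?invr_gt0.
  have g2 : (fl (l 0 i) <= fl r)%R by apply: le_floor; rewrite ler_pM2r ?invr_gt0.
  by rewrite /M; lia.
have := @xgetPex _ 0 (P (fl (l 0 0), fl (l 0 1))).
case; first by exists l.
set l' := xget _ _ => Ll' /= [E0 E1].
suff <- : l' = l by apply/allpairsP; exists (fl (l 0 0), fl (l 0 1)); split=> //; exact: fls.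
apply/eqP; rewrite -subr_eq0; apply/eqP; apply: He; first exact: lattice_sub.
have key (a b : R) : fl a = fl b -> `|a - b| < e.
  move=> E; have /andP[] := floor_itv (a / e); have /andP[] := floor_itv (b / e).
  rewrite -/(fl a) -/(fl b) E intrD => h1 h2 h3 h4.
  have : `|a / e - b / e| < 1 by rewrite ltr_norml; lra.
  by rewrite -mulrBl normrM normfV (gtr0_norm e0) ltr_pdivrMr// mul1r.
by apply: norm_lt_coord => // i; elim/ord2P: i; rewrite !mxE; exact: key.
Qed.

(** A pair of independent lattice vectors with least determinant is a basis: rounding the
    coordinates of [l] leaves a lattice vector with coordinates at most 1/2, and putting it in place
    of [b1] or [b2] would halve the determinant unless that coordinate is 0. The region [P] makes
    the candidates finite in number and is stable under this replacement. *)
Lemma lattice_basis : exists b1 b2, [/\ lattice_set L b1, lattice_set L b2,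
  det2 b1 b2 != 0 & forall l, lattice_set L l ->
    exists k1 k2 : int, l = k1%:~R *: b1 + k2%:~R *: b2].
Proof.
have [B unitB LB] := lattice_rank L.
pose r0 := row 0 B; pose r1 := row 1 B.
have dB : det2 r0 r1 != 0.
  suff <- : \det B = det2 r0 r1 by rewrite -unitfE -unitmxE.
  by rewrite det_mx22 /det2 !mxE.
pose P x := exists s t : R, [/\ `|s| <= 1, `|t| <= 1 & x = s *: r0 + t *: r1].
have PB x : P x -> `|x| <= `|r0| + `|r1|.
  move=> [s [t [s1 t1 ->]]]; rewrite (le_trans (ler_normD _ _))//.
  by rewrite !normrZ lerD// ler_piMl.
have Pcomb s t x y : P x -> P y -> `|s| <= 2^-1 -> `|t| <= 2^-1 ->
    P (s *: x + t *: y).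
  move=> [s1 [t1 [hs1 ht1 ->]]] [s2 [t2 [hs2 ht2 ->]]] hs ht.
  exists (s * s1 + t * s2), (s * t1 + t * t2); split.
  - rewrite (le_trans (ler_normD _ _))// !normrM.
    have : `|s| * `|s1| <= 2^-1 * 1 by apply: ler_pM.
    have : `|t| * `|s2| <= 2^-1 * 1 by apply: ler_pM.
    by lra.
  - rewrite (le_trans (ler_normD _ _))// !normrM.
    have : `|s| * `|t1| <= 2^-1 * 1 by apply: ler_pM.
    have : `|t| * `|t2| <= 2^-1 * 1 by apply: ler_pM.
    by lra.
  - by apply: row2P; rewrite !mxE; ring.
have [S HS] := lattice_bounded_finite (`|r0| + `|r1|).
pose S' := [seq z <- [seq (x, y) | x <- S, y <- S] |
  `[< [/\ lattice_set L z.1, lattice_set L z.2, P z.1, P z.2 &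
          det2 z.1 z.2 != 0] >]].
have S'P x y : lattice_set L x -> lattice_set L y -> P x -> P y ->
    det2 x y != 0 -> (x, y) \in S'.
  move=> Lx Ly Px Py dxy; rewrite mem_filter; apply/andP; split.
    exact/asboolP.
  by apply/allpairsP; exists (x, y); split=> //; apply: HS => //; exact: PB.
have S'0 : (r0, r1) \in S'.
  apply: S'P => //; [exact: LB|exact: LB|exists 1, 0|exists 0, 1].
    by split; rewrite ?normr1 ?normr0 ?ler01// scale1r scale0r addr0.
  by split; rewrite ?normr1 ?normr0 ?ler01// scale1r scale0r add0r.
have [[b1 b2]] := seq_argmin (fun z => `|det2 z.1 z.2|) S'0.
rewrite mem_filter => /andP[/asboolP/= [Lb1 Lb2 Pb1 Pb2 db] _] bmin.
exists b1, b2; split=> // l Ll.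
pose s := det2 l b2 / det2 b1 b2; pose t := det2 b1 l / det2 b1 b2.
pose k1 := nearest_int s; pose k2 := nearest_int t.
pose s' := s - k1%:~R; pose t' := t - k2%:~R.
have Es : `|s'| <= 2^-1 := nearest_intP s.
have Et : `|t'| <= 2^-1 := nearest_intP t.
have El : l = s *: b1 + t *: b2 := cramer2 l db.
pose l' := s' *: b1 + t' *: b2.
have Ell' : l = l' + (k1%:~R *: b1 + k2%:~R *: b2).
  by rewrite El /l' /s' /t'; apply: row2P; rewrite !mxE; ring.
have Ll' : lattice_set L l'.
  rewrite (_ : l' = l - (k1%:~R *: b1 + k2%:~R *: b2)).
    by apply: lattice_sub => //; apply: latticeD; exact: latticeZ.
  by rewrite {1}Ell' addrK.
have Pl' : P l' by exact: Pcomb.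
have small c : `|c| <= 2^-1 -> c != 0 -> `|det2 b1 b2| <= `|c * det2 b1 b2| ->
    False.
  move=> hc c0; rewrite normrM -{1}[`|det2 b1 b2|]mul1r ler_pM2r ?normr_gt0//.
  by lra.
exists k1, k2; rewrite {1}Ell'.
suff -> : l' = 0 by rewrite add0r.
have -> : l' = 0 *: b1 + 0 *: b2; last by rewrite !scale0r addr0.
rewrite /l'; congr (_ *: _ + _ *: _); apply/eqP; apply: contraT => c0; exfalso.
  apply: (small _ Es c0); rewrite -(det2_lin s' t' b1 b2).
  apply: (bmin (l', b2)); apply: S'P => //.
  by rewrite det2_lin mulf_neq0.
apply: (small _ Et c0); rewrite -(det2_linr s' t' b1 b2).
apply: (bmin (b1, l')); apply: S'P => //.
by rewrite det2_linr mulf_neq0.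
Qed.

Lemma lattice_cocompact : exists2 K : set 'rV[R]_2, compact K &
  forall x, exists2 l, lattice_set L l & K (x - l).
Proof.
have [b1 [b2 [Lb1 Lb2 db _]]] := lattice_basis.
pose r := `|b1| + `|b2|.
exists [set x : 'rV[R]_2 | forall i, [set` `[- r, r]] (x 0 i)].
  apply: (@rV_compact _ _ (fun=> [set` `[- r, r]])) => i.
  exact: segment_compact.
move=> x; pose s := det2 x b2 / det2 b1 b2; pose t := det2 b1 x / det2 b1 b2.
exists ((nearest_int s)%:~R *: b1 + (nearest_int t)%:~R *: b2).
  by apply: latticeD; exact: latticeZ.
move=> i; rewrite /= in_itv/= -ler_norml (le_trans (coord_le_norm _ _))//.
rewrite [X in `|X - _|](cramer2 x db) -/s -/t opprD addrACA -!scalerBl.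
rewrite (le_trans (ler_normD _ _))// !normrZ lerD// ler_piMl//.
  by apply: le_trans (nearest_intP s) _; lra.
by apply: le_trans (nearest_intP t) _; lra.
Qed.

End LatticeBasis.

(** * Lifting a divisor to the plane *)

Section Glue.
Context {R : realType}.

Lemma int_primitive (V : zmodType) (d : int -> V) :
  exists f : int -> V, forall k, f (k + 1) = f k + d k.
Proof.
exists (fun k => match k with
  | Posz m => \sum_(i < m) d i%:Z
  | Negz m => - \sum_(i < m.+1) d (Negz i) end).
move=> [m|[|m]].
- by rewrite -PoszD addn1 big_ord_recr.
- by rewrite (_ : Negz 0 + 1 = Posz 0)// big_ord0 big_ord1 addNr.
rewrite (_ : Negz m.+1 + 1 = Negz m); last by lia.
by rewrite [in RHS]big_ord_recr/= opprD -addrA addNr addr0.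
Qed.

Lemma convex_ball {V : normedModType R} (c x y : V) (e t : R) :
  `|x - c| < e -> `|y - c| < e -> 0 <= t <= 1 -> `|x + t *: (y - x) - c| < e.
Proof.
move=> hx hy /andP[t0 t1].
have -> : x + t *: (y - x) - c = (1 - t) *: (x - c) + t *: (y - c).
  have -> : y - x = (y - c) - (x - c) by rewrite opprB addrA subrK.
  rewrite [LHS]addrAC; set a := x - c; set b := y - c.
  by rewrite scalerBl scale1r scalerBr addrA addrAC.
apply: le_lt_trans (ler_normD _ _) _; rewrite !normrZ (ger0_norm t0).
rewrite ger0_norm ?subr_ge0//.
have [->|tn0] := eqVneq t 0; first by rewrite subr0 mul1r mul0r addr0.
have h1 : t * `|y - c| < t * e by rewrite ltr_pM2l// lt0r tn0.
have h2 : (1 - t) * `|x - c| <= (1 - t) * e.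
  by rewrite ler_wpM2l ?subr_ge0// ltW.
by lra.
Qed.

Context {n : nat}.
Implicit Types (x y : 'rV[R]_n) (l : 'rV[int]_n * R).

(** In a chain of convex sets only consecutive ones meet, so there is no cocycle condition to
    satisfy: the affine differences on the overlaps are summed along the chain by
    [int_primitive]. *)
Lemma glue_int (A : int -> set 'rV[R]_n) (G : int -> 'rV[R]_n -> R) :
  (forall k x y t, A k x -> A k y -> 0 <= t <= 1 -> A k (x + t *: (y - x))) ->
  (forall k k' x, A k x -> A k' x -> [\/ k' = k, k' = k + 1 | k = k' + 1]) ->
  (forall k x, A k x -> A (k + 1) x ->
    loc_affine (fun y => G k y - G (k + 1) y) x) ->
  exists H, forall k, exists l, forall x, A k x -> H x = G k x + affine_fun l x.
Proof.
move=> cA adj HG.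
have Hd k : exists l, forall x, A k x -> A (k + 1) x ->
    G k x - G (k + 1) x = affine_fun l x.
  have [||l Hl] := @loc_affine_convex _ _ (A k `&` A (k + 1))
      (fun y => G k y - G (k + 1) y).
  - by move=> x y t [? ?] [? ?] t01; split; exact: cA.
  - by move=> x [? ?]; exact: HG.
  by exists l => x Ak Ak1; exact: nbhs_singleton (Hl x (conj Ak Ak1)).
pose d k := projT1 (cid (Hd k)).
have dE k x : A k x -> A (k + 1) x -> G k x - G (k + 1) x = affine_fun (d k) x.
  exact: (projT2 (cid (Hd k))).
have [f fE] := int_primitive d.
have step k x : A k x -> A (k + 1) x ->
    G k x + affine_fun (f k) x = G (k + 1) x + affine_fun (f (k + 1)) x.
  move=> Ak Ak1; rewrite fE [affine_fun (_ + _) x]affine_funD -dE//; ring.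
have comp k k' x : A k x -> A k' x ->
    G k x + affine_fun (f k) x = G k' x + affine_fun (f k') x.
  move=> Ak Ak'; have [E|E|E] := adj _ _ _ Ak Ak'; rewrite ?E//.
    by apply: step; rewrite -?E.
  by symmetry; apply: step; rewrite -?E.
exists (fun x => let k := xget 0 [set k | A k x] in G k x + affine_fun (f k) x).
move=> k; exists (f k) => x Ak /=; apply: comp => //.
exact: (@xgetPex _ 0 [set k | A k x] (ex_intro _ k Ak)).
Qed.

End Glue.

Section Lift.
Context {R : realType} (L : lattice R 2) (D : divisor L).
Implicit Types (x y : 'rV[R]_2).
Local Notation pi := (@torus_pi R 2 L).

Lemma divisor_lebesgue_number : exists2 e : R, 0 < e &
  forall x, exists i : div_index D, forall y, `|y - x| < e -> div_dom i (pi y).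
Proof.
have [K /compact_near_coveringP cK HK] := lattice_cocompact L.
pose P (e : R) x := exists i : div_index D,
  forall y, `|y - x| < e -> div_dom i (pi y).
have : \forall e \near 0^'+, K `<=` P e.
  apply: cK => x _; have [i Ui] := div_cover D (pi x).
  have /nearP[e e0 He] := torus_pi_near (@div_open _ _ _ D i) Ui.
  have e20 : 0 < e / 2 by exact: divr_gt0.
  exists ([set x' | `|x' - x| < e / 2], [set d | d < e / 2]).
    by split=> /=; [|exact: nbhs_right_lt]; apply/(@nearP R _ (x : 'rV[R]_2)); exists (e / 2).
  move=> [x' d] /= [xx' de]; exists i => y yx'; apply: He.
  have -> : y - x = (y - x') + (x' - x) by rewrite addrA subrK.
  rewrite (le_lt_trans (ler_normD _ _))// [e]splitr ltrD//.
  exact: lt_trans yx' de.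
move=> HP.
have [e [e0 He]] : exists e, 0 < e /\ K `<=` P e.
  near (0 : R)^'+ => e; exists e; split; [near: e; exact: nbhs_right_gt|].
  by near: e.
exists e => // x; have [l Ll Kx] := HK x; have [i Hi] := He _ Kx.
exists i => y yx; rewrite -(torus_piD y (latticeN Ll)); apply: Hi.
by rewrite opprD addrACA subrr addr0.
Unshelve. all: by end_near. Qed.

(** The plane is covered by the open squares of radius [e] around the points of the grid of mesh
    [e], each inside a single chart. Gluing the squares of each row into strips, and then the
    strips, reduces the problem to [glue_int] twice, with convex overlaps each time. *)
Lemma divisor_lift : exists F : 'rV[R]_2 -> R, forall x (i : div_index D),
  div_dom i (pi x) -> loc_affine (fun y => F y - div_fun i (pi y)) x.
Proof.
have [e e0 He] := divisor_lebesgue_number.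
pose idx x := projT1 (cid (He x)).
have idxP x y : `|y - x| < e -> div_dom (idx x) (pi y).
  exact: (projT2 (cid (He x))).
pose c (j k : int) : 'rV[R]_2 :=
  \row_i (if i == 0 then j%:~R * e else k%:~R * e).
pose G j k x := div_fun (idx (c j k)) (pi x).
have fl (r : R) : exists j : int, `|r - j%:~R * e| < e.
  exists (Num.floor (r / e)); have /andP[] := floor_itv (r / e).
  rewrite ler_pdivlMr// ltr_pdivrMr// intrD mulrDl mul1r => h1 h2.
  by rewrite ltr_norml; lra.
have adj (r : R) (j j' : int) : `|r - j%:~R * e| < e -> `|r - j'%:~R * e| < e ->
    [\/ j' = j, j' = j + 1 | j = j' + 1].
  move=> h1 h2; have : `|(j - j')%:~R| < (2%:~R : R).
    rewrite -(ltr_pM2r e0) -{1}(gtr0_norm e0) -normrM intrB mulrBl.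
    by move: h1 h2; rewrite !ltr_norml; lra.
  rewrite -intr_norm ltr_int => ?.
  have [E|[E|E]] : j' = j \/ j' = j + 1 \/ j = j' + 1 by lia.
  - exact: Or31.
  - exact: Or32.
  - exact: Or33.
have GG j k j' k' x : `|x - c j k| < e -> `|x - c j' k'| < e ->
    loc_affine (fun y => G j k y - G j' k' y) x.
  by move=> h1 h2; apply: div_compat; split; exact: idxP.
have row_glue k : exists H, forall j, exists l, forall x, `|x - c j k| < e ->
    H x = G j k x + affine_fun l x.
  apply: (@glue_int _ _ (fun j => [set x | `|x - c j k| < e]) (G ^~ k)).
  - by move=> j x y t; exact: convex_ball.
  - move=> j j' x h1 h2; apply: (@adj (x 0 0)).
      by have := le_lt_trans (coord_le_norm _ 0) h1; rewrite !mxE.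
    by have := le_lt_trans (coord_le_norm _ 0) h2; rewrite !mxE.
  - by move=> j x; exact: GG.
pose H k := projT1 (cid (row_glue k)).
have HE k j : exists l, forall x, `|x - c j k| < e ->
    H k x = G j k x + affine_fun l x.
  exact: (projT2 (cid (row_glue k))).
have inball j k x : `|x 0 0 - j%:~R * e| < e -> `|x 0 1 - k%:~R * e| < e ->
    `|x - c j k| < e.
  by move=> h1 h2; apply: norm_lt_coord => // i; elim/ord2P: i; rewrite !mxE.
have nball j k x : `|x - c j k| < e -> \forall y \near x, `|y - c j k| < e.
  move=> xe; apply/nearP; exists (e - `|x - c j k|); first by rewrite subr_gt0.
  move=> y; rewrite ltrBrDr => /(le_lt_trans _); apply.
  by rewrite (le_trans _ (ler_normD _ _))// addrA subrK.
have HG j k x : `|x - c j k| < e -> loc_affine (fun y => H k y - G j k y) x.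
  move=> xe; have [l Hl] := HE k j; exists l.
  by apply: filterS (nball _ _ _ xe) => y /Hl ->; rewrite addrAC subrr add0r.
have [F HF] : exists F, forall k, exists l, forall x,
    `|x 0 1 - k%:~R * e| < e -> F x = H k x + affine_fun l x.
  apply: (@glue_int _ _ (fun k => [set x | `|x 0 1 - k%:~R * e| < e]) H).
  - move=> k x y t hx hy t01 /=; rewrite !mxE.
    by have := @convex_ball _ R^o (k%:~R * e) (x 0 1) (y 0 1) e t; exact.
  - by move=> k k' x h1 h2; exact: (@adj (x 0 1)).
  - move=> k x /= h1 h2; have [j hj] := fl (x 0 0).
    have b1 := inball _ _ _ hj h1; have b2 := inball _ _ _ hj h2.
    have := loc_affineD (loc_affineB (HG _ _ _ b1) (HG _ _ _ b2))
                        (GG _ _ _ _ _ b1 b2).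
    by apply: loc_affine_ext; near=> y; ring.
exists F => x i Ui.
have [j hj] := fl (x 0 0); have [k hk] := fl (x 0 1).
have xb := inball _ _ _ hj hk; have [l Hl] := HF k.
have FH : loc_affine (fun y => F y - H k y) x.
  exists l; near=> y; rewrite Hl ?[_ - H k y]addrAC ?subrr ?add0r//.
  have : `|y - c j k| < e by near: y; exact: nball.
  by move=> /(le_lt_trans (coord_le_norm _ 1)); rewrite !mxE.
have Gi : loc_affine (fun y => G j k y - div_fun i (pi y)) x.
  by apply: div_compat; split=> //; exact: idxP.
apply: loc_affine_ext (loc_affineD (loc_affineD FH (HG _ _ _ xb)) Gi).
by near=> y; ring.
Unshelve. all: by end_near. Qed.

End Lift.

(** * Tangent cones of piecewise linear functions *)

Section Cones.
Context {R : realType} {n : nat}.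
Implicit Types (x y z : 'rV[R]_n) (a b : 'rV[int]_n) (G A B phi : 'rV[R]_n -> R).

(** The tangent cone of [G] at [x]. The second clause makes it piecewise linear with finitely many
    integral slopes, and the Lipschitz clause provides continuity. *)
Definition is_cone G x phi : Prop :=
  [/\ forall t y, 0 <= t -> phi (t *: y) = t * phi y,
      exists S : seq 'rV[int]_n, forall y, exists2 a, a \in S & phi y = dot a y,
      exists2 K : R, 0 < K & forall y z, `|phi y - phi z| <= K * `|y - z| &
      \forall y \near x, G y = G x + phi (y - x)].

Lemma cone0 G x phi : is_cone G x phi -> phi 0 = 0.
Proof. by case=> [H _ _ _]; rewrite -(scale0r 0) H// mul0r. Qed.

Lemma cone_near G x phi (e : R) : is_cone G x phi -> 0 < e ->
  \forall y \near x, `|G y - G x| < e.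
Proof.
move=> Gphi e0; have p0 := cone0 Gphi; case: Gphi => [_ _ [K K0 HK] HG].
near=> y; have -> : G y = G x + phi (y - x) by near: y.
rewrite addrAC subrr add0r -[phi _]subr0 -p0 (le_lt_trans (HK _ _))// subr0.
by rewrite mulrC -ltr_pdivlMr//; near: y; apply: near_rV; exact: divr_gt0.
Unshelve. all: by end_near. Qed.

Lemma cone_affine l x : is_cone (affine_fun l) x (dot l.1).
Proof.
split.
- by move=> t y _; exact: dotZr.
- by exists [:: l.1] => y; exists l.1; rewrite ?inE.
- have [K K0 HK] := @dot_bound R _ l.1; exists K => // y z.
  by rewrite -dotBr.
- by near=> y; rewrite -affine_fun_at subrKC.
Unshelve. all: by end_near. Qed.

Lemma cone_ext G H x phi : (\forall y \near x, G y = H y) ->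
  is_cone G x phi -> is_cone H x phi.
Proof.
move=> GH [? ? ? HG]; split=> //; near=> y.
rewrite -(near GH y)// -(nbhs_singleton GH).
by near: y.
Unshelve. all: by end_near. Qed.

Lemma coneB A B x phi psi : is_cone A x phi -> is_cone B x psi ->
  is_cone (fun y => A y - B y) x (fun y => phi y - psi y).
Proof.
move=> [hA [S HS] [K K0 HK] nA] [hB [T HT] [M M0 HM] nB]; split.
- by move=> t y t0; rewrite hA// hB// mulrBr.
- exists [seq a - b | a <- S, b <- T] => y.
  have [a aS ->] := HS y; have [b bT ->] := HT y.
  by exists (a - b); [apply/allpairsP; exists (a, b)|rewrite dotBl].
- exists (K + M) => [|y z]; first exact: addr_gt0.
  have -> : phi y - psi y - (phi z - psi z) = (phi y - phi z) + (psi z - psi y).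
    by ring.
  rewrite (le_trans (ler_normD _ _))// mulrDl lerD//.
  by rewrite distrC.
- near=> y; have -> : A y = A x + phi (y - x) by near: y.
  have -> : B y = B x + psi (y - x) by near: y.
  by rewrite opprD addrACA.
Unshelve. all: by end_near. Qed.

Lemma cone_max A B x phi psi : is_cone A x phi -> is_cone B x psi ->
  exists chi, is_cone (fun y => Num.max (A y) (B y)) x chi.
Proof.
have strict A' B' phi' psi' : is_cone A' x phi' -> is_cone B' x psi' ->
    A' x < B' x -> \forall y \near x, A' y < B' y.
  move=> cA cB AB; pose e := (B' x - A' x) / 2.
  have e0 : 0 < e by rewrite divr_gt0// subr_gt0.
  near=> y.
  have : `|A' y - A' x| < e by near: y; exact: cone_near cA e0.
  have : `|B' y - B' x| < e by near: y; exact: cone_near cB e0.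
  by rewrite /e !ltr_norml; lra.
move=> cA cB; have [AB|AB|AB] := ltgtP (A x) (B x).
- have N := strict _ _ _ _ cA cB AB; exists psi; apply: cone_ext cB.
  by near=> y; rewrite max_r// ltW//; near: y; exact: N.
- have N := strict _ _ _ _ cB cA AB; exists phi; apply: cone_ext cA.
  by near=> y; rewrite max_l// ltW//; near: y; exact: N.
exists (fun y => Num.max (phi y) (psi y)).
case: cA cB => [hA [S HS] [K K0 HK] nA] [hB [T HT] [M M0 HM] nB]; split.
- by move=> t y t0; rewrite hA// hB// maxr_pMr.
- exists (S ++ T) => y; have [a aS Ea] := HS y; have [b bT Eb] := HT y.
  case: (leP (phi y) (psi y)) => _.
    by exists b; rewrite // mem_cat bT orbT.
  by exists a; rewrite // mem_cat aS.
- exists (K + M) => [|y z]; first exact: addr_gt0.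
  rewrite mulrDl; have := HK y z; have := HM y z; rewrite !ler_norml.
  by case: (leP (phi y) (psi y)); case: (leP (phi z) (psi z)); lra.
- near=> y; have -> : A y = A x + phi (y - x) by near: y.
  have -> : B y = B x + psi (y - x) by near: y.
  by rewrite AB maxxx addr_maxr.
Unshelve. all: by end_near. Qed.

Lemma cone_max_affine l0 s x : exists phi, is_cone (max_affine l0 s) x phi.
Proof.
elim: s => [|l s [phi IH]].
  exists (dot l0.1); apply: cone_ext (cone_affine l0 x).
  by near=> y; rewrite /max_affine big_nil.
have [chi Hchi] := cone_max (cone_affine l x) IH; exists chi.
by apply: cone_ext Hchi; near=> y; rewrite {2}/max_affine big_cons.
Unshelve. all: by end_near. Qed.

Lemma near_all_seq (T : eqType) (s : seq T) (P : T -> 'rV[R]_n -> Prop) x :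
  (forall b : T, b \in s -> \forall y \near x, P b y) ->
  \forall y \near x, forall b : T, b \in s -> P b y.
Proof.
elim: s => [|c s IH] H; first by near=> y.
have H1 := H c (mem_head c s).
have H2 : \forall y \near x, forall b : T, b \in s -> P b y.
  by apply: IH => b bs; apply: H; rewrite inE bs orbT.
near=> y => b; rewrite inE => /predU1P[->|]; first by near: y.
by move: b; near: y.
Unshelve. all: by end_near. Qed.

(** At a point where the linear functions of [S] take distinct values, continuity keeps [phi] away
    from all branches except the one it takes at [y]. *)
Lemma selection_affine (S : seq 'rV[int]_n) phi (K : R) y : 0 < K ->
  (forall z, exists2 a, a \in S & phi z = dot a z) ->
  (forall z z', `|phi z - phi z'| <= K * `|z - z'|) ->
  (forall a b, a \in S -> b \in S -> a != b -> dot (a - b) y != 0) ->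
  exists2 a, a \in S & \forall z \near y, phi z = dot a z.
Proof.
move=> K0 HS HK gen; have [a aS Ea] := HS y; exists a => //.
suff H : \forall z \near y, forall b, b \in S -> b != a -> phi z != dot b z.
  near=> z; have [b bS Eb] := HS z.
  have [<-//|ba] := eqVneq b a.
  suff : phi z != dot b z by rewrite Eb eqxx.
  by move: b {Eb} bS ba; near: z.
apply: near_all_seq => b bS; have [->|ba] := eqVneq b a; first by near=> z.
have := gen _ _ aS bS; rewrite eq_sym => /(_ ba); rewrite dotBl -Ea => d0.
pose e := `|phi y - dot b y| / 2.
have e0 : 0 < e by rewrite divr_gt0// normr_gt0.
have /continuous_atP/(_ e e0) Hb := @dot_continuous R _ b y.
near=> z; move=> _; apply/eqP => Ez.
have h1 : `|dot b y - dot b z| < e by near: z.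
have h2 : `|phi y - phi z| < e.
  rewrite (le_lt_trans (HK _ _))// mulrC -ltr_pdivlMr// distrC.
  by near: z; apply: near_rV; exact: divr_gt0.
have : `|phi y - dot b y| < e + e.
  rewrite -(subrK (phi z) (phi y)) -addrA (le_lt_trans (ler_normD _ _))//.
  by rewrite ltrD// Ez distrC.
by rewrite /e -splitr ltxx.
Unshelve. all: by end_near. Qed.

End Cones.

(** * Periods of the lift *)

Section QuasiPeriodic.
Context {R : realType} {n : nat} (L : lattice R n).
Implicit Types (x y l m : 'rV[R]_n) (F : 'rV[R]_n -> R).

Definition quasi_periodic F (a : 'rV[R]_n -> 'rV[int]_n) (b : 'rV[R]_n -> R) :=
  forall l, lattice_set L l -> forall x, F (x + l) = F x + (dot (a l) x + b l).

Lemma quasi_periodicN F a b : quasi_periodic F a b ->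
  quasi_periodic (fun x => - F x) (fun l => - a l) (fun l => - b l).
Proof. by move=> H l Ll x; rewrite H// dotNl !opprD. Qed.

Context (F : 'rV[R]_n -> R) (a : 'rV[R]_n -> 'rV[int]_n) (b : 'rV[R]_n -> R).
Context (Fab : quasi_periodic F a b).

Let cocycle l m x : lattice_set L l -> lattice_set L m ->
  dot (a (l + m)) x + b (l + m) =
  dot (a l) x + dot (a m) x + (b l + b m + dot (a m) l).
Proof.
move=> Ll Lm; apply: (addrI (F x)); rewrite -Fab; last exact: latticeD.
by rewrite addrA !Fab// dotDr; ring.
Qed.

Lemma period_constD l m : lattice_set L l -> lattice_set L m ->
  b (l + m) = b l + b m + dot (a m) l.
Proof. by move=> Ll Lm; have := cocycle 0 Ll Lm; rewrite !dot0r !add0r. Qed.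

Lemma period_slopeD l m : lattice_set L l -> lattice_set L m ->
  a (l + m) = a l + a m.
Proof.
move=> Ll Lm; apply: (@dot_inj R) => x; rewrite dotDl.
by have := cocycle x Ll Lm; rewrite period_constD// => /addIr.
Qed.

Lemma period_slope_sym l m : lattice_set L l -> lattice_set L m ->
  dot (a l) m = dot (a m) l.
Proof.
move=> Ll Lm; have := period_constD Lm Ll; rewrite addrC period_constD//.
by rewrite [b m + b l]addrC => /addrI ->.
Qed.

Lemma period_slopeZ (k : int) l : lattice_set L l ->
  a (k%:~R *: l) = k *: a l.
Proof.
move=> Ll.
have a0 : a 0 = 0.
  have := period_slopeD (lattice_0 L) (lattice_0 L).
  by rewrite addr0 => /eqP; rewrite -subr_eq0 opprD addNKr oppr_eq0 => /eqP.
have aN m : lattice_set L m -> a (- m) = - a m.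
  move=> Lm; apply/eqP; rewrite -addr_eq0 -period_slopeD ?addNr ?a0//.
  exact: latticeN.
have an (m : nat) : a (m%:R *: l) = m%:Z *: a l.
  elim: m => [|m IH]; first by rewrite !scale0r.
  have -> : m.+1%:R *: l = l + m%:R *: l by rewrite mulrS scalerDl scale1r.
  rewrite period_slopeD ?IH ?intS ?scalerDl ?scale1r//.
  by rewrite scaler_nat; exact: latticeMn.
case: k => m; first exact: an.
rewrite NegzE mulrNz !scaleNr aN ?an//.
by rewrite -pmulrn scaler_nat; exact: latticeMn.
Qed.

End QuasiPeriodic.

(** * Lifts of a divisor: tangent cones, periods, facets *)

Section LiftTheory.
Context {R : realType} (L : lattice R 2) (D : divisor L).
Implicit Types (x y q : 'rV[R]_2) (F : 'rV[R]_2 -> R) (a b u : 'rV[int]_2).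
Local Notation pi := (@torus_pi R 2 L).

Definition is_lift (E : divisor L) F : Prop := forall x (i : div_index E),
  div_dom i (pi x) -> loc_affine (fun y => F y - div_fun i (pi y)) x.

Lemma is_lift_opp F : is_lift D F -> is_lift (opp_divisor D) (fun x => - F x).
Proof.
move=> HF x i Ui; have := loc_affineN (HF x i Ui).
by apply: loc_affine_ext; near=> y; rewrite opprD.
Unshelve. all: by end_near. Qed.

Context (F : 'rV[R]_2 -> R).
Context (DF : is_lift D F).

Lemma lift_cone x : exists phi, is_cone F x phi.
Proof.
have [i Ui] := div_cover D (pi x); have [l Hl] := DF Ui.
have [_ /(_ _ Ui)[W [g [h [oW [Wx WU] [_ rg] [_ rh] E]]]]] := div_rational i.
have [k0 [s Hs]] := rg _ Wx; have [k1 [t Ht]] := rh _ Wx.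
have [phi Hphi] := cone_max_affine k0 s x.
have [psi Hpsi] := cone_max_affine k1 t x.
exists (fun y => dot l.1 y - (psi y - phi y)).
apply: cone_ext (coneB (cone_affine l x) (coneB Hpsi Hphi)).
have WW := torus_pi_near oW Wx; near=> y.
have <- : F y - div_fun i (pi y) = affine_fun l y by near: y.
have -> : div_fun i (pi y) = g (pi y) - h (pi y) by apply: E; near: y.
have -> : g (pi y) = max_affine k0 s y by near: y.
have -> : h (pi y) = max_affine k1 t y by near: y.
by ring.
Unshelve. all: by end_near. Qed.

(** The local equations of the divisor live on the torus, hence cancel in [F (x + l) - F x], which
    is locally affine on the whole plane and therefore affine. *)
Lemma lift_quasi_periodic : exists (a : _ -> 'rV[int]_2) (b : _ -> R),
  quasi_periodic L F a b.
Proof.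
have H l : exists k : 'rV[int]_2 * R, lattice_set L l ->
    forall x, F (x + l) = F x + affine_fun k x.
  have [Ll|nLl] := pselect (lattice_set L l); last by exists (0, 0).
  have [||k Hk] := @loc_affine_convex R 2 setT (fun x => F (x + l) - F x).
  - by [].
  - move=> x _; have [i Ui] := div_cover D (pi x).
    have Uil : div_dom i (pi (x + l)) by rewrite torus_piD.
    have := loc_affineB (loc_affine_translate (DF Uil)) (DF Ui).
    by apply: loc_affine_ext; near=> y; rewrite torus_piD//; ring.
  exists k => _ x; rewrite -(nbhs_singleton (Hk x I)).
  by rewrite subrKC.
exists (fun l => (projT1 (cid (H l))).1), (fun l => (projT1 (cid (H l))).2).
by move=> l Ll x; rewrite (projT2 (cid (H l)) Ll).
Unshelve. all: by end_near. Qed.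

Lemma lift_support x : Defs.support D x <-> ~ loc_affine F x.
Proof.
split=> [[i Ui nA] AF|nA].
  apply: nA; have := loc_affineB AF (DF Ui).
  by apply: loc_affine_ext; near=> y; ring.
have [i Ui] := div_cover D (pi x); exists i => // Ai; apply: nA.
have := loc_affineD (DF Ui) Ai.
by apply: loc_affine_ext; near=> y; ring.
Unshelve. all: by end_near. Qed.

Definition facet (G : 'rV[R]_2 -> R) q u (w : int) : Prop :=
  [/\ primitive u, w != 0 & exists a b, a - b = w *: u /\
    \forall y \near q, G y = G q +
      dot (if 0 <= dot u (y - q) then a else b) (y - q)].

Lemma lift_facet q u w : facet_at D q u w <-> facet F q u w.
Proof.
split.
  move=> [pu w0 [i [a [b [Ui ab Hab]]]]]; split=> //.
  have [l Hl] := DF Ui; exists (a + l.1), (b + l.1).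
  split; first by rewrite opprD addrACA subrr addr0.
  have E := nbhs_singleton Hl; near=> y.
  have Ey : F y - div_fun i (pi y) = affine_fun l y by near: y.
  have Dy : div_fun i (pi y) = div_fun i (pi q) +
    dot (if 0 <= dot u (y - q) then a else b) (y - q) by near: y.
  have -> : F y = affine_fun l y + div_fun i (pi y) by rewrite -Ey subrK.
  have -> : F q = affine_fun l q + div_fun i (pi q) by rewrite -E subrK.
  have El : affine_fun l y = affine_fun l q + dot l.1 (y - q).
  by rewrite -affine_fun_at subrKC.
rewrite Dy El.
  by case: ifP => _; rewrite dotDl; ring.
move=> [pu w0 [a [b [ab Hab]]]]; split=> //.
have [i Ui] := div_cover D (pi q); have [l Hl] := DF Ui.
exists i, (a - l.1), (b - l.1); split=> //.
  by rewrite opprB addrA subrK.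
have E := nbhs_singleton Hl; near=> y.
have Ey : F y - div_fun i (pi y) = affine_fun l y by near: y.
have Dy : F y = F q +
  dot (if 0 <= dot u (y - q) then a else b) (y - q) by near: y.
have -> : div_fun i (pi y) = F y - affine_fun l y by rewrite -Ey; ring.
have -> : div_fun i (pi q) = F q - affine_fun l q by rewrite -E; ring.
have El : affine_fun l y = affine_fun l q + dot l.1 (y - q).
  by rewrite -affine_fun_at subrKC.
rewrite Dy El.
by case: ifP => _; rewrite dotBl; ring.
Unshelve. all: by end_near. Qed.

End LiftTheory.

(** * Edges and fans *)

Section Primitive.
Implicit Types (d u v : 'rV[int]_2).

Definition rot d : 'rV[int]_2 := \row_i (if i == 0 then - d 0 1 else d 0 0).

Lemma lattice_length2 d : lattice_length d = gcdn `|d 0 0%R| `|d 0 1%R|.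
Proof.
rewrite /lattice_length !big_ord_recl big_ord0 gcdn0.
by rewrite (_ : lift ord0 ord0 = 1)//; exact: val_inj.
Qed.

Lemma primitiveP d : primitive d <-> exists p q, p * d 0 0 + q * d 0 1 = 1.
Proof.
rewrite /primitive lattice_length2; split=> [g1|[p [q E]]].
  have [p [q E]] := Bezoutz (d 0 0) (d 0 1); exists p, q.
  by rewrite E /gcdz g1.
apply/eqP; rewrite -dvdn1; set g := gcdn _ _.
have : (g%:Z %| p * d 0%R 0%R + q * d 0%R 1%R)%Z.
  apply: rpredD; apply: dvdz_mull; [exact: (dvdz_gcdl (d 0%R 0%R) (d 0%R 1%R))
    |exact: (dvdz_gcdr (d 0%R 0%R) (d 0%R 1%R))].
by rewrite E.
Qed.

Lemma primitive_neq0 d : primitive d -> d != 0.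
Proof.
move=> /primitiveP[p [q E]]; apply/eqP => d0; move: E.
by rewrite d0 !mxE !mulr0.
Qed.

Lemma primitiveN d : primitive d -> primitive (- d).
Proof.
move=> /primitiveP[p [q E]]; apply/primitiveP; exists (- p), (- q).
by rewrite !mxE !mulrNN.
Qed.

Lemma primitive_rot d : primitive d -> primitive (rot d).
Proof.
move=> /primitiveP[p [q E]]; apply/primitiveP; exists (- q), p.
by rewrite !mxE /= mulrNN addrC.
Qed.

Lemma primitive_parallel d u : primitive d -> primitive u ->
  d 0 0 * u 0 1 = d 0 1 * u 0 0 -> u = d \/ u = - d.
Proof.
move=> /primitiveP[p [q E]] /primitiveP[p' [q' E']] du.
pose k := p * u 0 0 + q * u 0 1.
have k0 : u 0 0 = k * d 0 0.
  rewrite -[LHS]mulr1 -E /k mulrDl mulrDr -!mulrA; congr (_ + _); first ring.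
  by rewrite [u 0 1 * _]mulrC du; ring.
have k1 : u 0 1 = k * d 0 1.
  rewrite -[LHS]mulr1 -E /k mulrDl mulrDr -!mulrA; congr (_ + _); last ring.
  by rewrite [u 0 0 * _]mulrC -du; ring.
have Ek : k * (p' * d 0 0 + q' * d 0 1) = 1 by rewrite -E' k0 k1; ring.
have : (k %| 1)%Z by apply/dvdzP; exists (p' * d 0 0 + q' * d 0 1); rewrite mulrC.
rewrite dvdz1 => k1'; have [E1|E1] : k = 1 \/ k = -1 by lia.
  by left; apply/rowP => i; elim/ord2P: i; rewrite ?k0 ?k1 E1 mul1r.
by right; apply/rowP => i; elim/ord2P: i; rewrite mxE ?k0 ?k1 E1 mulN1r.
Qed.

Lemma primitive_multiple v : v != 0 ->
  exists (g : int) d, [/\ primitive d, 0 < g & v = g *: d].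
Proof.
move=> v0; pose g : int := gcdz (v 0 0) (v 0 1).
have g0 : 0 < g.
  rewrite lt_def; apply/andP; split; last by rewrite /g /gcdz.
  rewrite gcdz_eq0; apply: contra v0 => /andP[/eqP h0 /eqP h1].
  by apply/eqP/rowP => i; elim/ord2P: i; rewrite mxE.
exists g, (\row_i divz (v 0 i) g).
have E i : v 0 i = g * divz (v 0 i) g.
  rewrite mulrC divzK//; elim/ord2P: i; [exact: dvdz_gcdl|exact: dvdz_gcdr].
split=> //; last by apply/rowP => i; rewrite !mxE -E.
have [p [q H]] := Bezoutz (v 0 0) (v 0 1).
apply/primitiveP; exists p, q; rewrite !mxE.
apply: (mulfI (lt0r_neq0 g0)); rewrite mulr1 mulrDr !(mulrCA g) -!E H.
by [].
Qed.

End Primitive.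

Section EdgeGerms.
Context {R : realType}.
Implicit Types (d u a b : 'rV[int]_2) (x y z v : 'rV[R]_2) (w : int)
  (F : 'rV[R]_2 -> R) (la lb : 'rV[int]_2 * R).

Definition rv d : 'rV[R]_2 := map_mx intr d.

Lemma rvN d : rv (- d) = - rv d.
Proof. by rewrite /rv map_mxN. Qed.

Lemma rv_eq0 d : (rv d == 0) = (d == 0).
Proof.
apply/eqP/eqP => [E|->]; last by apply/rowP => i; rewrite !mxE.
apply/rowP => i; apply/eqP; have := congr1 (fun M : 'rV[R]_2 => M 0 i) E.
by rewrite !mxE => /eqP; rewrite intr_eq0.
Qed.

Lemma dot2 a x : dot a x = (a 0 0)%:~R * x 0 0 + (a 0 1)%:~R * x 0 1.
Proof.
rewrite /dot !big_ord_recl big_ord0 addr0.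
by rewrite (_ : lift ord0 ord0 = 1)//; exact: val_inj.
Qed.

Lemma dot_rot d x : dot (rot d) x = det2 (rv d) x.
Proof. by rewrite dot2 /det2 !mxE /= mulrNz; ring. Qed.

Lemma det2DZ x y v (t : R) : det2 x (y + t *: v) = det2 x y + t * det2 x v.
Proof. by rewrite /det2 !mxE; ring. Qed.

Lemma det2Dr x y z : det2 x (y + z) = det2 x y + det2 x z.
Proof. by rewrite /det2 !mxE; ring. Qed.

Lemma det2xx x : det2 x x = 0.
Proof. by rewrite /det2; ring. Qed.

Lemma det2C x y : det2 x y = - det2 y x.
Proof. by rewrite /det2; ring. Qed.

Lemma det2Nl x y : det2 (- x) y = - det2 x y.
Proof. by rewrite /det2 !mxE; ring. Qed.

Lemma det2Nr x y : det2 x (- y) = - det2 x y.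
Proof. by rewrite /det2 !mxE; ring. Qed.

Lemma det2Zl (t : R) x y : det2 (t *: x) y = t * det2 x y.
Proof. by rewrite /det2 !mxE; ring. Qed.

Lemma det2Zr (t : R) x y : det2 x (t *: y) = t * det2 x y.
Proof. by rewrite /det2 !mxE; ring. Qed.

Lemma det2_rot_gt0 d : d != 0 -> 0 < det2 (rv d) (rv (rot d)).
Proof.
move=> d0; rewrite -dot_rot dot2 !mxE /= -!intrM -intrD ltr0z.
rewrite lt_neqAle addr_ge0 ?andbT; last 2 first.
- by rewrite mulrNN -expr2 sqr_ge0.
- by rewrite -expr2 sqr_ge0.
rewrite eq_sym paddr_eq0 ?mulrNN -?expr2 ?sqr_ge0//.
rewrite !sqrf_eq0; apply: contra d0 => /andP[/eqP h1 /eqP h0].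
by apply/eqP/rowP => i; elim/ord2P: i; rewrite mxE.
Qed.

(** The same crease as in [facet], described by the direction of the edge instead of its conormal;
    [la] is on the left of [d]. The two affine functions are kept with their constants, so that they
    stay the same while [z] moves along the edge. The weight 0 is allowed. *)
Definition edge_germ F z d w la lb : Prop :=
  la.1 - lb.1 = w *: rot d /\ \forall y \near z,
    (0 <= det2 (rv d) (y - z) -> F y = affine_fun la y) /\
    (det2 (rv d) (y - z) <= 0 -> F y = affine_fun lb y).

Lemma edge_germN F z d w la lb :
  edge_germ F z d w la lb -> edge_germ F z (- d) w lb la.
Proof.
move=> [E H]; split.
  rewrite -opprB E -scalerN; congr (_ *: _).
  by apply/rowP => i; rewrite !mxE; case: ifP.
apply: filterS H => y [h1 h2]; split; rewrite rvN det2Nl.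
  by rewrite oppr_ge0.
by rewrite oppr_le0.
Qed.

Lemma edge_germ_move F z d w la lb : edge_germ F z d w la lb ->
  \forall t \near (0 : R), edge_germ F (z + t *: rv d) d w la lb.
Proof.
move=> [E /near_join/(near_line0 (rv d)) H]; near=> t; split=> //.
have : \forall y \near z + t *: rv d,
    (0 <= det2 (rv d) (y - z) -> F y = affine_fun la y) /\
    (det2 (rv d) (y - z) <= 0 -> F y = affine_fun lb y) by near: t.
apply: filterS => y.
have -> : det2 (rv d) (y - z) = det2 (rv d) (y - (z + t *: rv d)).
  by rewrite opprD addrA -scaleNr det2DZ det2xx mulr0 addr0.
by [].
Unshelve. all: by end_near. Qed.

Lemma positive_side d z (P : set 'rV[R]_2) : d != 0 ->
  (\forall y \near z, P y) ->
  exists y, \forall y' \near y, 0 < det2 (rv d) (y' - z) /\ P y'.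
Proof.
move=> d0 /near_join/(near_line0 (rv (rot d)))/near0_pos[e e0 He].
exists (z + e *: rv (rot d)).
have : \forall y \near z + e *: rv (rot d), P y by apply: He; rewrite gtr0_norm.
have E x : det2 (rv d) (x - z) = det2 (rv d) x - det2 (rv d) z.
  by rewrite -scaleN1r det2DZ mulN1r.
have e0' : 0 < e * det2 (rv d) (rv (rot d)) by rewrite mulr_gt0// det2_rot_gt0.
have /continuous_atP/(_ _ e0') := @dot_continuous R _ (rot d)
  (z + e *: rv (rot d)).
apply: filterS2 => y; rewrite !dot_rot det2DZ E ltr_norml => /andP[_ h] Py.
by split=> //; lra.
Qed.

Lemma edge_germ_unique F z d w la lb l : d != 0 -> edge_germ F z d w la lb ->
  (\forall y \near z, 0 < det2 (rv d) (y - z) -> F y = affine_fun l y) ->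
  la = l.
Proof.
move=> d0 [_ H] Hl.
have [y Hy] := positive_side d0 (filterI H Hl).
apply: (@affine_eq_near R _ _ _ y); apply: filterS Hy => y' [y0 [[h _] h']].
by rewrite -h ?h'// ltW.
Qed.

Lemma edge_germ_inj F z d w la lb w' la' lb' : d != 0 ->
  edge_germ F z d w la lb -> edge_germ F z d w' la' lb' ->
  [/\ w = w', la = la' & lb = lb'].
Proof.
move=> d0 H H'.
have Ea : la = la'.
  apply: (edge_germ_unique d0 H); case: H' => _; apply: filterS => y [h _].
  by move=> ?; apply: h; rewrite ltW.
have Eb : lb = lb'.
  have dN0 : - d != 0 by rewrite oppr_eq0.
  apply: (edge_germ_unique dN0 (edge_germN H)).
  have [_] := edge_germN H'; apply: filterS => y [h _].
  by move=> ?; apply: h; rewrite ltW.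
split=> //; case: H H' => [E _] [E' _].
have rd : (w - w') *: rot d = 0 by rewrite scalerBl -E -E' Ea Eb subrr.
apply/eqP; rewrite -subr_eq0; apply: contraNT d0 => ww'.
have r i : rot d 0 i = 0.
  apply: (mulfI ww'); rewrite mulr0.
  by have := congr1 (fun M : 'rV[int]_2 => M 0 i) rd; rewrite !mxE.
apply/eqP/rowP => i; elim/ord2P: i; [have := r 1|have := r 0].
  by rewrite !mxE.
by rewrite !mxE/= => /eqP; rewrite oppr_eq0 => /eqP.
Qed.

(** An affine germ is an edge germ of weight 0, and the weight is determined by the germ. *)
Lemma edge_germ_not_affine F z d w la lb : d != 0 -> w != 0 ->
  edge_germ F z d w la lb -> ~ loc_affine F z.
Proof.
move=> d0 w0 H [l Hl].
have H' : edge_germ F z d 0 l l.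
  by split; [rewrite subrr scale0r|apply: filterS Hl => y ->].
by have [E _ _] := edge_germ_inj d0 H H'; rewrite E eqxx in w0.
Qed.

Lemma edge_germ_off F z d w la lb : edge_germ F z d w la lb ->
  \forall y \near z, ~ loc_affine F y -> det2 (rv d) (y - z) = 0.
Proof.
move=> [_ /near_join H]; near=> y => nA.
have Hy : \forall y' \near y,
    (0 <= det2 (rv d) (y' - z) -> F y' = affine_fun la y') /\
    (det2 (rv d) (y' - z) <= 0 -> F y' = affine_fun lb y') by near: y.
have E x : det2 (rv d) (x - z) = det2 (rv d) x - det2 (rv d) z.
  by rewrite -scaleN1r det2DZ mulN1r.
have C e : 0 < e -> \forall y' \near y, `|det2 (rv d) y - det2 (rv d) y'| < e.
  move=> e0; have /continuous_atP/(_ _ e0) := @dot_continuous R _ (rot d) y.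
  by apply: filterS => y'; rewrite !dot_rot.
apply/eqP; apply: contrapT => /negP d0; apply: nA.
have [d1|d1|d1] := ltgtP (det2 (rv d) (y - z)) 0.
- exists lb; have e0 : 0 < - det2 (rv d) (y - z) by rewrite oppr_gt0.
  apply: filterS2 (C _ e0) Hy => y'; rewrite ltr_norml !E => h1 [_]; apply.
  by move: h1; lra.
- exists la.
  apply: filterS2 (C _ d1) Hy => y'; rewrite ltr_norml !E => h1 [+ _]; apply.
  by move: h1; lra.
- by move: d0; rewrite d1 eqxx.
Unshelve. all: by end_near. Qed.

(** Both [rot d] and [u] are primitive and orthogonal to [d], hence equal up to sign; the sign
    decides which side is [la]. *)
Lemma facet_edge_germ F q u w d : facet F q u w -> primitive d ->
  dot u (rv d) = 0 -> exists la lb, edge_germ F q d w la lb.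
Proof.
move=> [pu w0 [a [b [ab H]]]] pd.
rewrite dot2 !mxE -!intrM -intrD => /eqP; rewrite intr_eq0 => /eqP ud.
have side c y : F q + dot c (y - q) = affine_fun (c, F q - dot c q) y.
  by rewrite /affine_fun /= dotBr; ring.
have zero y : dot u (y - q) = 0 -> dot a (y - q) = dot b (y - q).
  by move=> h; apply/eqP; rewrite -subr_eq0 -dotBl ab dotZl h mulr0.
have [E|E] : rot d = u \/ rot d = - u.
- have [] := @primitive_parallel u (rot d) pu (primitive_rot pd).
  + by rewrite !mxE /= mulrN; apply/eqP; rewrite -addr_eq0 ud.
  + by left.
  + by right.
- exists (a, F q - dot a q), (b, F q - dot b q); split; first by rewrite E.
  apply: filterS H => y Hy; rewrite -dot_rot E Hy -!side; split.
    by move=> ->.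
  by rewrite le_eqVlt => /predU1P[h|h]; [case: ifP => _; rewrite ?zero|rewrite leNgt h].
exists (b, F q - dot b q), (a, F q - dot a q); split.
  by rewrite E -opprB ab scalerN.
apply: filterS H => y Hy; rewrite -dot_rot E dotNl Hy -!side.
rewrite oppr_ge0 oppr_le0; split; last by move=> ->.
by rewrite le_eqVlt => /predU1P[h|h]; [case: ifP => _; rewrite ?zero|rewrite leNgt h].
Qed.

(** Real induction along the edge. At a limit point [q] an affine germ would spread to earlier
    points of the edge, so [q] lies on a facet. The earlier points lie in the support and hence on
    the line of that facet, which must have direction [d]; comparison at one earlier point
    identifies the weight and the two affine functions. *)
Lemma edge_germ_persist F z d w la lb (T : R) : primitive d -> w != 0 ->
  (forall t, 0 <= t < T -> ~ loc_affine F (z + t *: rv d) ->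
    exists u w, facet F (z + t *: rv d) u w) ->
  edge_germ F z d w la lb ->
  forall t, 0 <= t < T -> edge_germ F (z + t *: rv d) d w la lb.
Proof.
move=> pd w0 Hfacet Hz t0 /andP[t00 t0T].
have d0 := primitive_neq0 pd.
suff : forall t, 0 <= t <= t0 -> edge_germ F (z + t *: rv d) d w la lb.
  by apply; rewrite lexx t00.
have shift (s t : R) : z + s *: rv d + (t - s) *: rv d = z + t *: rv d.
  by rewrite -addrA -scalerDl subrKC.
apply: real_induction => //; first by rewrite scale0r addr0.
  move=> s _ /edge_germ_move/near0_pos[e e0 He]; exists e => // t /andP[h1 h2].
  by rewrite -(shift s t); apply: He; rewrite gtr0_norm; lra.
move=> s /andP[h1 h2] IH; set q := z + s *: rv d.
have IHn t : 0 <= t < s -> ~ loc_affine F (z + t *: rv d).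
  by move=> /IH; exact: edge_germ_not_affine.
have nq : ~ loc_affine F q.
  move=> [l /near_join/near_line Hl].
  have [t ts Ht] := near_left h1 Hl.
  by apply: (IHn t ts); exists l.
have [|u [w' Hu]] := Hfacet s _ nq; first by lra.
have [pu _ _] := Hu.
have rr x : det2 (rv (rot u)) x = - dot u x.
  by rewrite -dot_rot !dot2 !mxE /= mulrNz; ring.
have ud : dot u (rv d) = 0.
  have [||la1 [lb1 /edge_germ_off/near_line H1]] := @facet_edge_germ _ _ _ _ (rot u) Hu.
  - exact: primitive_rot.
  - by apply/eqP; rewrite -oppr_eq0 -rr det2xx.
  have [t ts /(_ (IHn t ts))] := near_left h1 H1.
  rewrite rr /q opprD addrACA subrr add0r -scalerBl dotZr => /eqP.
  rewrite oppr_eq0 mulf_eq0 => /orP[|/eqP//].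
  by rewrite subr_eq0 => /eqP ts'; move: ts; rewrite ts'; lra.
have [la' [lb' Hq]] := facet_edge_germ Hu pd ud.
have /near0_pos[e e0 He] := edge_germ_move Hq.
have [t /andP[ts ts'] te] := near_left h1 (near_ball s e0).
have := He (t - s) (ltW te); rewrite /q shift => Ht.
have [|-> -> ->] := edge_germ_inj d0 (IH t _) Ht; first by rewrite ts.
exact: Hq.
Qed.

End EdgeGerms.

Section Fans.
Context {R : realType}.
Implicit Types (d u a b : 'rV[int]_2) (x y z v : 'rV[R]_2) (w : int)
  (F phi : 'rV[R]_2 -> R).

Lemma near_scale (t : R) x (P : set 'rV[R]_2) : 0 < t ->
  (\forall y \near t *: x, P y) -> \forall y \near x, P (t *: y).
Proof.
move=> t0 /nearP[e e0 He]; have := @near_rV R 2 x (e / t) (divr_gt0 e0 t0).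
apply: filterS => y; rewrite ltr_pdivlMr// => yx; apply: He.
by rewrite -scalerBr normrZ gtr0_norm// mulrC.
Qed.

Definition is_fan phi (ds : seq 'rV[int]_2) (w : 'rV[int]_2 -> int)
    (A B : 'rV[int]_2 -> 'rV[int]_2) : Prop :=
  [/\ uniq ds,
      forall d, d \in ds -> [/\ primitive d, w d != 0 &
        edge_germ phi (rv d) d (w d) (A d, 0) (B d, 0)],
      forall y, y != 0 ->
        (forall d t, d \in ds -> 0 < t -> y <> t *: rv d) -> loc_affine phi y,
      forall t y, 0 <= t -> phi (t *: y) = t * phi y &
      exists2 K : R, 0 < K & forall y z, `|phi y - phi z| <= K * `|y - z|].

Lemma cone_scale phi (t : R) y :
  (forall t y, 0 <= t -> phi (t *: y) = t * phi y) -> 0 < t ->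
  loc_affine phi (t *: y) -> loc_affine phi y.
Proof.
move=> hphi t0 [l /(near_scale t0) Hl]; exists (l.1, t^-1 * l.2).
apply: filterS Hl => z; rewrite hphi ?ltW// => E.
apply: (mulfI (lt0r_neq0 t0)); rewrite E /affine_fun /= dotZr mulrDr mulVKf//.
exact: lt0r_neq0.
Qed.

Lemma edge_germ_scale phi (t : R) z d w a b :
  (forall t y, 0 <= t -> phi (t *: y) = t * phi y) -> 0 < t ->
  edge_germ phi (t *: z) d w (a, 0) (b, 0) ->
  edge_germ phi z d w (a, 0) (b, 0).
Proof.
move=> hphi t0 [E /(near_scale t0) H]; split=> //.
apply: filterS H => y; rewrite -scalerBr det2Zr (hphi _ _ (ltW t0)).
rewrite pmulr_rge0// pmulr_rle0// /affine_fun !addr0 !dotZr => -[h1 h2].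
have t1 := mulfI (lt0r_neq0 t0).
by split=> hz; apply: t1; [exact: h1|exact: h2].
Qed.

(** Along the ray itself [phi] is linear in the parameter, and both sides agree with it there. *)
Lemma edge_germ_cone phi (t : R) d w la lb :
  (forall t y, 0 <= t -> phi (t *: y) = t * phi y) -> 0 < t ->
  edge_germ phi (t *: rv d) d w la lb -> la.2 = 0 /\ lb.2 = 0.
Proof.
move=> hphi t0 [_ H].
have H0 l : (\forall y \near t *: rv d, det2 (rv d) (y - t *: rv d) = 0 ->
    phi y = affine_fun l y) -> l.2 = 0.
  move=> Hl; have := @near_line R 2 0 (rv d) t
    (fun y => det2 (rv d) (y - t *: rv d) = 0 -> phi y = affine_fun l y).
  rewrite add0r => /(_ Hl) H1.
  have [] := @near_eq_affine _ 0 (phi (rv d)) l.2 (dot l.1 (rv d)) t; last by [].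
  near=> s; have s0 : 0 < s by near: s; exact: lt_nbhsr.
  have : phi (s *: rv d) = affine_fun l (s *: rv d).
    rewrite -[s *: _]add0r; have : det2 (rv d) (0 + s *: rv d - t *: rv d) = 0.
      by rewrite add0r -scalerBl det2Zr det2xx mulr0.
    by near: s.
  by rewrite hphi ?ltW// /affine_fun dotZr add0r mulrC => ->; ring.
by split; apply: H0; apply: filterS H => y [h1 h2] E; [apply: h1|apply: h2];
  rewrite E.
Unshelve. all: by end_near. Qed.

Lemma cone_transfer F x phi : is_cone F x phi ->
  exists2 e : R, 0 < e & forall y, `|y| < e ->
    \forall z \near y, F (x + z) = F x + phi z.
Proof.
case=> [_ _ _ /near_join/nearP[e e0 He]]; exists e => // y ye.
have : \forall z \near x + y, F z = F x + phi (z - x).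
  by apply: He; rewrite addrAC subrr add0r.
rewrite addrC => /near_translate; apply: filterS => z.
by rewrite addrK addrC.
Qed.

Lemma transfer_affine F x phi y :
  (\forall z \near y, F (x + z) = F x + phi z) ->
  loc_affine F (x + y) <-> loc_affine phi y.
Proof.
move=> H; split=> [|[l Hl]].
  rewrite addrC => /loc_affine_translate[l Hl]; exists (l.1, l.2 - F x).
  apply: filterS2 H Hl => z; rewrite [x + z]addrC => -> E.
  by rewrite /affine_fun /= addrA -/(affine_fun l z) -E addrC addKr.
exists (l.1, l.2 + F x - dot l.1 x); rewrite addrC.
apply/near_translate; apply: filterS2 H Hl => z; rewrite [x + z]addrC => -> ->.
by rewrite /affine_fun /= dotDr; ring.
Qed.

Lemma transfer_facet F x phi y u w :
  (\forall z \near y, F (x + z) = F x + phi z) ->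
  facet F (x + y) u w -> facet phi y u w.
Proof.
move=> H [pu w0 [a [b [ab]]]]; rewrite addrC => /near_translate Hab.
split=> //; exists a, b; split=> //.
have Ey := nbhs_singleton H.
apply: filterS2 H Hab => z; rewrite [x + z]addrC => ->.
rewrite [y + x]addrC Ey [x + y]addrC opprD addrACA subrr addr0 => E.
by apply: (addrI (F x)); rewrite E addrA.
Qed.

(** By homogeneity [phi] is nowhere affine on the open ray through [d], whereas near the facet all
    such points lie on the line orthogonal to [u]. *)
Lemma facet_ray phi (t : R) d u w : (forall t y, 0 <= t -> phi (t *: y) = t * phi y) ->
  0 < t -> ~ loc_affine phi (t *: rv d) -> facet phi (t *: rv d) u w ->
  dot u (rv d) = 0 :> R.
Proof.
move=> hphi t0 nA Hu; have [pu _ _] := Hu.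
have rr x : det2 (rv (rot u)) x = - dot u x.
  by rewrite -dot_rot !dot2 !mxE /= mulrNz; ring.
have [||la1 [lb1 /edge_germ_off H1]] := @facet_edge_germ _ _ _ _ _ (rot u) Hu.
- exact: primitive_rot.
- by apply/eqP; rewrite -oppr_eq0 -rr det2xx.
have := @near_line R 2 0 (rv d) t
    (fun y => ~ loc_affine phi y -> det2 (rv (rot u)) (y - t *: rv d) = 0).
rewrite add0r => /(_ H1) /nearP[e e0 He].
have := He (t + e / 2); rewrite addrAC subrr add0r gtr0_norm ?divr_gt0// add0r.
move=> /(_ ltac:(lra)); rewrite rr -scalerBl addrAC subrr add0r dotZr => E.
suff /E/eqP : ~ loc_affine phi ((t + e / 2) *: rv d).
  by rewrite oppr_eq0 mulf_eq0 => /orP[|/eqP//]; rewrite gt_eqF ?divr_gt0.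
have te : 0 < t + e / 2 by rewrite addr_gt0 ?divr_gt0.
move=> A; apply: nA; apply: (@cone_scale phi ((t + e / 2) / t)) => //.
  exact: divr_gt0.
by rewrite scalerA divfK ?gt_eqF.
Qed.

(** By [selection_affine], the cone can fail to be affine at [y] only if two of its finitely many
    slopes agree on [y]. This confines [y] to finitely many rational lines, each of which
    contributes two primitive directions. *)
Lemma cone_directions F x phi : is_cone F x phi ->
  exists C : seq 'rV[int]_2, (forall d, d \in C -> primitive d) /\
    forall y, y != 0 -> ~ loc_affine phi y ->
      exists d t, [/\ d \in C, 0 < t & y = t *: rv d].
Proof.
case=> [hphi [S HS] [K K0 HK] _].
pose prim (v : 'rV[int]_2) := xget v
  [set d | primitive d /\ exists g : int, v = g *: d /\ 0 < g].
have primP (v : 'rV[int]_2) : v != 0 -> primitive (prim v) /\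
    exists g : int, v = g *: prim v /\ 0 < g.
  move=> v0; apply: (@xgetPex _ v
    [set d | primitive d /\ exists g : int, v = g *: d /\ 0 < g]).
  have [g [d [pd g0 E]]] := primitive_multiple v0.
  by exists d; split=> //; exists g.
pose C := [seq rot (prim (p.1 - p.2)) | p <- [seq (a, b) | a <- S, b <- S]
  & p.1 != p.2].
exists (C ++ map -%R C); split.
  have pC d : d \in C -> primitive d.
    move=> /mapP[[a b]]; rewrite mem_filter /= => /andP[ab _] ->.
    by apply/primitive_rot; have [] := primP _ (_ : a - b != 0); rewrite ?subr_eq0.
  move=> d; rewrite mem_cat => /orP[/pC//|/mapP[d' /pC pd' ->]].
  exact: primitiveN.
move=> y y0 nA.
have [a [b [aS bS ab E]]] : exists a b,
    [/\ a \in S, b \in S, a != b & dot (a - b) y = 0].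
  apply: contrapT => H; apply: nA.
  have [|a aS Ha] := @selection_affine R 2 S phi K y K0 HS HK.
    move=> a b aS bS ab; apply/eqP => E; apply: H; exists a, b.
    by split.
  by exists (a, 0); apply: filterS Ha => z ->; rewrite /affine_fun /= addr0.
have ab0 : a - b != 0 by rewrite subr_eq0.
have [pn [g [Eg g0]]] := primP _ ab0.
set n := prim (a - b) in pn Eg.
have En : dot n y = 0.
  move: E; rewrite Eg dotZl => /eqP; rewrite mulf_eq0 intr_eq0.
  by rewrite (gt_eqF g0) => /eqP.
have nC : rot n \in C.
  apply/mapP; exists (a, b) => //; rewrite mem_filter /= ab.
  by apply/allpairsP; exists (a, b).
have n0 := primitive_neq0 pn.
pose N : R := det2 (rv n) (rv (rot n)).
have N0 : 0 < N := det2_rot_gt0 n0.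
(* In the orthogonal basis [n], [rot n] the component of [y] along [n] vanishes. *)
have Ey : y = (det2 (rv n) y / N) *: rv (rot n).
  move: En; rewrite dot2 => En.
  apply: row2P; rewrite !mxE /=; apply: (mulfI (lt0r_neq0 N0));
    rewrite mulrA mulrCA divff ?mulr1 ?lt0r_neq0// /N /det2 !mxE /= ?mulrNz.
    apply/eqP; rewrite -subr_eq0; apply/eqP.
    transitivity ((n 0 0)%:~R * ((n 0 0)%:~R * y 0 0 + (n 0 1)%:~R * y 0 1)).
      by ring.
    by rewrite En mulr0.
  apply/eqP; rewrite -subr_eq0; apply/eqP.
  transitivity ((n 0 1)%:~R * ((n 0 0)%:~R * y 0 0 + (n 0 1)%:~R * y 0 1)).
    by ring.
  by rewrite En mulr0.
have t0 : det2 (rv n) y / N != 0.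
  by apply: contra y0 => /eqP E0; rewrite Ey E0 scale0r.
have [tn|tp|t00] := ltgtP (det2 (rv n) y / N) 0; last by rewrite t00 eqxx in t0.
- exists (- rot n), (- (det2 (rv n) y / N)); split.
  + by rewrite mem_cat map_f ?orbT.
  + by rewrite oppr_gt0.
  + by rewrite rvN scalerN scaleNr opprK.
- by exists (rot n), (det2 (rv n) y / N); rewrite mem_cat nC.
Qed.

Lemma cone_fan F x phi : is_cone F x phi ->
  (\forall y \near x, y != x -> ~ loc_affine F y -> exists u w, facet F y u w) ->
  exists ds (w : _ -> int) A B, is_fan phi ds w A B.
Proof.
move=> Fphi /nearP[e1 e10 Hfacet].
have [e2 e20 Htr] := cone_transfer Fphi.
have [C [pC HC]] := cone_directions Fphi.
have [hphi _ HK _] := Fphi.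
pose ds := undup [seq d <- C | `[< ~ loc_affine phi (rv d) >]].
have dsP d : d \in ds -> primitive d /\ ~ loc_affine phi (rv d).
  by rewrite mem_undup mem_filter => /andP[/asboolP nA /pC].
have H d : exists wab : int * ('rV[int]_2 * 'rV[int]_2), d \in ds ->
    wab.1 != 0 /\ edge_germ phi (rv d) d wab.1 (wab.2.1, 0) (wab.2.2, 0).
  have [dds|] := boolP (d \in ds); last by exists (0, (0, 0)).
  have [pd nA] := dsP _ dds; have d0 := primitive_neq0 pd.
  have rd0 : rv d != 0 :> 'rV[R]_2 by rewrite rv_eq0.
  have nd0 : 0 < `|rv d : 'rV[R]_2| by rewrite normr_gt0.
  (* The facet hypothesis is available only close to [x], so the ray is examined at a point within
     both radii and the result is scaled back to [rv d]. *)
  pose t := Num.min e1 e2 / (2 * `|rv d|).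
  have t0 : 0 < t by rewrite divr_gt0 ?mulr_gt0// lt_min e10.
  have tn : `|t *: rv d| < Num.min e1 e2.
    rewrite normrZ gtr0_norm// /t invfM mulrA mulfVK ?gt_eqF//.
    by rewrite ltr_pdivrMr// ltr_pMr ?lt_min ?e10// ltr1n.
  have nAt : ~ loc_affine phi (t *: rv d).
    by move=> /(cone_scale hphi t0).
  have tr := Htr (t *: rv d) (lt_le_trans tn _).
  have {}tr := tr ltac:(by rewrite ge_min lexx orbT).
  have [|||u [w Hu]] := Hfacet (x + t *: rv d).
  - by rewrite addrAC subrr add0r (lt_le_trans tn)// ge_min lexx.
  - rewrite -subr_eq0 addrAC subrr add0r scaler_eq0 negb_or rd0 andbT.
    by rewrite gt_eqF.
  - by move=> /(transfer_affine tr).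
  have Hu' := transfer_facet tr Hu.
  have ud := facet_ray hphi t0 nAt Hu'.
  have [la [lb G]] := facet_edge_germ Hu' pd ud.
  have w0 : w != 0 by case: Hu.
  have [la0 lb0] := edge_germ_cone hphi t0 G.
  exists (w, (la.1, lb.1)) => _; split=> //=.
  apply: (edge_germ_scale hphi t0).
  by move: G la0 lb0; case: la => a c; case: lb => b c' /= G Ea Eb; rewrite Ea Eb in G.
pose W d := projT1 (cid (H d)).
have WP d : d \in ds -> (W d).1 != 0 /\
    edge_germ phi (rv d) d (W d).1 ((W d).2.1, 0) ((W d).2.2, 0).
  exact: (projT2 (cid (H d))).
exists ds, (fun d => (W d).1), (fun d => (W d).2.1), (fun d => (W d).2.2).
split=> //; first exact: undup_uniq.
  by move=> d dds; have [pd _] := dsP _ dds; have [? ?] := WP _ dds.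
move=> y y0 Hy; apply: contrapT => nA.
have [d [t [dC t0 E]]] := HC y y0 nA; apply: (Hy d t _ t0 E).
rewrite mem_undup mem_filter dC andbT; apply/asboolP => A; apply: nA; rewrite E.
apply: (cone_scale hphi (_ : 0 < t^-1)); first by rewrite invr_gt0.
by rewrite scalerA mulVf ?scale1r ?gt_eqF.
Qed.

End Fans.

(** * Slopes along a line and local multiplicities *)

Section Piecewise.
Context {R : realType}.
Implicit Types (g h : R -> R) (s t c e K : R).

Definition locally_affine g s : Prop :=
  exists c e, \forall t \near s, g t = c + e * t.

Lemma locally_affine_ext g h s : (\forall t \near s, g t = h t) ->
  locally_affine g s -> locally_affine h s.
Proof.
by move=> E [c [e H]]; exists c, e; apply: filterS2 E H => t <-.
Qed.

Lemma locally_affineD g h s : locally_affine g s -> locally_affine h s ->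
  locally_affine (fun t => g t + h t) s.
Proof.
move=> [c [e H]] [c' [e' H']]; exists (c + c'), (e + e').
by apply: filterS2 H H' => t -> ->; ring.
Qed.

Lemma locally_affineM k g s : locally_affine g s ->
  locally_affine (fun t => k * g t) s.
Proof.
move=> [c [e H]]; exists (k * c), (k * e).
by apply: filterS H => t ->; ring.
Qed.

Lemma locally_affine_sum (T : Type) (r : seq T) (P : pred T) (f : T -> R -> R) s :
  (forall i, P i -> locally_affine (f i) s) ->
  locally_affine (fun t => \sum_(i <- r | P i) f i t) s.
Proof.
move=> H; elim: r => [|i r IH].
  by exists 0, 0; near=> t; rewrite big_nil mul0r addr0.
case Pi: (P i); last first.
  by apply: locally_affine_ext IH; near=> t; rewrite big_cons Pi.
have := locally_affineD (H i Pi) IH; apply: locally_affine_ext.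
by near=> t; rewrite big_cons Pi.
Unshelve. all: by end_near. Qed.

Lemma locally_affine_max c s : c != s ->
  locally_affine (fun t => Num.max 0 (t - c)) s.
Proof.
rewrite neq_lt => /orP[h|h].
  exists (- c), 1; near=> t; rewrite max_r; first by ring.
  by rewrite subr_ge0 ltW//; near: t; exact: lt_nbhsr.
exists 0, 0; near=> t; rewrite max_l; first by ring.
by rewrite subr_le0 ltW//; near: t; exact: lt_nbhsl.
Unshelve. all: by end_near. Qed.

Lemma affine_line g : (forall s, locally_affine g s) ->
  exists c e, forall s, g s = c + e * s.
Proof.
move=> Hg; have [c [e H0]] := Hg 0; exists c, e => s.
have [||c' [e' H]] := @affine_segment _ g (- `|s|) `|s|.
- by rewrite ge0_cp.
- by move=> t _; exact: Hg.
have [-> ->] : c = c' /\ e = e'.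
  apply: (@near_eq_affine _ _ _ _ _ 0).
  have := H 0; rewrite oppr_le0 normr_ge0 => /(_ isT).
  by apply: filterS2 H0 => t -> ->.
apply: (nbhs_singleton (H s _)).
by rewrite ler_norm lerNl -normrN ler_norm.
Qed.

Lemma bounded_affine c e s0 K :
  (forall s, s0 <= s -> `|c + e * s| <= K) -> e = 0.
Proof.
move=> H; apply/eqP; apply: contraT => e0.
pose s := Num.max s0 ((`|c| + K + 1) / `|e|).
have := H s; rewrite le_max lexx => /(_ isT).
have h1 : `|c| + K + 1 <= `|e| * s.
  by rewrite mulrC -ler_pdivrMr ?normr_gt0// le_max lexx orbT.
have s1 : 0 <= s \/ s < 0 by case: (leP 0 s); [left|right].
have K0 : 0 <= K.
  have := H s; rewrite le_max lexx => /(_ isT).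
  by apply: le_trans; exact: normr_ge0.
have s2 : 0 <= s by rewrite le_max divr_ge0 ?orbT// addr_ge0// addr_ge0.
have h2 : `|e * s| <= `|c + e * s| + `|c|.
  rewrite -[e * s](addKr c) (le_trans (ler_normD _ _))// normrN addrC lerD//.
  by rewrite addKr.
by move: h2; rewrite normrM (ger0_norm s2); lra.
Qed.

End Piecewise.

(** Crossing the edge in direction [v] changes the slope by the weight times the absolute value of
    [det2 (rv d) v]: the sign of the determinant tells which side is entered, and exchanging the
    sides changes the sign of the difference of slopes. *)
Lemma edge_germ_kink {R : realType} (F : 'rV[R]_2 -> R) (y0 v : 'rV[R]_2) (s : R)
    d w la lb :
  det2 (rv d) v != 0 -> edge_germ F (y0 + s *: v) d w la lb ->
  locally_affine (fun s' => F (y0 + s' *: v) -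
    w%:~R * `|det2 (rv d) v| * Num.max 0 (s' - s)) s.
Proof.
set z := y0 + s *: v => dv [Eab Hz].
have [Ea0 Eb0] := nbhs_singleton Hz; rewrite subrr {1 2}/det2 !mxE !mulr0 subrr in Ea0 Eb0.
have E0 : affine_fun la z = affine_fun lb z by rewrite -Ea0// -Eb0.
have Edet s' : det2 (rv d) (y0 + s' *: v - z) = (s' - s) * det2 (rv d) v.
  by rewrite opprD addrACA subrr add0r -scalerBl det2Zr.
have Edot s' : affine_fun la (y0 + s' *: v) =
    affine_fun lb (y0 + s' *: v) + w%:~R * ((s' - s) * det2 (rv d) v).
  have H l : affine_fun l (y0 + s' *: v) =
      affine_fun l z + dot l.1 (y0 + s' *: v - z).
    by rewrite -affine_fun_at subrKC.
  by rewrite -Edet -dot_rot -dotZl -Eab dotBl !H E0; ring.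
have Ea l s' : affine_fun l (y0 + s' *: v) = affine_fun l y0 + dot l.1 v * s'.
  by rewrite affine_fun_at dotZr mulrC.
have /near_line G := Hz.
have [dp|dn|d0] := ltgtP (det2 (rv d) v) 0; last by rewrite d0 eqxx in dv.
- exists (affine_fun la y0), (dot la.1 v); apply: filterS G => s'.
  rewrite Edet => -[h1 h2]; have [le|lt] := leP s' s.
    rewrite max_l ?subr_le0// mulr0 subr0 h1 ?Ea//.
    by apply: mulr_le0; [rewrite subr_le0|exact: ltW].
  rewrite max_r ?subr_ge0 ?(ltW lt)// h2 -?Ea; last first.
    by apply: mulr_ge0_le0; [rewrite subr_ge0|]; exact: ltW.
  by rewrite Edot (ltr0_norm dp); ring.
exists (affine_fun lb y0), (dot lb.1 v); apply: filterS G => s'.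
rewrite Edet => -[h1 h2]; have [le|lt] := leP s' s.
  rewrite max_l ?subr_le0// mulr0 subr0 h2 ?Ea//.
  by apply: mulr_le0_ge0; [rewrite subr_le0|exact: ltW].
rewrite max_r ?subr_ge0 ?(ltW lt)// h1 -?Ea; last first.
  by apply: mulr_ge0; [rewrite subr_ge0|]; exact: ltW.
by rewrite Edot (gtr0_norm dn); ring.
Qed.

(** * Restriction of a fan to a line, and the balancing condition *)

Section FanSums.
Context {R : realType}.
Implicit Types (d : 'rV[int]_2) (x y z v : 'rV[R]_2).
Context (phi : 'rV[R]_2 -> R) (ds : seq 'rV[int]_2) (w : 'rV[int]_2 -> int)
  (A B : 'rV[int]_2 -> 'rV[int]_2) (fanphi : is_fan phi ds w A B).

Lemma ray_unique d d' (t t' : R) : primitive d -> primitive d' -> 0 < t -> 0 < t' ->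
  t *: rv d = t' *: rv d' -> d = d'.
Proof.
move=> pd pd' t0 t0' E.
have dd : det2 (rv d) (rv d') = 0 :> R.
  apply: (mulfI (lt0r_neq0 t0)); rewrite -det2Zl E det2Zl det2xx !mulr0.
  by [].
have [|->//|E'] := @primitive_parallel d d' pd pd'.
  apply/eqP; rewrite -subr_eq0 -(intr_eq0 R) intrB !intrM.
  by move: dd; rewrite /det2 !mxE => ->.
have /eqP : (t + t') *: rv d = 0 :> 'rV[R]_2.
  by rewrite scalerDl E E' rvN scalerN addNr.
rewrite scaler_eq0 gt_eqF ?addr_gt0//= rv_eq0.
by rewrite (negbTE (primitive_neq0 pd)).
Qed.

Lemma fan_kink d (t : R) y0 v s : d \in ds -> 0 < t ->
  y0 + s *: v = t *: rv d -> det2 (rv d) v != 0 ->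
  locally_affine (fun s' => phi (y0 + s' *: v) -
    (w d)%:~R * `|det2 (rv d) v| * Num.max 0 (s' - s)) s.
Proof.
move=> dds t0 Ey dv; have [_ /(_ d dds)[pd w0 G] _ hphi _] := fanphi.
have {}G : edge_germ phi (y0 + s *: v) d (w d) (A d, 0) (B d, 0).
  rewrite Ey; apply: (edge_germ_scale hphi (_ : 0 < t^-1)).
    by rewrite invr_gt0.
  by rewrite scalerA mulVf ?scale1r ?gt_eqF.
exact: edge_germ_kink G.
Qed.

Section Line.
Context (y0 v : 'rV[R]_2) (yv : det2 y0 v != 0).

(** A line that avoids the origin meets the ray [d] iff [d] and [y0] are on the same side of the
    parallel line through the origin. The parameter [crossing d] solves
    [det2 (rv d) (y0 + s *: v) = 0]. *)
Definition same_side d := 0 < det2 (rv d) v * det2 y0 v.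
Definition crossing d : R := - det2 (rv d) y0 / det2 (rv d) v.
Definition jump d : R := (w d)%:~R * `|det2 (rv d) v|.

Lemma crossing_ray d : same_side d ->
  exists2 t : R, 0 < t & y0 + crossing d *: v = t *: rv d.
Proof.
move=> sd; have dv : det2 (rv d) v != 0.
  by apply: contraTneq sd; rewrite /same_side => ->; rewrite mul0r ltxx.
exists (det2 y0 v / det2 (rv d) v).
  rewrite -(pmulr_rgt0 _ (_ : 0 < det2 (rv d) v ^+ 2)) ?exprn_even_gt0//.
  by rewrite expr2 -mulrA [_ * (_ / _)]mulrC divfK.
move: dv; rewrite /crossing /det2 => dv.
by apply: row2P; rewrite !mxE; field; move: dv; rewrite !mxE.
Qed.

Lemma ray_crossing d s (t : R) : 0 < t -> y0 + s *: v = t *: rv d ->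
  same_side d /\ crossing d = s.
Proof.
move=> t0 E.
have E1 : det2 y0 v = t * det2 (rv d) v.
  rewrite -det2Zl -E /det2 !mxE; ring.
have dv : det2 (rv d) v != 0.
  by apply: contra yv => /eqP h; rewrite E1 h mulr0.
split.
  by rewrite /same_side E1 mulrCA -expr2 mulr_gt0// exprn_even_gt0.
have : det2 (rv d) (y0 + s *: v) = 0 by rewrite E det2Zr det2xx mulr0.
rewrite det2DZ => /eqP; rewrite addrC addr_eq0 => /eqP E2.
by rewrite /crossing -E2 mulfK.
Qed.

Lemma fan_line_local s : locally_affine (fun s' => phi (y0 + s' *: v) -
  \sum_(d <- ds | same_side d) jump d * Num.max 0 (s' - crossing d)) s.
Proof.
have [Uds Hds Haff _ _] := fanphi.
have [[d [dds [t t0 E]]]|H] := pselect (exists d, d \in ds /\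
    exists2 t : R, 0 < t & y0 + s *: v = t *: rv d).
  have [sd cd] := ray_crossing t0 E.
  have dv : det2 (rv d) v != 0.
    by apply: contraTneq sd; rewrite /same_side => ->; rewrite mul0r ltxx.
  have K := fan_kink dds t0 E dv.
  have S : locally_affine (fun s' => \sum_(d' <- ds | (d' != d) && same_side d')
      jump d' * Num.max 0 (s' - crossing d')) s.
    rewrite -/(locally_affine _ s).
    suff : locally_affine (fun s' => \sum_(d' <- ds | [&& d' != d, same_side d'
       & d' \in ds]) jump d' * Num.max 0 (s' - crossing d')) s.
      apply: locally_affine_ext; near=> s'.
      rewrite big_seq_cond [RHS]big_seq_cond; apply: eq_bigl => d'.
      by case: (d' \in ds); rewrite ?andbF ?andbT.
    apply: locally_affine_sum => d' /and3P[d'd sd' d'ds].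
    apply/locally_affineM/locally_affine_max.
    apply: contra d'd => /eqP cd'; apply/eqP.
    have [t' t0' E'] := crossing_ray sd'; rewrite cd' E in E'.
    have [pd _ _] := Hds _ dds; have [pd' _ _] := Hds _ d'ds.
    by rewrite (ray_unique pd pd' t0 t0' E').
  have := locally_affineD K (locally_affineM (-1) S).
  apply: locally_affine_ext; near=> s'.
  rewrite [in RHS]big_mkcond (bigD1_seq d)//= sd cd -big_mkcondr /jump.
  by ring.
have A1 : locally_affine (fun s' => phi (y0 + s' *: v)) s.
  have [||l /near_line Hl] := Haff (y0 + s *: v).
  - apply: contra yv => /eqP E; have : det2 (y0 + s *: v) v = 0.
      by rewrite E /det2 !mxE !mul0r subrr.
    by move=> <-; rewrite /det2 !mxE; apply/eqP; ring.
  - by move=> d t dds t0 E; apply: H; exists d; split=> //; exists t.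
  exists (affine_fun l y0), (dot l.1 v); apply: filterS Hl => s' ->.
  by rewrite affine_fun_at dotZr mulrC.
have S : locally_affine (fun s' => \sum_(d' <- ds | same_side d' && (d' \in ds))
      jump d' * Num.max 0 (s' - crossing d')) s.
  apply: locally_affine_sum => d' /andP[sd' d'ds].
  apply/locally_affineM/locally_affine_max.
  apply/eqP => cd'; apply: H; exists d'; split=> //.
  by rewrite -cd'; exact: crossing_ray.
have := locally_affineD A1 (locally_affineM (-1) S).
apply: locally_affine_ext; near=> s'.
rewrite mulN1r; congr (_ - _); rewrite big_seq_cond [RHS]big_seq_cond.
by apply: eq_bigl => d'; case: (d' \in ds); rewrite ?andbF ?andbT.
Unshelve. all: by end_near. Qed.

(** Removing the kinks at all crossings leaves a function that is affine on the whole line. By the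
    Lipschitz bound and homogeneity, [phi (y0 + s *: u)] stays at bounded distance from [s * phi u]
    for [s >= 0]; taking [u] to be [v] and [- v] yields the slopes at both ends. *)
Lemma fan_line : exists c e, [/\ forall s, phi (y0 + s *: v) = c + e * s +
    \sum_(d <- ds | same_side d) jump d * Num.max 0 (s - crossing d),
  e = - phi (- v) &
  e + \sum_(d <- ds | same_side d) jump d = phi v].
Proof.
have [c [e H]] := affine_line fan_line_local.
have {}H s : phi (y0 + s *: v) = c + e * s +
    \sum_(d <- ds | same_side d) jump d * Num.max 0 (s - crossing d).
  by rewrite -H subrK.
have [_ _ _ hphi [K K0 HK]] := fanphi.
pose s0 := \sum_(d <- ds) `|crossing d|.
have s0P d : d \in ds -> `|crossing d| <= s0.
  by move=> dds; rewrite /s0 (big_rem _ dds)/= lerDl sumr_ge0.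
have s00 : 0 <= s0 by exact: sumr_ge0.
have lim (u : 'rV[R]_2) s : 0 <= s -> `|phi (y0 + s *: u) - s * phi u| <= K * `|y0|.
  by move=> s1; rewrite -hphi// (le_trans (HK _ _))// addrK.
exists c, e; split=> //.
  apply/eqP; rewrite -subr_eq0 opprK -oppr_eq0; apply/eqP.
  apply: (@bounded_affine _ c _ s0 (K * `|y0|)) => s ss0.
  have := lim (- v) s (le_trans s00 ss0); rewrite scalerN -scaleNr H.
  rewrite big_seq_cond big1 ?addr0; last first.
    move=> d /andP[/s0P ds0 _]; rewrite max_l ?mulr0//.
    by move: ds0; rewrite ler_norml; lra.
  by congr (`|_| <= _); ring.
apply/eqP; rewrite -subr_eq0; apply/eqP.
pose C := c - \sum_(d <- ds | same_side d) jump d * crossing d.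
apply: (@bounded_affine _ C _ s0 (K * `|y0|)) => s ss0.
have := lim v s (le_trans s00 ss0); rewrite H.
rewrite big_seq_cond (eq_bigr (fun d => jump d * s - jump d * crossing d)); last first.
  move=> d /andP[/s0P ds0 _]; rewrite max_r ?mulrBr//.
  by move: ds0; rewrite ler_norml; lra.
rewrite -big_seq_cond sumrB -mulr_suml.
by congr (`|_| <= _); rewrite /C; ring.
Qed.

End Line.

(** Two lines of direction [v] on either side of the origin have the same slopes at both ends, hence
    the same total of jumps. One line meets the rays with [det2 (rv d) v < 0], the other those with
    [det2 (rv d) v > 0]. *)
Lemma fan_balance v : \sum_(d <- ds) (w d)%:~R * det2 (rv d) v = 0.
Proof.
have [->|v0] := eqVneq v 0.
  by rewrite big1// => d _; rewrite /det2 !mxE !mulr0 subrr mulr0.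
(* A quarter turn of [v]: the lines through [y0] and [- y0] lie on opposite sides of the origin. *)
pose y0 : 'rV[R]_2 := \row_i (if i == 0 then - v 0 1 else v 0 0).
have yv : det2 y0 v < 0.
  rewrite /det2 !mxE /=; rewrite -subr_gt0 sub0r opprB -[X in X < _](subrr 0).
  have : 0 < v 0 0 * v 0 0 + v 0 1 * v 0 1.
    rewrite lt_neqAle eq_sym -!expr2 paddr_eq0 ?sqr_ge0// !sqrf_eq0.
    rewrite addr_ge0 ?sqr_ge0// andbT; apply: contra v0 => /andP[/eqP h0 /eqP h1].
    by apply/eqP/row2P; rewrite mxE.
  by lra.
have [c [e [_ -> E1]]] := fan_line (ltr0_neq0 yv).
have yv' : det2 (- y0) v != 0 by rewrite det2Nl oppr_eq0 ltr0_neq0.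
have [c' [e' [_ -> E2]]] := fan_line yv'.
transitivity (\sum_(d <- ds | same_side (- y0) v d) jump v d -
              \sum_(d <- ds | same_side y0 v d) jump v d); last first.
  by move: E1 E2; lra.
rewrite [X in _ = X - _]big_mkcond [X in _ = _ - X]big_mkcond /= -sumrB.
apply: eq_bigr => d _; rewrite /same_side det2Nl mulrN oppr_gt0.
rewrite nmulr_llt0// nmulr_lgt0// /jump.
have [h|h|h] := ltgtP (det2 (rv d) v) 0.
- by rewrite (ltr0_norm h); ring.
- by rewrite (gtr0_norm h); ring.
- by rewrite h mulr0 subrr.
Qed.

End FanSums.

(** * Crossings of a fan with its translate *)

Section LocalSum.
Context {R : realType}.
Implicit Types (d : 'rV[int]_2) (x y z v p q : 'rV[R]_2).
Context (phi : 'rV[R]_2 -> R) (ds : seq 'rV[int]_2) (w : 'rV[int]_2 -> int)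
  (A B : 'rV[int]_2 -> 'rV[int]_2) (fanphi : is_fan phi ds w A B).
Context (v0 : 'rV[R]_2)
  (gen : forall d, d \in ds -> det2 (rv d) v0 != 0).

(* The ray [d] meets the ray [d'] translated by [v0] iff
   [v0 = t d - t' d'] with [t, t' > 0], where [t] and [t'] are as follows. *)
Definition fst_par d d' : R := det2 (rv d') v0 / det2 (rv d') (rv d).
Definition snd_par d d' : R := det2 (rv d) v0 / det2 (rv d') (rv d).
Definition meet_rays d d' : bool := (0 < fst_par d d') && (0 < snd_par d d').

Lemma meet_rays_par d d' : meet_rays d d' ->
  det2 (rv d') (rv d) != 0 :> R /\
  v0 = fst_par d d' *: rv d - snd_par d d' *: rv d'.
Proof.
move=> /andP[t0 _].
have dd : det2 (rv d') (rv d) != 0 :> R.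
  by apply: contraTneq t0; rewrite /fst_par => ->; rewrite invr0 mulr0 ltxx.
split=> //; move: dd; rewrite /fst_par /snd_par /det2 => dd.
by apply: row2P; rewrite !mxE; field; move: dd; rewrite !mxE.
Qed.

Lemma par_meet_rays d d' (t t' : R) : det2 (rv d) v0 != 0 -> 0 < t -> 0 < t' ->
  v0 = t *: rv d - t' *: rv d' ->
  t = fst_par d d' /\ t' = snd_par d d'.
Proof.
move=> dv t0 t'0 E.
have dd : det2 (rv d') (rv d) != 0 :> R.
  apply: contra dv => /eqP h; rewrite E -scaleNr det2DZ det2Zr det2xx.
  by rewrite [det2 (rv d) (rv d')]det2C h oppr0 !mulr0 addr0.
rewrite /fst_par /snd_par {1 2}E -!scaleNr !det2DZ !det2Zr !det2xx.
rewrite [det2 (rv d) (rv d')]det2C !mulr0 addr0 add0r mulrNN.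
by rewrite !mulfK.
Qed.

(** The ray [d] of one copy, seen from the copy translated by [v0], is the half-line from [- v0] in
    direction [d]. Along it the slope of [phi] grows from [dot l.1 (rv d)] to [phi (rv d)], and the
    kinks at positive parameters are the rays that it meets. *)
Lemma fan_halfline l d : d \in ds ->
  (\forall z \near - v0, phi z = affine_fun l z) ->
  \sum_(d' <- ds | meet_rays d d') (w d')%:~R * `|det2 (rv d') (rv d)| =
  phi (rv d) - dot l.1 (rv d) :> R.
Proof.
move=> dds Hl; have yv : det2 (- v0) (rv d) != 0.
  by rewrite det2Nl -det2C gen.
have [c [e [H _ E]]] := fan_line fanphi yv.
have cr0 d' : d' \in ds -> same_side (- v0) (rv d) d' ->
    crossing (- v0) (rv d) d' != 0.
  move=> d'ds sd'; rewrite /crossing det2Nr opprK mulf_neq0 ?gen// invr_neq0//.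
  by apply: contraTneq sd'; rewrite /same_side => ->; rewrite mul0r ltxx.
pose S (P : R -> bool) : R := \sum_(d' <- ds | same_side (- v0) (rv d) d' &&
  P (crossing (- v0) (rv d) d')) jump w (rv d) d'.
have E1 : S (fun c : R => 0 < c) + S (fun c : R => c < 0) =
    \sum_(d' <- ds | same_side (- v0) (rv d) d') jump w (rv d) d'.
  rewrite /S 2!big_mkcondr -big_split /= big_seq_cond [RHS]big_seq_cond.
  apply: eq_bigr => d' /andP[/cr0 + sd'] => /(_ sd').
  by case: ltgtP => //; rewrite ?addr0 ?add0r.
(* At parameter 0 exactly the kinks at negative parameters have contributed to the slope. Below,
   [a d'] and [b d'] are the constant and the slope of the contribution of [d'] near 0. *)
have E2 : e + S (fun c : R => c < 0) = dot l.1 (rv d).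
  have K : \forall s \near (0 : R), phi (- v0 + s *: rv d) =
      affine_fun l (- v0) + dot l.1 (rv d) * s.
    have := near_line0 (rv d) Hl; apply: filterS => s ->.
    by rewrite affine_fun_at dotZr mulrC.
  pose b d' : R := if crossing (- v0) (rv d) d' < 0 then jump w (rv d) d' else 0.
  pose a d' : R := if crossing (- v0) (rv d) d' < 0
    then - (jump w (rv d) d' * crossing (- v0) (rv d) d') else 0.
  have Kd : \forall s \near (0 : R), forall d', d' \in ds ->
      same_side (- v0) (rv d) d' ->
      jump w (rv d) d' * Num.max 0 (s - crossing (- v0) (rv d) d') = a d' + b d' * s.
    suff Hs (r : seq 'rV[int]_2) : (forall d', d' \in r -> d' \in ds) ->
        \forall s \near (0 : R), forall d', d' \in r ->
      same_side (- v0) (rv d) d' ->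
      jump w (rv d) d' * Num.max 0 (s - crossing (- v0) (rv d) d') = a d' + b d' * s.
      exact: Hs.
    elim: r => [|d' r IH] rds; first by near=> s.
    have {}IH := IH (fun d'' h => rds d'' (@mem_behead _ (d' :: r) d'' h)).
    have [sd'|nsd'] := boolP (same_side (- v0) (rv d) d'); last first.
      apply: filterS IH => s IH d''; rewrite inE => /predU1P[->|/IH//].
      by rewrite (negbTE nsd').
    have c0 := cr0 _ (rds _ (mem_head _ _)) sd'.
    suff : \forall s \near (0 : R), jump w (rv d) d' *
        Num.max 0 (s - crossing (- v0) (rv d) d') = a d' + b d' * s.
      apply: filterS2 IH => s IH Ed' d''.
      by rewrite inE => /predU1P[->|/IH].
    rewrite /a /b.
    have [cn|cp|c00] := ltgtP (crossing (- v0) (rv d) d') 0.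
    - near=> s; rewrite max_r; first by ring.
      by rewrite subr_ge0 ltW//; near: s; exact: lt_nbhsr.
    - near=> s; rewrite max_l ?mulr0 ?mul0r ?addr0//.
      by rewrite subr_le0 ltW//; near: s; exact: lt_nbhsl.
    - by rewrite c00 eqxx in c0.
  have [] := @near_eq_affine _
    (c + \sum_(d' <- ds | same_side (- v0) (rv d) d') a d')
    (e + \sum_(d' <- ds | same_side (- v0) (rv d) d') b d')
    (affine_fun l (- v0)) (dot l.1 (rv d)) 0.
    apply: filterS2 K Kd => s <- Ks; rewrite H mulrDl mulr_suml addrACA.
    rewrite -big_split/=; congr (_ + _).
    by rewrite big_seq_cond [RHS]big_seq_cond; apply: eq_bigr => d' /andP[? ?]; rewrite Ks.
  by move=> _ <-; rewrite /S /b big_mkcondr.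
transitivity (S (fun c : R => 0 < c)); last by rewrite -E -E1 -E2; ring.
rewrite /S.
rewrite big_seq_cond [RHS]big_seq_cond.
have Eq d' : d' \in ds -> meet_rays d d' =
    same_side (- v0) (rv d) d' && (0 < crossing (- v0) (rv d) d').
  move=> _; rewrite /meet_rays /same_side /crossing /fst_par /snd_par.
  rewrite det2Nr opprK det2Nl -[- det2 v0 _]det2C andbC; congr (_ && _).
  have [->|h] := eqVneq (det2 (rv d') (rv d) : R) 0.
    by rewrite mul0r invr0 mulr0.
  rewrite -[RHS](pmulr_rgt0 _ (_ : 0 < (det2 (rv d') (rv d)) ^- 2)); last first.
    by rewrite invr_gt0 exprn_even_gt0.
  by congr (_ < _); field.
have {}Eq d' : (d' \in ds) && meet_rays d d' = (d' \in ds) &&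
    (same_side (- v0) (rv d) d' && (0 < crossing (- v0) (rv d) d')).
  by case: (boolP (d' \in ds)) => //= /Eq ->.
by rewrite (eq_bigl _ _ Eq).
Unshelve. all: by end_near. Qed.

Lemma dot_det2 (a : 'rV[int]_2) x : dot a x = det2 x (rv (rot a)).
Proof. by rewrite dot2 /det2 !mxE/= mulrNz; ring. Qed.

(** The initial slopes on all the rays come from the same covector [l.1]. Written as determinants
    with [rot l.1], they add up to 0 by [fan_balance], so the choice of [v0] leaves no trace. *)
Lemma fan_meet_sum :
  \sum_(d <- ds) \sum_(d' <- ds | meet_rays d d')
    ((w d)%:~R * ((w d')%:~R * `|det2 (rv d') (rv d)|)) =
  \sum_(d <- ds) (w d)%:~R * phi (rv d).
Proof.
have [Uds Hds Haff _ _] := fanphi.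
case E : ds => [|d0 ds']; first by rewrite !big_nil.
have d0ds : d0 \in ds by rewrite E mem_head.
rewrite -E.
have [||l Hl] := Haff (- v0).
- rewrite oppr_eq0; apply: contra (gen d0ds) => /eqP ->.
  by rewrite /det2 !mxE !mulr0 subrr.
- move=> d t dds t0 Ev; have := gen dds.
  by rewrite -[v0]opprK Ev det2Nr det2Zr det2xx mulr0 oppr0 eqxx.
transitivity (\sum_(d <- ds) ((w d)%:~R * phi (rv d) -
    (w d)%:~R * det2 (rv d) (rv (rot l.1)))).
  rewrite big_seq [RHS]big_seq; apply: eq_bigr => d dds.
  by rewrite -mulr_sumr (fan_halfline dds Hl) -mulrBr dot_det2.
by rewrite sumrB (fan_balance fanphi) subr0.
Qed.

End LocalSum.

(** * The multiplicity of a vertex in terms of its fan *)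

Section LocalMultiplicity.
Context {R : realType} (L : lattice R 2) (D : divisor L).
Implicit Types (d : 'rV[int]_2) (x y z v p q : 'rV[R]_2).
Local Notation pi := (@torus_pi R 2 L).
Context (F : 'rV[R]_2 -> R) (DF : is_lift D F) (V : set (torus L)).

Lemma edge_germ_facet z d w la lb : primitive d -> w != 0 ->
  edge_germ F z d w la lb -> facet F z (rot d) w.
Proof.
move=> pd w0 [E H]; split=> //; first exact: primitive_rot.
exists la.1, lb.1; split=> //.
have [Ea Eb] := nbhs_singleton H; rewrite subrr {1 2}/det2 !mxE !mulr0 subrr in Ea Eb.
apply: filterS H => y [h1 h2]; rewrite dot_rot; case: ifP => h.
  by rewrite h1// Ea// -affine_fun_at subrKC.
rewrite h2; first by rewrite Eb// -affine_fun_at subrKC.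
by rewrite ltW// ltNge h.
Qed.

Lemma generic_vector (ds : seq 'rV[int]_2) : (forall d, d \in ds -> d != 0) ->
  exists2 v0 : 'rV[R]_2, v0 != 0 & forall d, d \in ds -> det2 (rv d) v0 != 0.
Proof.
move=> ds0; pose x : R := 1 + \sum_(d <- ds) `|(d 0 1)%:~R|.
exists (\row_i (if i == 0 then 1 else x)).
  by apply/eqP => /rowP/(_ 0); rewrite !mxE /= => /eqP; rewrite oner_eq0.
move=> d dds.
rewrite /det2 !mxE /= mulr1 subr_eq0; apply/eqP => E.
have [d00|d00] := eqVneq (d 0 0) 0.
  have /eqP := ds0 _ dds; apply; apply/rowP => i; elim/ord2P: i; rewrite mxE//.
  by apply/eqP; rewrite -(intr_eq0 R) -E d00 mul0r.
have le1 : 1 <= `|(d 0 0)%:~R : R|.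
  by rewrite -intr_norm -[1]/(1%:~R) ler_int; lia.
have x0 : 0 < x by rewrite ltr_pwDl// sumr_ge0.
have : x <= `|(d 0 1)%:~R|.
  by rewrite -E normrM (gtr0_norm x0) ler_peMl// ltW.
rewrite /x (big_rem _ dds)/= => h.
have : 0 <= \sum_(d <- rem d ds) `|(d 0 1)%:~R : R| by exact: sumr_ge0.
by lra.
Qed.

Lemma fan_transfer p phi (t : R) d ds w A B : is_fan phi ds w A B ->
  (\forall z \near t *: rv d, F (p + z) = F p + phi z) ->
  d \in ds -> 0 < t ->
  edge_germ F (p + t *: rv d) d (w d) (A d, F p - dot (A d) p)
    (B d, F p - dot (B d) p).
Proof.
move=> [_ /(_ d)Hd _ hphi _] tr dds t0; have [pd w0 G] := Hd dds.
have [Eab H] : edge_germ phi (t *: rv d) d (w d) (A d, 0) (B d, 0).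
  apply: (edge_germ_scale hphi (_ : 0 < t^-1)); first by rewrite invr_gt0.
  by rewrite scalerA mulVf ?scale1r ?gt_eqF.
split=> //; rewrite addrC; apply/near_translate.
apply: filterS2 tr H => z; rewrite [p + z]addrC => Ez [h1 h2].
have -> : z + p - (t *: rv d + p) = z - t *: rv d.
  by rewrite opprD addrACA subrr addr0.
rewrite Ez /affine_fun /= !dotDr; split=> hz.
  by rewrite h1// /affine_fun /=; ring.
by rewrite h2// /affine_fun /=; ring.
Qed.

Lemma fan_support y phi ds w A B : is_fan phi ds w A B -> y != 0 ->
  ~ loc_affine phi y -> exists d t, [/\ d \in ds, 0 < t & y = t *: rv d].
Proof.
move=> [_ _ Haff _ _] y0 nA; apply: contrapT => H; apply: nA; apply: Haff => //.
by move=> d t dds t0 E; apply: H; exists d, t.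
Qed.

Lemma det_rot d d' : (\det (col_mx (rot d) (rot d') : 'M[int]_2))%:~R =
  det2 (rv d) (rv d') :> R.
Proof.
have E0 j : (col_mx (rot d) (rot d') : 'M[int]_2) 0 j = rot d 0 j.
  by rewrite -(col_mxEu (rot d) (rot d')); congr (_ _ _); exact: val_inj.
have E1 j : (col_mx (rot d) (rot d') : 'M[int]_2) 1 j = rot d' 0 j.
  by rewrite -(col_mxEd (rot d) (rot d')); congr (_ _ _); exact: val_inj.
rewrite det_mx22 !E0 !E1.
by rewrite /det2 !mxE /= intrB !intrM !mulrNz; ring.
Qed.

(** The first copy is left in place and the second is moved by [v = c *: v0], with [v0] off the
    lines of all rays and [c] so small that every crossing of the two fans lies where [F] coincides
    with its cone and the two stars are available. The value of the hypothesis at these translates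
    is the sum in [fan_meet_sum]. *)
Lemma local_multiplicity_fan p phi ds w A B (m : int) :
  is_cone F p phi -> is_fan phi ds w A B ->
  (\forall y \near p, y != p -> ~ V (pi y)) ->
  local_multiplicity D V D V p m ->
  m%:~R = \sum_(d <- ds) (w d)%:~R * phi (rv d).
Proof.
move=> Fphi fanphi /nearP[e1 e10 isoV].
move=> [U1 [U2 [[U1star [W1 [oW1 W1p U1E]]] [U2star [W2 [oW2 W2p U2E]]]]]].
move=> [[N1 N2] [/= N1P N2P] HN].
have {N1P} N10 : N1 0 by exact: nbhs_singleton N1P.
have {N2P} /nearP[e4 e40 N2P] : \forall v \near (0 : 'rV[R]_2), N2 v by [].
have [e2 e20 Htr] := cone_transfer Fphi.
have /nearP[e3 e30 HW] : \forall y \near p, W1 y /\ W2 y.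
  by apply: filterI; apply: open_nbhs_nbhs.
have [Uds Hds Haff hphi _] := fanphi.
have [v0 v00 gen] := @generic_vector ds (fun d dds =>
  primitive_neq0 (let: And3 pd _ _ := Hds d dds in pd)).
pose e := Num.min (Num.min e1 e2) (Num.min e3 e4).
have e0 : 0 < e by rewrite !lt_min e10 e20 e30 e40.
have [ee1 ee2 ee3 ee4] : [/\ e <= e1, e <= e2, e <= e3 & e <= e4].
  by rewrite /e !ge_min !lexx ?orbT.
(* A common bound for [v0] and for the position vectors of all crossings, before scaling by [c]. *)
pose M : R := 1 + `|v0| + \sum_(d <- ds) \sum_(d' <- ds)
  (`|fst_par v0 d d' *: rv d| + `|snd_par v0 d d' *: rv d'|).
have M0 : 0 < M.
  rewrite /M -addrA ltr_pwDl// addr_ge0// sumr_ge0// => d _.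
  by apply: sumr_ge0 => d' _; exact: addr_ge0.
have [c c0 small] : exists2 c : R, 0 < c &
    forall y : 'rV[R]_2, `|y| <= M -> `|c *: y| < e.
  have c0 : 0 < e / (2 * M) by rewrite divr_gt0// mulr_gt0.
  exists (e / (2 * M)) => // y yM; rewrite normrZ (gtr0_norm c0).
  apply: (@le_lt_trans _ _ (e / (2 * M) * M)); first by rewrite ler_wpM2l// ltW.
  by rewrite invfM mulrA mulfVK ?gt_eqF// ltr_pdivrMr// ltr_pMr// ltr1n.
have sumM d d' : d \in ds -> d' \in ds ->
    `|fst_par v0 d d' *: rv d| + `|snd_par v0 d d' *: rv d'| <= M.
  move=> dds d'ds; rewrite /M (big_rem _ dds)/= (big_rem _ d'ds)/=.
  set a := `|fst_par _ _ _ *: _|; set b := `|snd_par _ _ _ *: _|.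
  set s1 := \sum_(y <- rem d' ds) _; set s2 := \sum_(y <- rem d ds) _.
  have : 0 <= s1 by apply: sumr_ge0 => ? _; exact: addr_ge0.
  have : 0 <= s2.
    by apply: sumr_ge0 => ? _; apply: sumr_ge0 => ? _; exact: addr_ge0.
  have := normr_ge0 v0; lra.
pose v := c *: v0.
have vE : `|v| < e.
  apply: small; rewrite /M addrAC lerDr addr_ge0// sumr_ge0// => d _.
  by apply: sumr_ge0 => d' _; exact: addr_ge0.
pose Q := [seq dd <- [seq (d, d') | d <- ds, d' <- ds] | meet_rays v0 dd.1 dd.2].
pose pt (dd : 'rV[int]_2 * 'rV[int]_2) : 'rV[R]_2 :=
  p + (c * fst_par v0 dd.1 dd.2) *: rv dd.1.
pose val (dd : 'rV[int]_2 * 'rV[int]_2) : int :=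
  w dd.1 * w dd.2 * `|\det (col_mx (rot dd.1) (rot dd.2) : 'M[int]_2)|.
have QP dd : dd \in Q -> [/\ dd.1 \in ds, dd.2 \in ds & meet_rays v0 dd.1 dd.2].
  rewrite mem_filter => /andP[m' /allpairsP[[d d'] [/= ? ? E]]].
  by move: m'; rewrite E.
have UQ : uniq Q.
  apply: filter_uniq; apply: allpairs_uniq => //.
  by move=> [? ?] [? ?] _ _ /= [-> ->].
have ptv dd : dd \in Q -> pt dd - v = p + (c * snd_par v0 dd.1 dd.2) *: rv dd.2.
  move=> /QP[_ _ /meet_rays_par[_ E]].
  have -> : v = (c * fst_par v0 dd.1 dd.2) *: rv dd.1 -
      (c * snd_par v0 dd.1 dd.2) *: rv dd.2.
    by rewrite /v [X in c *: X = _]E scalerBr !scalerA.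
  by rewrite /pt opprB -addrA; congr (_ + _); rewrite addrC subrK.
have near_pt d (t : R) : d \in ds -> 0 < t -> `|t *: rv d| < e ->
    [/\ edge_germ F (p + t *: rv d) d (w d) (A d, F p - dot (A d) p)
          (B d, F p - dot (B d) p), facet F (p + t *: rv d) (rot d) (w d),
      Defs.support D (p + t *: rv d), ~ V (pi (p + t *: rv d)) &
      W1 (p + t *: rv d) /\ W2 (p + t *: rv d)].
  move=> dds t0 te; have [pd w0 _] := Hds _ dds.
  have G := fan_transfer fanphi (Htr _ (lt_le_trans te ee2)) dds t0.
  have d0 := primitive_neq0 pd.
  split=> //.
  - exact: edge_germ_facet G.
  - by apply/(lift_support DF); exact: edge_germ_not_affine G.
  - apply: isoV; first by rewrite addrAC subrr add0r (lt_le_trans te).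
    rewrite -subr_eq0 addrAC subrr add0r scaler_eq0 negb_or rv_eq0 d0 andbT.
    by rewrite gt_eqF.
  - by apply: HW; rewrite addrAC subrr add0r (lt_le_trans te).
have ptQ dd : dd \in Q -> [/\ 0 < c * fst_par v0 dd.1 dd.2,
    0 < c * snd_par v0 dd.1 dd.2,
    `|(c * fst_par v0 dd.1 dd.2) *: rv dd.1 : 'rV[R]_2| < e &
    `|(c * snd_par v0 dd.1 dd.2) *: rv dd.2 : 'rV[R]_2| < e].
  move=> /QP[d1 d2 /andP[m1 m2]]; have := sumM _ _ d1 d2.
  have := normr_ge0 (fst_par v0 dd.1 dd.2 *: rv dd.1 : 'rV[R]_2).
  have := normr_ge0 (snd_par v0 dd.1 dd.2 *: rv dd.2 : 'rV[R]_2).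
  move=> b0 a0 ab; split; [exact: mulr_gt0|exact: mulr_gt0| |];
    rewrite -scalerA; apply: small; lra.
have ptI : {in Q &, injective pt}.
  move=> [d1 d1'] [d2 d2'] Q1 Q2 E.
  have [m1 m1' _ _] := ptQ _ Q1; have [m2 m2' _ _] := ptQ _ Q2.
  have [d1ds d1'ds _] := QP _ Q1; have [d2ds d2'ds _] := QP _ Q2.
  have [p1 _ _] := Hds _ d1ds; have [p1' _ _] := Hds _ d1'ds.
  have [p2 _ _] := Hds _ d2ds; have [p2' _ _] := Hds _ d2'ds.
  have E1 : d1 = d2 := ray_unique p1 p2 m1 m2 (addrI _ E).
  have E2 : pt (d1, d1') - v = pt (d2, d2') - v by rewrite E.
  rewrite !ptv// in E2.
  have E3 : d1' = d2' := ray_unique p1' p2' m1' m2' (addrI _ E2).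
  by rewrite E1 E3.
have Upt : uniq (map pt Q) by rewrite map_inj_in_uniq.
(* This makes [val] a function of the point. Since [pt] is injective on [Q], the sum has a single
   term at each crossing. *)
pose mu q := \sum_(dd <- Q | pt dd == q) val dd.
have muE dd : dd \in Q -> mu (pt dd) = val dd.
  move=> ddQ; rewrite /mu -big_filter.
  rewrite (_ : [seq i <- Q | pt i == pt dd] = [:: dd]) ?big_seq1//.
  apply: perm_small_eq => //; apply: uniq_perm => // [|i]; first exact: filter_uniq.
  rewrite mem_filter inE; apply/andP/eqP => [[/eqP E iQ]|->//].
  exact: ptI.
have IE : translate U1 0 `&` translate U2 v = [set` map pt Q].
  apply/seteqP; split=> q.
    rewrite /translate /= subr0 => -[U1q U2q].
    (* A star neighbourhood may reach beyond the radius [e]. Its points still lie on the rays of the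
       fan: the open star contains the segment towards [p], part of which is close to [p], and the
       locus where [phi] is not affine is a cone. *)
    have cone_of U W' : U `<=` open_star D V p -> U = W' `&` Defs.support D ->
        forall y, U (p + y) -> y != 0 ->
        exists d t, [/\ d \in ds, 0 < t & y = t *: rv d].
      move=> Ustar UE y Uy y0; apply: (fan_support fanphi y0) => A0.
      have [E|Hst] := Ustar _ Uy.
        by move: y0; rewrite -(addKr p y) E addNr eqxx.
      have y1 : 0 < 1 + `|y| by rewrite ltr_pwDl.
      pose t := Num.min 1 (e / (2 * (1 + `|y|))).
      have t0 : 0 < t by rewrite lt_min ltr01 divr_gt0 ?mulr_gt0.
      have te : `|t *: y| < e.
        rewrite normrZ (gtr0_norm t0).
        have h1 : t <= e / (2 * (1 + `|y|)) by rewrite ge_min lexx orbT.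
        have h2 : e / (2 * (1 + `|y|)) * (1 + `|y|) = e / 2.
          by field; rewrite gt_eqF.
        have h3 : t * `|y| <= t * (1 + `|y|) by rewrite ler_wpM2l ?ltW// ltrDr.
        have h4 : t * (1 + `|y|) <= e / (2 * (1 + `|y|)) * (1 + `|y|).
          by rewrite ler_wpM2r// ltW.
        by lra.
      have [|+ _] := Hst t; first by rewrite t0 ge_min lexx.
      rewrite addrAC subrr add0r => /(lift_support DF); apply.
      apply/(transfer_affine (Htr _ (lt_le_trans te ee2))).
      apply: (cone_scale hphi (_ : 0 < t^-1)); first by rewrite invr_gt0.
      by rewrite scalerA mulVf ?scale1r ?gt_eqF.
    have vray d (t : R) : d \in ds -> v <> t *: rv d.
      move=> dds E; have := gen _ dds; apply/negP; rewrite negbK.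
      rewrite -(inj_eq (mulfI (lt0r_neq0 c0))) -det2Zr -/v E det2Zr det2xx.
      by rewrite !mulr0.
    have c1 := cone_of _ _ U1star U1E; have c2 := cone_of _ _ U2star U2E.
    have U1q' : U1 (p + (q - p)) by rewrite subrKC.
    have U2q' : U2 (p + (q - v - p)) by rewrite subrKC.
    have vn0 : v != 0 by rewrite scaler_eq0 negb_or v00 gt_eqF.
    have [d [s [dds s0 Es]]] : exists d s, [/\ d \in ds, 0 < s & q - p = s *: rv d].
      apply: c1 => //; rewrite subr_eq0; apply/eqP => qp.
      have [|d [t [dds _ E]]] := c2 _ U2q'.
        by rewrite qp addrAC subrr add0r oppr_eq0.
      apply: (vray d (- t) dds); rewrite scaleNr -E qp addrAC subrr add0r.
      by rewrite opprK.
    have [d' [s' [d'ds s'0 Es']]] :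
        exists d s, [/\ d \in ds, 0 < s & q - v - p = s *: rv d].
      apply: c2 => //; rewrite subr_eq0 subr_eq addrC -subr_eq; apply/eqP => qp.
      by apply: (vray d s dds); rewrite -qp Es.
    have Ev : v0 = (s / c) *: rv d - (s' / c) *: rv d'.
      apply: (scalerI (lt0r_neq0 c0)); rewrite -/v scalerBr !scalerA.
      rewrite !(mulrC c) !divfK ?gt_eqF// -Es -Es'.
      by apply/rowP => i; rewrite !mxE; ring.
    have [f1 f2] := par_meet_rays (gen _ dds) (divr_gt0 s0 c0) (divr_gt0 s'0 c0) Ev.
    apply/mapP; exists (d, d').
      rewrite mem_filter /= /meet_rays -f1 -f2 !divr_gt0//=.
      by apply/allpairsP; exists (d, d').
    have Ec : c * fst_par v0 d d' = s by rewrite -f1 mulrC divfK ?gt_eqF.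
    by rewrite /pt /= Ec -Es subrKC.
  move=> /mapP[dd ddQ ->]; have [m1 m2 s1 s2] := ptQ _ ddQ.
  have [d1ds d2ds _] := QP _ ddQ.
  have [_ _ S1 _ [? _]] := near_pt _ _ d1ds m1 s1.
  have [_ _ S2 _ [_ ?]] := near_pt _ _ d2ds m2 s2.
  by split; rewrite /translate /= ?subr0 ?U1E ?U2E ?ptv//; split.
have := HN (0, v) (conj N10 (N2P v _)); rewrite subr0.
move=> /(_ (lt_le_trans vE ee4)) /=; rewrite IE => /(_ mu) <- //.
- rewrite -fsbig_seq// big_map rmorph_sum /=.
  transitivity (\sum_(dd <- Q) (w dd.1)%:~R *
      ((w dd.2)%:~R * `|det2 (rv dd.2) (rv dd.1)|) : R).
    rewrite big_seq [RHS]big_seq; apply: eq_bigr => dd ddQ.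
    by rewrite muE// /val !intrM intr_norm det_rot det2C normrN mulrA.
  rewrite -(fan_meet_sum fanphi gen) /Q big_filter big_mkcond.
  rewrite big_allpairs_dep /=.
  by apply: eq_bigr => d _; rewrite [RHS]big_mkcond.
- move=> q Iq; have {Iq} : (translate U1 0 `&` translate U2 v) q by [].
  rewrite IE => /= /mapP[dd ddQ ->]; rewrite subr0 muE// ptv//.
  have [m1 m2 s1 s2] := ptQ _ ddQ; have [d1ds d2ds mr] := QP _ ddQ.
  have [_ f1 _ V1 _] := near_pt _ _ d1ds m1 s1.
  have [_ f2 _ V2 _] := near_pt _ _ d2ds m2 s2.
  exists (rot dd.1), (w dd.1), (rot dd.2), (w dd.2); split=> //.
  + by split=> //; apply/(lift_facet DF).
  + by split=> //; apply/(lift_facet DF).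
  + rewrite -(intr_eq0 R) det_rot det2C oppr_eq0.
    by have [] := meet_rays_par mr.
Qed.

End LocalMultiplicity.

(** * The edges of a divisor and its self-intersection number *)

Section Edges.
Context {R : realType} (L : lattice R 2).
Implicit Types (d u : 'rV[int]_2) (x y z v p q : 'rV[R]_2).
Local Notation pi := (@torus_pi R 2 L).

(** Two lifts of one point of the torus that are within half the separation of the lattice from [z]
    coincide, so each of the finitely many points has at most one lift there. *)
Lemma finite_set_isolated (V : set (torus L)) z : finite_set V ->
  \forall y \near z, y != z -> ~ V (pi y).
Proof.
move=> /finite_seqP[s ->].
have [e e0 He] := lattice_separated L.
suff : \forall y \near z, forall c, c \in s -> y != z -> pi y <> c.
  by apply: filterS => y Hy yz /Hy; apply.
apply: near_all_seq => c _.
have e2 : 0 < e / 2 by rewrite divr_gt0.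
have uniq_lift y y' : `|y - z| < e / 2 -> `|y' - z| < e / 2 -> pi y = c ->
    pi y' = c -> y = y'.
  move=> h h' E E'; apply/eqP; rewrite -subr_eq0; apply/eqP/He.
    by apply/torus_piP; rewrite E E'.
  have -> : y - y' = (y - z) - (y' - z) by rewrite opprB addrA subrK.
  by rewrite (le_lt_trans (ler_normB _ _))// [e]splitr ltrD.
have [[y0 [y0z Ey0 nz]]|H] := pselect (exists y0,
    [/\ `|y0 - z| < e / 2, pi y0 = c & y0 != z]).
  have d0 : 0 < `|y0 - z| by rewrite normr_gt0 subr_eq0.
  apply: filterS (near_rV z d0) => y yd yz E.
  have := uniq_lift y y0 (lt_trans yd y0z) y0z E Ey0.
  by move=> Eyy; rewrite Eyy ltxx in yd.
apply: filterS (near_rV z e2) => y yd yz E.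
by apply: H; exists y.
Qed.

(** The parameters of the vertices on the line are isolated. Isolation at 0 makes their infimum
    positive, and isolation at the infimum makes it attained. *)
Lemma first_vertex (V : set (torus L)) x v : finite_set V -> v != 0 ->
  (exists2 t : R, 0 < t & V (pi (x + t *: v))) ->
  exists T : R, [/\ 0 < T, V (pi (x + T *: v)) &
    forall t, 0 < t < T -> ~ V (pi (x + t *: v))].
Proof.
move=> finV v0 [t1 t10 Vt1].
pose S := [set t : R | 0 < t /\ V (pi (x + t *: v))].
have S0 : S !=set0 by exists t1.
have lS : has_lbound S by exists 0 => t [/ltW].
have hS : has_inf S by [].
have iso s : exists2 e : R, 0 < e & forall t, `|t - s| < e -> t != s ->
    ~ V (pi (x + t *: v)).
  have /near_line/nearP[e e0 He] := finite_set_isolated (x + s *: v) finV.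
  exists e => // t te ts; apply: He => //.
  by rewrite (inj_eq (addrI x)) -subr_eq0 -scalerBl scaler_eq0 negb_or v0 subr_eq0 ts.
have [e0 e00 He0] := iso 0.
have eT : e0 <= inf S.
  apply: lb_le_inf => // t [t0 Vt]; rewrite leNgt; apply/negP => te.
  by apply: (He0 t) Vt; rewrite ?subr0 ?gtr0_norm ?gt_eqF.
have T0 := lt_le_trans e00 eT.
exists (inf S); split=> //; last first.
  move=> t /andP[t0 tT] Vt; have : inf S <= t by apply: ge_inf.
  by rewrite leNgt tT.
apply: contrapT => nV; have [e e1 He] := iso (inf S).
have [|t [t0 Vt] tT] := @inf_lt _ S (inf S + e) S0.
  by rewrite ltrDl.
have Tt : inf S <= t by apply: ge_inf.
apply: (He t _ _ Vt); first by rewrite ger0_norm; lra.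
by apply/eqP => E; apply: nV; rewrite -E.
Qed.

End Edges.

(** * Oriented edges and the form defined by their periods *)

Section EdgeEnds.
Context {R : realType} (L : lattice R 2) (F : 'rV[R]_2 -> R)
  (a : 'rV[R]_2 -> 'rV[int]_2) (b : 'rV[R]_2 -> R) (V : set (torus L)).
Implicit Types (d u : 'rV[int]_2) (x y z v p q l : 'rV[R]_2).
Local Notation pi := (@torus_pi R 2 L).
Context (Fab : quasi_periodic L F a b) (finV : finite_set V)
  (facetV : forall q, ~ V (pi q) -> ~ loc_affine F q -> exists u w, facet F q u w)
  (followV : forall q u w (v : 'rV[R]_2), ~ V (pi q) -> facet F q u w ->
     dot u v = 0 -> v != 0 -> exists2 t : R, 0 < t & V (pi (q + t *: v))).
Context (phi : 'rV[R]_2 -> 'rV[R]_2 -> R) (ds : 'rV[R]_2 -> seq 'rV[int]_2)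
  (w : 'rV[R]_2 -> 'rV[int]_2 -> int) (A B : 'rV[R]_2 -> 'rV[int]_2 -> 'rV[int]_2)
  (Fphi : forall x, is_cone F x (phi x))
  (fanphi : forall x, is_fan (phi x) (ds x) (w x) (A x) (B x)).

Definition upper x d := (A x d, F x - dot (A x d) x).
Definition lower x d := (B x d, F x - dot (B x d) x).

Lemma dir_primitive x d : d \in ds x -> primitive d.
Proof. by have [_ H _ _ _] := fanphi x; move=> /H[]. Qed.

Lemma weight_neq0 x d : d \in ds x -> w x d != 0.
Proof. by have [_ H _ _ _] := fanphi x; move=> /H[]. Qed.

Lemma dir_rv_neq0 x d : d \in ds x -> rv d != 0 :> 'rV[R]_2.
Proof. by move=> /dir_primitive/primitive_neq0; rewrite rv_eq0. Qed.

Lemma vertex_edge_germ x d : d \in ds x -> exists2 e : R, 0 < e &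
  forall t, 0 < t < e -> edge_germ F (x + t *: rv d) d (w x d)
    (upper x d) (lower x d).
Proof.
move=> dds; have [e e0 He] := cone_transfer (Fphi x).
have d0 := dir_rv_neq0 dds.
exists (e / `|rv d : 'rV[R]_2|); first by rewrite divr_gt0// normr_gt0.
move=> t /andP[t0 te]; apply: (fan_transfer (fanphi x) _ dds t0).
apply: He; rewrite normrZ (gtr0_norm t0).
by rewrite -ltr_pdivlMr// normr_gt0.
Qed.

Lemma phi_dir x d : d \in ds x ->
  phi x (rv d) = dot (A x d) (rv d) /\ phi x (rv d) = dot (B x d) (rv d).
Proof.
have [_ H _ _ _] := fanphi x; move=> /H[_ _ [_ /nbhs_singleton]].
by rewrite subrr {1 2}/det2 !mxE !mulr0 subrr /affine_fun !addr0 => -[-> // ->].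
Qed.

Lemma dirP x d : d \in ds x <-> primitive d /\ ~ loc_affine (phi x) (rv d).
Proof.
split=> [dds|[pd nA]].
  split; first exact: dir_primitive dds.
  have [_ /(_ d dds)[pd w0 G] _ _ _] := fanphi x.
  exact: edge_germ_not_affine (primitive_neq0 pd) w0 G.
have [|d' [t [d'ds t0 E]]] := fan_support (fanphi x) _ nA.
  by rewrite rv_eq0; exact: primitive_neq0.
suff -> : d = d' by [].
apply: (@ray_unique R d d' 1 t) => //; first exact: dir_primitive d'ds.
by rewrite scale1r.
Qed.

Lemma dir_not_affine y d (T : R) : 0 < T -> primitive d ->
  (forall t, 0 < t < T -> ~ loc_affine F (y + t *: rv d)) -> d \in ds y.
Proof.
move=> T0 pd nA; have [e e0 He] := cone_transfer (Fphi y).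
apply/dirP; split=> // Aff.
have nr : 0 < `|rv d : 'rV[R]_2| by rewrite normr_gt0 rv_eq0 primitive_neq0.
pose t := Num.min (T / 2) (e / `|rv d : 'rV[R]_2| / 2).
have t0 : 0 < t by rewrite lt_min !divr_gt0.
have te : `|t *: rv d : 'rV[R]_2| < e.
  rewrite normrZ (gtr0_norm t0) -ltr_pdivlMr// gt_min; apply/orP; right.
  have : 0 < e / `|rv d : 'rV[R]_2| by rewrite divr_gt0.
  lra.
have [hphi _ _ _] := Fphi y.
apply: (nA t); first by rewrite t0 gt_min; lra.
apply/(transfer_affine (He _ te)); apply: (cone_scale hphi (_ : 0 < t^-1)).
  by rewrite invr_gt0.
by rewrite scalerA mulVf ?scale1r ?gt_eqF.
Qed.

(** A point slightly beyond [x] on the ray lies on an edge, from which [followV] leads to some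
    vertex and hence to a first one. Up to there all points off the affine locus are facets, so the
    germ persists. *)
Lemma edge_first_vertex x d : d \in ds x -> exists T : R,
  [/\ 0 < T, V (pi (x + T *: rv d)) &
    forall t, 0 < t < T -> ~ V (pi (x + t *: rv d)) /\
      edge_germ F (x + t *: rv d) d (w x d) (upper x d) (lower x d)].
Proof.
move=> dds; have pd := dir_primitive dds; have w0 := weight_neq0 dds.
have d0 := dir_rv_neq0 dds.
have [e e0 He] := vertex_edge_germ dds.
have /near0_pos[e' e'0 He'] := near_line0 (rv d) (finite_set_isolated x finV).
have iso t : 0 < t <= e' -> ~ V (pi (x + t *: rv d)).
  move=> /andP[t0 te]; apply: He'; first by rewrite gtr0_norm.
  by rewrite -subr_eq0 addrAC subrr add0r scaler_eq0 negb_or d0 gt_eqF.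
have [T [T0 VT HT]] : exists T : R, [/\ 0 < T, V (pi (x + T *: rv d)) &
    forall t, 0 < t < T -> ~ V (pi (x + t *: rv d))].
  apply: first_vertex => //.
  pose t1 := Num.min (e / 2) e'.
  have t10 : 0 < t1 by rewrite lt_min divr_gt0.
  have nV1 : ~ V (pi (x + t1 *: rv d)).
    by apply: iso; rewrite t10 ge_min lexx orbT.
  have G1 : edge_germ F (x + t1 *: rv d) d (w x d) (upper x d) (lower x d).
    by apply: He; rewrite t10 gt_min; lra.
  have [|t t0 Vt] := followV nV1 (edge_germ_facet pd w0 G1) _ d0.
    by rewrite dot_rot det2xx.
  exists (t1 + t); first exact: addr_gt0.
  by rewrite scalerDl addrA.
exists T; split=> // t tT; split; first exact: HT.
have /andP[t0 tT'] := tT.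
pose t1 := Num.min (e / 2) t.
have t10 : 0 < t1 by rewrite lt_min divr_gt0.
have t1t : t1 <= t by rewrite ge_min lexx orbT.
have G1 : edge_germ F (x + t1 *: rv d) d (w x d) (upper x d) (lower x d).
  by apply: He; rewrite t10 gt_min; lra.
have shift s : x + t1 *: rv d + s *: rv d = x + (t1 + s) *: rv d.
  by rewrite scalerDl addrA.
have -> : t = t1 + (t - t1) by rewrite subrKC.
rewrite -shift; apply: (@edge_germ_persist R F _ d _ _ _ (T - t1) pd w0 _ G1) => [s /andP[s0 s1]|].
  rewrite shift; apply: facetV; apply: HT.
  by apply/andP; split; lra.
by rewrite subr_ge0 t1t ltrD2r.
Qed.

(* The length of the edge that leaves [x] in direction [d]. *)
Definition ret x d : R := xget 0 [set T | [/\ 0 < T, V (pi (x + T *: rv d)) &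
    forall t, 0 < t < T -> ~ V (pi (x + t *: rv d))]].

Lemma retP x d : d \in ds x -> [/\ 0 < ret x d, V (pi (x + ret x d *: rv d)) &
    forall t, 0 < t < ret x d -> ~ V (pi (x + t *: rv d)) /\
      edge_germ F (x + t *: rv d) d (w x d) (upper x d) (lower x d)].
Proof.
move=> dds; have [T [T0 VT HT]] := edge_first_vertex dds.
suff -> : ret x d = T by [].
apply: xget_unique; first by split=> // t /HT[].
move=> T' [T'0 VT' HT']; apply/eqP; rewrite eq_le !leNgt.
apply/andP; split; apply/negP => h.
  by apply: (HT' T) VT; rewrite T0.
by have [] := HT T' _; rewrite ?T'0.
Qed.

Lemma ret_unique x d T : 0 < T -> V (pi (x + T *: rv d)) ->
  (forall t, 0 < t < T -> ~ V (pi (x + t *: rv d))) -> ret x d = T.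
Proof.
move=> T0 VT HT; apply: xget_unique => // T' [T'0 VT' HT'].
apply/eqP; rewrite eq_le !leNgt; apply/andP; split; apply/negP => h.
  by apply: (HT' T) VT; rewrite T0.
by apply: (HT T') VT'; rewrite T'0.
Qed.

Definition edge_end x d := x + ret x d *: rv d.

Lemma edge_end_back x d t : edge_end x d + t *: rv (- d) =
  x + (ret x d - t) *: rv d.
Proof. by rewrite /edge_end rvN scalerN scalerBl addrA. Qed.

(** Read backwards, the germ along the edge has direction [- d] with its sides exchanged. Close to
    the far end it must agree with the germ of the ray [- d] of the fan there, which transfers
    weight and slope. *)
Lemma edge_end_dir x d : V (pi x) -> d \in ds x ->
  [/\ - d \in ds (edge_end x d), w (edge_end x d) (- d) = w x d,
      phi (edge_end x d) (rv (- d)) = - phi x (rv d) &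
      ret (edge_end x d) (- d) = ret x d].
Proof.
move=> Vx dds; have [T0 VT HT] := retP dds; set y := edge_end x d.
have pd := dir_primitive dds; have w0 := weight_neq0 dds.
have d0 := primitive_neq0 pd.
have back t : 0 < t < ret x d -> edge_germ F (y + t *: rv (- d)) (- d) (w x d)
    (lower x d) (upper x d).
  move=> /andP[t0 t1]; apply: edge_germN; rewrite edge_end_back.
  by have [] := HT (ret x d - t) _ => //; rewrite subr_gt0 t1 gtrBl.
have dsN : - d \in ds y.
  apply: (dir_not_affine T0); first exact: primitiveN.
  by move=> t /back; apply: edge_germ_not_affine; rewrite ?oppr_eq0.
have [e' e'0 He'] := vertex_edge_germ dsN.
pose t := Num.min (ret x d / 2) (e' / 2).
have t0 : 0 < t by rewrite lt_min !divr_gt0.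
have G1 : edge_germ F (y + t *: rv (- d)) (- d) (w y (- d)) (upper y (- d))
    (lower y (- d)) by apply: He'; rewrite t0 gt_min; lra.
have G2 := back t; have {}G2 := G2 ltac:(by rewrite t0 gt_min; lra).
have [|Ew Eu El] := edge_germ_inj _ G1 G2; first by rewrite oppr_eq0.
split=> //.
  have [-> _] := phi_dir dsN; have [_ ->] := phi_dir dds.
  by move: Eu => [-> _]; rewrite rvN dotNr.
apply: ret_unique => //.
  by rewrite edge_end_back subrr scale0r addr0.
move=> s /andP[s0 s1]; rewrite edge_end_back.
by have [] := HT (ret x d - s) _ => //; rewrite subr_gt0 s1 gtrBl.
Qed.

Lemma phi_shift x l v : lattice_set L l ->
  phi (x + l) v = phi x v + dot (a l) v.
Proof.
move=> Ll; have [h1 _ _ n1] := Fphi (x + l); have [h2 _ _ n2] := Fphi x.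
move: n1 => /near_translate n1.
have n12 : \forall y \near x,
    F (y + l) = F (x + l) + phi (x + l) (y + l - (x + l)) /\
    F y = F x + phi x (y - x) by apply: filterI.
have /near0_pos[e e0 He] := near_line0 v n12.
have [] := He e; first by rewrite gtr0_norm.
have -> : x + e *: v + l - (x + l) = e *: v.
  by rewrite opprD addrACA subrr addr0 addrAC subrr add0r.
have -> : x + e *: v - x = e *: v by rewrite addrAC subrr add0r.
rewrite !(Fab Ll) (h1 _ _ (ltW e0)) (h2 _ _ (ltW e0)) dotDr dotZr => E1 E2.
apply: (mulfI (lt0r_neq0 e0)); rewrite mulrDr.
by move: E1; rewrite E2; lra.
Qed.

Lemma loc_affine_phi_shift x l v : lattice_set L l ->
  loc_affine (phi (x + l)) v -> loc_affine (phi x) v.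
Proof.
move=> Ll H; have := loc_affineB H (loc_affine_fun (a l, 0) v).
apply: loc_affine_ext; near=> y; rewrite phi_shift// /affine_fun /= addr0.
by rewrite addrK.
Unshelve. all: by end_near. Qed.

Lemma dir_shift x l d : lattice_set L l -> d \in ds x -> d \in ds (x + l).
Proof.
move=> Ll /dirP[pd nA]; apply/dirP; split=> //.
by move=> /(loc_affine_phi_shift Ll).
Qed.

Lemma weight_shift x l d : lattice_set L l -> d \in ds x -> w (x + l) d = w x d.
Proof.
move=> Ll dds; have dds' := dir_shift Ll dds.
have [_ /(_ _ dds)[pd _ [E G]] _ _ _] := fanphi x.
have [_ /(_ _ dds')[_ _ G'] _ _ _] := fanphi (x + l).
have G2 : edge_germ (phi (x + l)) (rv d) d (w x d) (A x d + a l, 0)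
    (B x d + a l, 0).
  split; first by rewrite /= opprD addrACA subrr addr0.
  apply: filterS G => y [h1 h2]; rewrite phi_shift//.
  rewrite /affine_fun /= !addr0 !dotDl; split=> h.
    by rewrite h1// /affine_fun /= addr0.
  by rewrite h2// /affine_fun /= addr0.
by have [] := edge_germ_inj (primitive_neq0 pd) G' G2.
Qed.

Lemma ret_shift x l d : lattice_set L l -> d \in ds x -> ret (x + l) d = ret x d.
Proof.
move=> Ll dds; have [T0 VT HT] := retP dds.
have E t : pi (x + l + t *: rv d) = pi (x + t *: rv d).
  by rewrite addrAC (torus_piD _ Ll).
by apply: ret_unique => //; rewrite ?E// => t /HT[]; rewrite E.
Qed.

Context (sV : seq (torus L)) (VE : V = [set` sV]) (UsV : uniq sV).

Definition rep y : 'rV[R]_2 := repr (pi y).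

Lemma pi_rep y : pi (rep y) = pi y.
Proof. by rewrite /rep /torus_pi reprK. Qed.

Lemma rep_lattice y : lattice_set L (y - rep y).
Proof. by apply/torus_piP; rewrite pi_rep. Qed.

Definition vertices : seq 'rV[R]_2 := map repr sV.

Lemma vertexP x : x \in vertices <-> V (pi x) /\ rep x = x.
Proof.
rewrite VE; split=> [/mapP[s sV' ->]|[/= Vx E]].
  by rewrite /rep /torus_pi reprK.
by apply/mapP; exists (pi x).
Qed.

(* A dart is an edge of the divisor on the torus together with one of its two
   orientations, stored as its initial vertex and its primitive direction. *)
Definition darts : seq ('rV[R]_2 * 'rV[int]_2) :=
  [seq (x, d) | x <- vertices, d <- ds x].

Lemma dartP h : h \in darts <-> h.1 \in vertices /\ h.2 \in ds h.1.
Proof.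
case: h => x d; split=> [/allpairsPdep[x' [d' [? ? [-> ->]]]]//|[h1 h2]].
by apply/allpairsPdep; exists x, d.
Qed.

Lemma darts_uniq : uniq darts.
Proof.
apply: allpairs_uniq_dep.
- by rewrite map_inj_uniq//; exact: can_inj reprK.
- by move=> x _; have [] := fanphi x.
- by move=> [x d] [x' d'] _ _ /= [-> ->].
Qed.

(** The edge is followed in the plane, so its far end need not be the chosen representative of its
    class; [dart_shift] is the lattice vector between the two. *)
Definition dart_end h := edge_end h.1 h.2.
Definition dart_opp h := (rep (dart_end h), - h.2).
Definition dart_shift h := dart_end h - rep (dart_end h).

Lemma dart_oppP h : h \in darts ->
  [/\ dart_opp h \in darts,
      dart_opp (dart_opp h) = h,
      dart_shift (dart_opp h) = - dart_shift h,
      w (dart_opp h).1 (dart_opp h).2 = w h.1 h.2 &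
      phi (dart_opp h).1 (rv (dart_opp h).2) =
        - phi h.1 (rv h.2) + dot (a (dart_shift h)) (rv h.2)].
Proof.
case: h => x d /dartP[/= /vertexP[Vx rx] dds].
have [T0 VT HT] := retP dds; have [Ed Ew Ep Er] := edge_end_dir Vx dds.
rewrite /dart_opp /dart_shift /dart_end /=; set y := edge_end x d.
have Ll := rep_lattice y; set l := y - rep y in Ll *.
have ry : rep y = y + - l by rewrite /l opprB subrKC.
have LN : lattice_set L (- l) by exact: latticeN.
have dsr : - d \in ds (rep y) by rewrite ry; exact: dir_shift.
have wr : w (rep y) (- d) = w x d by rewrite ry weight_shift.
have rr : ret (rep y) (- d) = ret x d by rewrite ry ret_shift.
have Ee : edge_end (rep y) (- d) = x - l.
  rewrite /edge_end rr ry rvN scalerN addrAC; congr (_ - l).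
  by rewrite /y /edge_end addrK.
have re : rep (x - l) = x by rewrite /rep (torus_piD _ LN) -/(rep x).
split=> //.
- by apply/dartP; split=> //=; apply/vertexP; rewrite pi_rep /rep pi_rep.
- by rewrite Ee re opprK.
- by rewrite Ee re addrAC subrr add0r.
- have := phi_shift (rep y) (rv (- d)) Ll; rewrite subrKC -/y Ep => E.
  by rewrite -[LHS](addrK (dot (a l) (rv (- d)))) -E rvN dotNr opprK.
Qed.

Lemma dart_sum_opp (f : 'rV[R]_2 * 'rV[int]_2 -> R) :
  \sum_(h <- darts) f (dart_opp h) = \sum_(h <- darts) f h.
Proof.
rewrite -(big_map dart_opp xpredT f); apply: perm_big; apply: uniq_perm.
- rewrite map_inj_in_uniq ?darts_uniq// => h h' hd hd' E.
  by have [_ <- _ _ _] := dart_oppP hd; have [_ <- _ _ _] := dart_oppP hd'; rewrite E.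
- exact: darts_uniq.
move=> h; apply/mapP/idP => [[h' /dart_oppP[? _ _ _ _] ->]//|hd].
by have [? E _ _ _] := dart_oppP hd; exists (dart_opp h).
Qed.

(** Balancing at each vertex; any factor that depends only on the initial vertex may be inserted. *)
Lemma dart_balance (f : 'rV[R]_2 -> R) q :
  \sum_(h <- darts) (w h.1 h.2)%:~R * (f h.1 * det2 (rv h.2) q) = 0.
Proof.
rewrite /darts big_allpairs_dep /= big1// => x _.
rewrite (eq_bigr (fun d => f x * ((w x d)%:~R * det2 (rv d) q))).
  by rewrite -mulr_sumr (fan_balance (fanphi x)) mulr0.
by move=> d _; rewrite mulrCA.
Qed.

Lemma dart_phi_sum :
  \sum_(h <- darts) (w h.1 h.2)%:~R * phi h.1 (rv h.2) =
  2^-1 * \sum_(h <- darts) (w h.1 h.2)%:~R * dot (a (dart_shift h)) (rv h.2).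
Proof.
have := dart_sum_opp (fun h => (w h.1 h.2)%:~R * phi h.1 (rv h.2)).
rewrite big_seq (eq_bigr (fun h => (w h.1 h.2)%:~R * dot (a (dart_shift h)) (rv h.2) -
  (w h.1 h.2)%:~R * phi h.1 (rv h.2))); last first.
  by move=> h /dart_oppP[_ _ _ -> ->]; ring.
rewrite -big_seq sumrB => E.
set S := \sum_(h <- darts) _ * dot _ _ in E *.
by set P := \sum_(h <- darts) _ in E *; lra.
Qed.

(** The weighted sum of period tensor direction, paired with [p] and [q] by determinants. Since
    [dot (a l) v] is linear in [l] and in [v], this tensor is all that [dart_phi_sum] requires. *)
Definition shift_form p q := \sum_(h <- darts)
  (w h.1 h.2)%:~R * (det2 (dart_shift h) p * det2 (rv h.2) q).

Lemma shift_formE p q : shift_form p q = \sum_(h <- darts)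
  (w h.1 h.2)%:~R * (ret h.1 h.2 * (det2 (rv h.2) p * det2 (rv h.2) q)).
Proof.
(* The shift of [h] is its edge vector plus its initial vertex minus that of [dart_opp h]. The two
   vertex terms are [g h] and [g (dart_opp h)], whose sums vanish by balancing. The remaining
   expression is symmetric in [p] and [q]. *)
pose g h : R := (w h.1 h.2)%:~R * (det2 h.1 p * det2 (rv h.2) q).
have E h : h \in darts ->
    (w h.1 h.2)%:~R * (det2 (dart_shift h) p * det2 (rv h.2) q) =
    g h + g (dart_opp h) +
    (w h.1 h.2)%:~R * (ret h.1 h.2 * (det2 (rv h.2) p * det2 (rv h.2) q)).
  move=> /dart_oppP[_ _ _ Ew _]; rewrite /g Ew /dart_shift /= /dart_end /edge_end.
  by rewrite rvN det2Nl /det2 !mxE; ring.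
rewrite /shift_form big_seq (eq_bigr _ E) -big_seq !big_split /=.
by rewrite dart_sum_opp /g (dart_balance (fun x => det2 x p)) !add0r.
Qed.

(** A period adds the same affine function on both sides of the edge and leaves its weight
    unchanged. *)
Lemma edge_germ_shift z l d (k : int) la lb : lattice_set L l ->
  edge_germ F z d k la lb -> exists la' lb', edge_germ F (z + l) d k la' lb'.
Proof.
move=> Ll [E H].
pose sh (f : 'rV[int]_2 * R) := (f.1 + a l, f.2 + b l - dot (f.1 + a l) l).
exists (sh la), (sh lb); split; first by rewrite /= opprD addrACA subrr addr0.
apply/near_translate; apply: filterS H => y [h1 h2].
have -> : y + l - (z + l) = y - z by rewrite opprD addrACA subrr addr0.
have Esh f : affine_fun (sh f) (y + l) = affine_fun f y + (dot (a l) y + b l).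
  by rewrite /affine_fun /sh /= dotDr !dotDl; ring.
by rewrite (Fab Ll) !Esh; split=> h; [rewrite h1|rewrite h2].
Qed.

Lemma edge_germ_parallel z d (k : int) la lb d' (k' : int) la' lb' :
  k' != 0 -> primitive d' ->
  edge_germ F z d k la lb -> edge_germ F z d' k' la' lb' ->
  det2 (rv d) (rv d') = 0 :> R.
Proof.
move=> k0 pd' /edge_germ_off/(near_line0 (rv d')) H1 /edge_germ_move H2.
have /near0_pos[e e0 He] : \forall t \near (0 : R),
    (~ loc_affine F (z + t *: rv d') -> det2 (rv d) (z + t *: rv d' - z) = 0) /\
    edge_germ F (z + t *: rv d') d' k' la' lb' by apply: filterI.
have [] := He e; first by rewrite gtr0_norm.
move=> + G; rewrite addrAC subrr add0r det2Zr.
move=> /(_ (edge_germ_not_affine (primitive_neq0 pd') k0 G))/eqP.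
by rewrite mulf_eq0 gt_eqF// => /eqP.
Qed.

Lemma not_in_seq (r : seq R) : exists2 t : R, 0 < t < 1 & t \notin r.
Proof.
pose s := [seq (i.+2%:R : R)^-1 | i <- iota 0 (size r).+1].
have Us : uniq s.
  rewrite map_inj_uniq ?iota_uniq// => i j /invr_inj/eqP.
  by rewrite eqr_nat => /eqP[].
have [t ts tr] : exists2 t, t \in s & t \notin r.
  apply: contrapT => H; have /(uniq_leq_size Us) : {subset s <= r}.
    by move=> t ts; apply: contraT => tr; exfalso; apply: H; exists t.
  by rewrite size_map size_iota ltnn.
exists t => //; move: ts => /mapP[i _ ->].
by rewrite invr_gt0 ltr0n /= invf_lt1 ?ltr1n ?ltr0n.
Qed.

Lemma absz_between (x y k : int) : x < k -> k <= y ->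
  x + 1 + (absz (k - x - 1)%R)%:Z = k /\ (absz (k - x - 1)%R < absz (y - x)%R)%N.
Proof. by move=> *; lia. Qed.

(** * Crossings of the divisor with a closed geodesic *)

Section Crossings.
Context (b1 b2 : 'rV[R]_2) (Lb1 : lattice_set L b1) (Lb2 : lattice_set L b2)
  (b12 : det2 b1 b2 != 0)
  (genL : forall l, lattice_set L l ->
    exists k1 k2 : int, l = k1%:~R *: b1 + k2%:~R *: b2).

Definition fstc z : R := det2 z b2 / det2 b1 b2.
Definition sndc z : R := det2 b1 z / det2 b1 b2.

Lemma coordE z : z = fstc z *: b1 + sndc z *: b2.
Proof. exact: cramer2. Qed.

Lemma sndcD z z' : sndc (z + z') = sndc z + sndc z'.
Proof. by rewrite /sndc det2Dr mulrDl. Qed.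

Lemma sndcZ (k : R) z : sndc (k *: z) = k * sndc z.
Proof. by rewrite /sndc det2Zr mulrA. Qed.

Lemma sndcN z : sndc (- z) = - sndc z.
Proof. by rewrite /sndc det2Nr mulNr. Qed.

Lemma sndc_b1 : sndc b1 = 0.
Proof. by rewrite /sndc det2xx mul0r. Qed.

Lemma sndc_b2 : sndc b2 = 1.
Proof. by rewrite /sndc divff. Qed.

Lemma fstcD z z' : fstc (z + z') = fstc z + fstc z'.
Proof. by rewrite /fstc -mulrDl; congr (_ / _); rewrite /det2 !mxE; ring. Qed.

Lemma fstcZ (k : R) z : fstc (k *: z) = k * fstc z.
Proof. by rewrite /fstc det2Zl mulrA. Qed.

Lemma fstc_b1 : fstc b1 = 1.
Proof. by rewrite /fstc divff. Qed.

Lemma fstc_b2 : fstc b2 = 0.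
Proof. by rewrite /fstc det2xx mul0r. Qed.

Lemma coord_lattice l : lattice_set L l -> exists k1 k2 : int,
  fstc l = k1%:~R /\ sndc l = k2%:~R.
Proof.
move=> /genL[k1 [k2 ->]]; exists k1, k2.
rewrite fstcD sndcD !fstcZ !sndcZ sndc_b1 sndc_b2 fstc_b1 fstc_b2.
by rewrite !mulr0 !mulr1 addr0 add0r.
Qed.

(** Lattice vectors have integral height, so the heights of all lifts of vertices take finitely many
    values modulo the integers. *)
Lemma generic_height : exists t : R, forall y (k : int), V (pi y) ->
  sndc y - t <> k%:~R.
Proof.
pose fr (x : R) := x - (Num.floor x)%:~R.
have [t t01 tr] := not_in_seq (map (fr \o sndc) vertices).
exists t => y k Vy Ey; move/negP: tr; apply.
apply/mapP; exists (rep y); first by apply/vertexP; rewrite pi_rep /rep pi_rep.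
have [k1 [k2 [_ E2]]] := coord_lattice (rep_lattice y).
have Er : sndc (rep y) = t + (k - k2)%:~R.
  move: E2; rewrite sndcD sndcN => E2; rewrite intrB; move: Ey; lra.
rewrite /= /fr Er.
have -> : Num.floor (t + (k - k2)%:~R) = k - k2.
  by apply: floor_def; rewrite intrD; move: t01 => /andP[? ?]; lra.
by rewrite addrK.
Qed.

Section Line.
Context (t0 : R) (t0P : forall y (k : int), V (pi y) -> sndc y - t0 <> k%:~R).

Lemma height_not_vertex z (k : int) : sndc z = t0 + k%:~R -> ~ V (pi z).
Proof. by move=> E Vz; apply: (t0P (k := k) Vz); rewrite E addrC addKr. Qed.

(** An edge in direction [b1] would stay at the height of [z], where there are no vertices, and yet
    lead to one. *)
Lemma facet_transverse z (k : int) u k' : sndc z = t0 + k%:~R -> facet F z u k' ->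
  dot u b1 != 0.
Proof.
move=> Ez Hu; apply/eqP => ub.
have b10 : b1 != 0 by apply: contra b12 => /eqP ->; rewrite /det2 !mxE !mul0r subrr.
have [t t00 Vt] := followV (height_not_vertex Ez) Hu ub b10.
by apply: height_not_vertex Vt; rewrite sndcD sndcZ sndc_b1 mulr0 addr0 Ez.
Qed.

Lemma det2_rotl u x : det2 (rv (rot u)) x = - dot u x.
Proof. by rewrite -dot_rot !dot2 !mxE /= mulrNz; ring. Qed.

(** The segment over which the slope is compared has to start off the divisor. A point on an edge is
    moved along [b1], which is transverse to that edge. *)
Lemma generic_base : exists2 z, sndc z = t0 & loc_affine F z.
Proof.
have E0 : sndc (t0 *: b2) = t0 by rewrite sndcZ sndc_b2 mulr1.
have [A0|nA] := pselect (loc_affine F (t0 *: b2)); first by exists (t0 *: b2).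
have E0' : sndc (t0 *: b2) = t0 + 0%:~R by rewrite E0 addr0.
have [u [k Hu]] := facetV (height_not_vertex E0') nA.
have ub := facet_transverse E0' Hu; have [pu _ _] := Hu.
have [||la [lb G]] := @facet_edge_germ _ _ _ _ _ (rot u) Hu.
- exact: primitive_rot.
- by apply/eqP; rewrite -oppr_eq0 -det2_rotl det2xx.
have /near0_pos[e e0 He] := near_line0 b1 (edge_germ_off G).
exists (t0 *: b2 + e *: b1); first by rewrite sndcD E0 sndcZ sndc_b1 mulr0 addr0.
apply: contrapT => nA'; have := He e; rewrite gtr0_norm// => /(_ (lexx _) nA').
rewrite addrAC subrr add0r det2Zr det2_rotl => /eqP.
by rewrite mulf_eq0 oppr_eq0 (negbTE ub) orbF gt_eqF.
Qed.

Context (z0 : 'rV[R]_2) (z0t : sndc z0 = t0) (z0A : loc_affine F z0).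

(** Each edge that is not parallel to [b1] is counted in its upward orientation. A crossing is a
    dart [h] with a level [t0 + k], where [q h < k <= q' h], that it passes; [j] enumerates these
    [k] starting from [q h + 1]. The passage [point] is at parameter [rpar] of the dart, and a
    lattice translation brings it to the parameter [spar] of the segment from [z0] to [z0 + b1]. *)
Let H := [seq h <- darts | 0 < sndc (rv h.2)].
Let q (h : 'rV[R]_2 * 'rV[int]_2) : int := Num.floor (sndc h.1 - t0).
Let q' (h : 'rV[R]_2 * 'rV[int]_2) : int := Num.floor (sndc (dart_end h) - t0).
Let crossings : seq (('rV[R]_2 * 'rV[int]_2) * nat) :=
  [seq (h, j) | h <- H, j <- iota 0 `|q' h - q h|%N].
Let level (i : ('rV[R]_2 * 'rV[int]_2) * nat) : int := q i.1 + 1 + i.2%:Z.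
Let rpar i : R := (t0 + (level i)%:~R - sndc i.1.1) / sndc (rv i.1.2).
Let point i := i.1.1 + rpar i *: rv i.1.2.
Let fpar i : R := fstc (point i) - fstc z0.
Let spar i : R := fpar i - (Num.floor (fpar i))%:~R.
Let jmp (i : ('rV[R]_2 * 'rV[int]_2) * nat) : R :=
  (w i.1.1 i.1.2)%:~R * `|det2 (rv i.1.2) b1|.

Lemma upward_dart h : h \in H -> h \in darts /\ 0 < sndc (rv h.2).
Proof. by rewrite mem_filter => /andP[]. Qed.

Lemma dart_vertices h : h \in darts -> V (pi h.1) /\ V (pi (dart_end h)).
Proof.
by move=> /dartP[/vertexP[Vx _] dds]; split=> //; have [_ VT _] := retP dds.
Qed.

Lemma floor_height y : V (pi y) ->
  (Num.floor (sndc y - t0))%:~R < sndc y - t0 < (Num.floor (sndc y - t0) + 1)%:~R.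
Proof.
move=> Vy; have /andP[h1 h2] := floor_itv (sndc y - t0); rewrite h2 andbT.
rewrite lt_neqAle h1 andbT; apply/eqP => E.
exact: (t0P (k := Num.floor (sndc y - t0)) Vy).
Qed.

Lemma level_between h (k : int) : h \in H ->
  (q h < k <= q' h) = (sndc h.1 < t0 + k%:~R < sndc (dart_end h)).
Proof.
move=> /upward_dart[hd _]; have [V1 V2] := dart_vertices hd.
have /andP[a1 a2] := floor_height V1; have /andP[c1 c2] := floor_height V2.
rewrite -/(q h) in a1 a2; rewrite -/(q' h) in c1 c2.
apply/andP/andP => -[h1 h2]; split.
- have : (q h + 1)%:~R <= k%:~R :> R by rewrite ler_int; lia.
  lra.
- have : k%:~R <= (q' h)%:~R :> R by rewrite ler_int; lia.
  lra.
- rewrite -(ltr_int R); lra.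
- have : k%:~R < (q' h + 1)%:~R :> R by lra.
  by rewrite ltr_int; lia.
Qed.

Lemma q_le h : h \in H -> q h <= q' h.
Proof.
move=> /upward_dart[hd h0]; apply: le_floor; rewrite lerD2r /dart_end /edge_end.
have /dartP[_ dds] := hd; have [T0 _ _] := retP dds.
by rewrite sndcD sndcZ lerDl mulr_ge0// ltW.
Qed.

Lemma level_bound h (j : nat) : q h <= q' h -> (j < 0 + `|q' h - q h|)%N ->
  q h < level (h, j) <= q' h.
Proof. by rewrite /level /=; move: (q h) (q' h) => *; lia. Qed.

Lemma crossingP i : i \in crossings ->
  [/\ i.1 \in H, 0 < rpar i < ret i.1.1 i.1.2 & sndc (point i) = t0 + (level i)%:~R].
Proof.
move=> /allpairsPdep[h [j [hH]]]; rewrite mem_iota => /andP[_ jlt] ->.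
have [hd h0] := upward_dart hH; have qq := q_le hH.
split=> //=; last first.
  by rewrite /point /= sndcD sndcZ /rpar /= divfK ?gt_eqF//; ring.
have : q h < level (h, j) <= q' h by exact: level_bound.
rewrite level_between// /dart_end /edge_end sndcD sndcZ => /andP[h1 h2].
rewrite /rpar /= divr_gt0 ?subr_gt0//= ltr_pdivrMr//.
by rewrite ltrBlDl.
Qed.

Lemma crossing_point i : i \in crossings ->
  exists2 l, lattice_set L l & z0 + spar i *: b1 = point i + l.
Proof.
move=> /crossingP[_ _ Es].
exists (- ((Num.floor (fpar i))%:~R *: b1 + (level i)%:~R *: b2)).
  by apply: latticeN; apply: latticeD; exact: latticeZ.
rewrite [z0]coordE z0t [X in _ = X + _]coordE Es /spar /fpar.
by apply/rowP => c; rewrite !mxE; ring.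
Qed.

Lemma crossing_germ i : i \in crossings -> exists la lb,
  edge_germ F (z0 + spar i *: b1) i.1.2 (w i.1.1 i.1.2) la lb.
Proof.
move=> ic; have [/upward_dart[hd _] r0 _] := crossingP ic.
have /dartP[_ dds] := hd; have [_ _ /(_ _ r0)[_ G]] := retP dds.
have [l Ll ->] := crossing_point ic.
by have [la [lb G']] := edge_germ_shift Ll G; exists la, lb.
Qed.

Lemma crossing_spar i : i \in crossings -> 0 < spar i < 1.
Proof.
move=> ic; have /andP[h1 h2] := floor_itv (fpar i); rewrite intrD in h2.
apply/andP; split; last by rewrite /spar; lra.
(* The parameter 0 would put an edge through [z0], where [F] is affine. *)
rewrite lt_neqAle /spar subr_ge0 h1 andbT; apply/eqP => E.
have [la [lb G]] := crossing_germ ic; have [/upward_dart[hd _] _ _] := crossingP ic.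
have /dartP[_ dds] := hd.
apply: (edge_germ_not_affine _ (weight_neq0 dds) G).
  exact/primitive_neq0/(dir_primitive dds).
by rewrite /spar -E scale0r addr0.
Qed.

(** At a common point the two edges are parallel, and both point upwards, so their directions agree.
    If their parameters differed, the initial vertex of one edge would lie, modulo the lattice, in
    the interior of the other. Hence the initial vertices are congruent, and they are equal because
    both are chosen representatives. *)
Lemma crossing_inj : {in crossings &, injective spar}.
Proof.
move=> i i' ic ic' Es.
have [/upward_dart[hd p0] r0 E] := crossingP ic; have [/upward_dart[hd' p0'] r0' E'] := crossingP ic'.
have /dartP[v1 dds] := hd; have /dartP[v1' dds'] := hd'.
have [la [lb G]] := crossing_germ ic; have [la' [lb' G']] := crossing_germ ic'.
rewrite -Es in G'.
have pd := dir_primitive dds; have pd' := dir_primitive dds'.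
have dd := edge_germ_parallel (weight_neq0 dds') pd' G G'.
have Ed : i.1.2 = i'.1.2.
  have [|//|Ed] := @primitive_parallel i'.1.2 i.1.2 pd' pd.
    apply/eqP; rewrite -subr_eq0 -(intr_eq0 R) intrB !intrM.
    by move: dd; rewrite det2C /det2 !mxE => /eqP; rewrite oppr_eq0.
  by move: p0; rewrite Ed rvN sndcN oppr_gt0 => /(lt_trans p0'); rewrite ltxx.
have [l Ll El] := crossing_point ic; have [l' Ll' El'] := crossing_point ic'.
rewrite -Es in El'; have {El El'} El : point i + l = point i' + l' by rewrite -El.
have [T0 VT HT] := retP dds; have [T0' VT' HT'] := retP dds'.
have Vx : V (pi i.1.1) by move/vertexP: v1 => [].
have Vx' : V (pi i'.1.1) by move/vertexP: v1' => [].
have Ex : i'.1.1 + (rpar i' - rpar i) *: rv i'.1.2 = i.1.1 + (l - l').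
  move: El; rewrite /point Ed => El.
  apply/rowP => c; have := congr1 (fun M : 'rV[R]_2 => M 0 c) El.
  by rewrite !mxE; lra.
have Err : rpar i = rpar i'.
  apply/eqP; rewrite eq_le !leNgt; apply/andP; split; apply/negP => h.
    have [|nV _] := HT (rpar i - rpar i').
      by move: r0 r0' => /andP[? ?] /andP[? ?]; apply/andP; split; lra.
    apply: nV; rewrite -(torus_piD _ (lattice_sub Ll Ll')).
    have -> : i.1.1 + (rpar i - rpar i') *: rv i.1.2 + (l - l') = i'.1.1.
      apply/rowP => c; have := congr1 (fun M : 'rV[R]_2 => M 0 c) Ex.
      by rewrite Ed !mxE; lra.
    by [].
  have [|nV _] := HT' (rpar i' - rpar i).
    by move: r0 r0' => /andP[? ?] /andP[? ?]; apply/andP; split; lra.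
  by apply: nV; rewrite Ex (torus_piD _ (lattice_sub Ll Ll')).
have Exx : i.1.1 = i'.1.1.
  move: Ex; rewrite Err subrr scale0r addr0 => Ex.
  move/vertexP: v1 => [_ <-]; move/vertexP: v1' => [_ <-].
  by rewrite /rep Ex (torus_piD _ (lattice_sub Ll Ll')).
have Eh : i.1 = i'.1 by case: (i.1) (i'.1) Ed Exx => ? ? [? ?] /= -> ->.
have El2 : level i = level i'.
  apply/eqP; rewrite -(eqr_int R); apply/eqP/(addrI t0); rewrite -E -E' /point.
  by rewrite Err Eh.
have Ej : i.2 = i'.2 by move: El2; rewrite /level Eh => /addrI[].
by case: (i) (i') Eh Ej => ? ? [? ?] /= -> ->.
Qed.

(** The edge through the point is followed downwards to its first vertex [y]. The dart that starts
    at the representative of [y] passes, before its end, through the point translated by [- l], and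
    the coordinates of [l] give the level and the integral part of the position. *)
Lemma crossing_surj s : 0 <= s < 1 -> ~ loc_affine F (z0 + s *: b1) ->
  exists2 i, i \in crossings & spar i = s.
Proof.
move=> s01 nA; set z := z0 + s *: b1 in nA.
have tz : sndc z = t0 + 0%:~R by rewrite sndcD sndcZ sndc_b1 mulr0 z0t.
have Vz := height_not_vertex tz.
have [u [k Hu]] := facetV Vz nA.
have ub := facet_transverse tz Hu; have [pu k0 _] := Hu.
have [d [pd ud td]] : exists d, [/\ primitive d, dot u (rv d) = 0 :> R &
    0 < sndc (rv d)].
  have r0 : dot u (rv (rot u)) = 0 :> R.
    by apply/eqP; rewrite -oppr_eq0 -det2_rotl det2xx.
  have s0 : sndc (rv (rot u)) != 0.
    by rewrite /sndc det2C det2_rotl opprK mulf_neq0// invr_neq0.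
  have [sn|sp|s00] := ltgtP (sndc (rv (rot u))) 0.
  - exists (- rot u); split; first exact/primitiveN/primitive_rot.
      by rewrite rvN dotNr r0 oppr0.
    by rewrite rvN sndcN oppr_gt0.
  - by exists (rot u); split=> //; exact: primitive_rot.
  - by rewrite s00 eqxx in s0.
have [la [lb /edge_germN G]] := facet_edge_germ Hu pd ud.
have dN0 : rv (- d) != 0 :> 'rV[R]_2.
  by rewrite rv_eq0 oppr_eq0 primitive_neq0.
have [|r [r0 Vr Hr]] := @first_vertex _ _ V z (rv (- d)) finV dN0.
  by apply: (followV Vz Hu _ dN0); rewrite rvN dotNr ud oppr0.
set y := z + r *: rv (- d) in Vr.
have yz t : y + t *: rv d = z + (r - t) *: rv (- d).
  by rewrite /y rvN !scalerN scalerBl opprB -addrA [- _ + _]addrC.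
have Gy t : 0 < t <= r -> ~ loc_affine F (y + t *: rv d).
  move=> /andP[t00 tr]; rewrite yz.
  have := edge_germ_persist (T := r) (primitiveN pd) k0 _ G.
  have Hf t' : 0 <= t' < r -> ~ loc_affine F (z + t' *: rv (- d)) ->
      exists u k, facet F (z + t' *: rv (- d)) u k.
    move=> /andP[t'0 t'r]; apply: facetV.
    have [->|t'n0] := eqVneq t' 0; first by rewrite scale0r addr0.
    by apply: Hr; rewrite t'r andbT lt_neqAle eq_sym t'n0.
  move=> /(_ Hf (r - t)); rewrite subr_ge0 tr gtrBl t00 => /(_ isT).
  by apply: edge_germ_not_affine; rewrite ?oppr_eq0 ?primitive_neq0.
have dy : d \in ds y.
  apply: (dir_not_affine r0 pd) => t /andP[t00 tr]; apply: Gy.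
  by rewrite t00 ltW.
have Ll := rep_lattice y; set l := y - rep y in Ll.
have ry : rep y = y + - l by rewrite /l opprB subrKC.
have dr : d \in ds (rep y) by rewrite ry; apply: dir_shift => //; exact: latticeN.
have hd : (rep y, d) \in darts.
  by apply/dartP; split=> //=; apply/vertexP; rewrite pi_rep /rep pi_rep.
have hH : (rep y, d) \in H by rewrite mem_filter /= td.
have [T0 VT HT] := retP dr.
have ET t : pi (rep y + t *: rv d) = pi (y + t *: rv d).
  by rewrite ry addrAC (torus_piD _ (latticeN Ll)).
have rT : r < ret (rep y) d.
  rewrite ltNge; apply/negP; rewrite le_eqVlt => /predU1P[E|h].
    by apply: Vz; move: VT; rewrite ET yz E subrr scale0r addr0.
  apply: (Hr (r - ret (rep y) d)); first by rewrite subr_gt0 h gtrBl.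
  by rewrite -yz -ET.
have [k1 [k2 [E1 E2]]] := coord_lattice Ll.
have Epoint : rep y + r *: rv d = z - l.
  by rewrite ry [LHS]addrAC yz subrr scale0r addr0.
have Et : sndc (rep y) + r * sndc (rv d) = t0 + (- k2)%:~R.
  rewrite -sndcZ -sndcD Epoint sndcD sndcN E2 tz addr0 intrN.
  by [].
have := level_between (- k2) hH; rewrite -Et /dart_end /edge_end /=.
rewrite ltrDl mulr_gt0// sndcD sndcZ ltrD2l ltr_pM2r// rT => /andP[q1 q2].
have [Ek jlt] := absz_between q1 q2; set j := absz _ in Ek jlt.
pose i : ('rV[R]_2 * 'rV[int]_2) * nat := ((rep y, d), j).
have Ei : level i = - k2 by exact: Ek.
have Er : rpar i = r.
  by rewrite /rpar Ei -Et /i /= addrC addKr mulfK ?gt_eqF.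
exists i.
  by apply/allpairsPdep; exists (rep y, d), j; split=> //; rewrite mem_iota.
have -> : spar i = fpar i - (- k1)%:~R.
  rewrite /spar; congr (_ - _%:~R).
  apply: floor_def; rewrite /fpar /point Er /i /= Epoint.
  rewrite !fstcD fstcZ fstc_b1 -scaleN1r fstcZ E1 intrD intrN.
  by move: s01 => /andP[? ?]; apply/andP; split; lra.
rewrite /fpar /point Er /i /= Epoint !fstcD fstcZ fstc_b1 -scaleN1r fstcZ E1 intrN.
by ring.
Qed.

Lemma crossings_uniq : uniq crossings.
Proof.
apply: allpairs_uniq_dep.
- exact/filter_uniq/darts_uniq.
- by move=> h _; exact: iota_uniq.
- by move=> [h j] [h' j'] _ _ /= [-> ->].
Qed.

Lemma crossing_not_affine i : i \in crossings ->
  ~ loc_affine F (z0 + spar i *: b1).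
Proof.
move=> ic; have [la [lb]] := crossing_germ ic.
have [/upward_dart[/dartP[_ dds] _] _ _] := crossingP ic.
apply: edge_germ_not_affine; last exact: weight_neq0 dds.
exact/primitive_neq0/(dir_primitive dds).
Qed.

Lemma crossing_kinks s : 0 <= s <= 1 -> locally_affine (fun s' =>
  F (z0 + s' *: b1) - \sum_(i <- crossings) jmp i * Num.max 0 (s' - spar i)) s.
Proof.
move=> s01; have off (P : pred (('rV[R]_2 * 'rV[int]_2) * nat)) :
    (forall i, i \in crossings -> P i -> spar i != s) ->
    locally_affine (fun s' => \sum_(i <- crossings | P i)
      jmp i * Num.max 0 (s' - spar i)) s.
  move=> Hs; suff : locally_affine (fun s' => \sum_(i <- crossings |
      (i \in crossings) && P i) jmp i * Num.max 0 (s' - spar i)) s.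
    by apply: locally_affine_ext; near=> s'; rewrite -big_seq_cond.
  apply: locally_affine_sum => i /andP[ic Pi].
  by apply/locally_affineM/locally_affine_max; exact: Hs.
have [[l Hl]|nA] := pselect (loc_affine F (z0 + s *: b1)).
  have A1 : locally_affine (fun s' => F (z0 + s' *: b1)) s.
    exists (affine_fun l z0), (dot l.1 b1).
    by apply: filterS (near_line Hl) => s' ->; rewrite affine_fun_at dotZr mulrC.
  have /(locally_affineM (-1)) S : locally_affine (fun s' =>
      \sum_(i <- crossings) jmp i * Num.max 0 (s' - spar i)) s.
    apply: off => i ic _; apply/eqP => E.
    by apply: (crossing_not_affine ic); rewrite E; exists l.
  apply: locally_affine_ext (locally_affineD A1 S).
  by near=> s'; rewrite mulN1r.
(* The end [z0 + b1] is off the divisor because it is a translate of [z0]; it has to be excluded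
   since [crossing_surj] works on the half-open segment. *)
have s1 : 0 <= s < 1.
  have /andP[-> s1] := s01; rewrite lt_neqAle s1 andbT; apply/eqP => E.
  apply: nA; rewrite E scale1r; have [l Hl] := z0A.
  exists (l.1 + a b1, l.2 + b b1 - dot (l.1 + a b1) b1).
  apply/near_translate; apply: filterS Hl => y Ey; rewrite (Fab Lb1) Ey.
  by rewrite /affine_fun /= dotDr !dotDl; ring.
have [i ic Es] := crossing_surj s1 nA.
have [la [lb]] := crossing_germ ic; rewrite Es => /edge_germ_kink K.
have [/upward_dart[hd p0] _ _] := crossingP ic.
have {}K := K _; have {}K := K ltac:(by rewrite -(inj_eq oppr_inj) oppr0 -det2C;
  apply: contraTneq p0 => E; rewrite /sndc E mul0r ltxx).
have /(locally_affineM (-1)) S : locally_affine (fun s' =>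
    \sum_(i' <- crossings | i' != i) jmp i' * Num.max 0 (s' - spar i')) s.
  apply: off => i' ic'; apply: contra => /eqP E; apply/eqP.
  by apply: crossing_inj => //; rewrite E.
apply: locally_affine_ext (locally_affineD K S).
near=> s'; rewrite [in RHS](bigD1_seq i)//= ?crossings_uniq// Es /jmp.
by ring.
Unshelve. all: by end_near. Qed.

Lemma seq_lower_bound (T : eqType) (r : seq T) (f : T -> R) :
  (forall i : T, i \in r -> 0 < f i) ->
  exists2 e : R, 0 < e & forall i : T, i \in r -> e <= f i.
Proof.
elim: r => [|i r IH] fr; first by exists 1.
have [|e e0 He] := IH; first by move=> j jr; apply: fr; rewrite inE jr orbT.
exists (Num.min e (f i)); first by rewrite lt_min e0 fr// mem_head.
move=> j; rewrite inE => /predU1P[->|jr]; first by rewrite ge_min lexx orbT.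
by rewrite ge_min He.
Qed.

(** Apart from its kinks, [F] is one affine function on the segment. Near 0 no kink has begun and
    near 1 all of them have, so the slopes there differ by the sum of the jumps, while periodicity
    says that they differ by the slope of [a b1]. *)
Lemma crossing_sum : dot (a b1) b1 = \sum_(i <- crossings) jmp i.
Proof.
have [c [e Hce]] := affine_segment (ler01 : 0 <= 1 :> R) crossing_kinks.
have [d d0 Hd] : exists2 d : R, 0 < d & forall i, i \in crossings ->
    d <= Num.min (spar i) (1 - spar i).
  apply: seq_lower_bound => i /crossing_spar/andP[h1 h2].
  by rewrite lt_min h1 subr_gt0.
have {}Hd i : i \in crossings -> d <= spar i /\ spar i <= 1 - d.
  by move=> /Hd; rewrite le_min => /andP[? ?]; split=> //; lra.
have /nearP[e0 e00 H0] := Hce 0 ltac:(by rewrite lexx ler01).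
have /nearP[e1 e10 H1] := Hce 1 ltac:(by rewrite lexx ler01).
pose S := \sum_(i <- crossings) jmp i.
pose S' := \sum_(i <- crossings) jmp i * (1 - spar i).
(* Less than the distance of every kink from 0 and from 1, and within the radii where the affine
   expression is valid. *)
pose m := Num.min d (Num.min e0 e1).
have m0 : 0 < m by rewrite !lt_min d0 e00.
have [md me0 me1] : [/\ m <= d, m <= e0 & m <= e1].
  by rewrite /m !ge_min !lexx ?orbT.
have [] := @near_eq_affine _ (c + e + S') (e + S)
    (c + (dot (a b1) z0 + b b1)) (e + dot (a b1) b1) 0; last first.
  by move=> _ /addrI <-.
apply: filterS (near_ball (0 : R) m0) => s; rewrite subr0 => sm.
have s0 : F (z0 + s *: b1) = c + e * s.
  rewrite -H0 ?subr0 ?(lt_le_trans sm)// big_seq big1 ?subr0// => i ic.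
  have [h1 _] := Hd _ ic; rewrite max_l ?mulr0//.
  by move: sm; rewrite ltr_norml; lra.
have s1 : F (z0 + (1 + s) *: b1) = c + e * (1 + s) + (S' + S * s).
  have := H1 (1 + s); rewrite addrAC subrr add0r => /(_ (lt_le_trans sm me1)).
  move=> /eqP; rewrite subr_eq => /eqP ->; congr (_ + _).
  rewrite /S' /S mulr_suml -big_split/= big_seq [RHS]big_seq.
  apply: eq_bigr => i ic; have [_ h2] := Hd _ ic; rewrite max_r.
    by ring.
  by move: sm; rewrite ltr_norml; lra.
have := Fab Lb1 (z0 + s *: b1).
have -> : z0 + s *: b1 + b1 = z0 + (1 + s) *: b1.
  by rewrite scalerDl scale1r addrA addrAC.
by rewrite s0 s1 dotDr dotZr => E; move: E; lra.
Qed.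

Lemma floor_addz (x : R) (k : int) : Num.floor (x + k%:~R) = Num.floor x + k.
Proof.
apply: floor_def; have /andP[] := floor_itv x; rewrite !intrD => h1 h2.
by apply/andP; split; lra.
Qed.

Lemma end_level h : h \in darts -> (q' h)%:~R =
  (q (dart_opp h))%:~R + sndc (dart_shift h).
Proof.
move=> hd; have [k1 [k2 [_ E2]]] := coord_lattice (rep_lattice (dart_end h)).
rewrite [dart_shift h]/(dart_end h - rep (dart_end h)) E2 -intrD; congr _%:~R.
rewrite /q' /q /= -floor_addz; congr Num.floor.
by rewrite -E2 sndcD sndcN; ring.
Qed.

(* Along the segment from [z0] to [z0 + b1] the slope of [F] in direction [b1]
   grows by [dot (a b1) b1], and the kinks are the edges met by the segment modulo
   the lattice.  An upward dart meets it as often as its height passes [t0 + Z]. *)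
Lemma crossing_form : dot (a b1) b1 * (2 * `|det2 b1 b2|) = shift_form b1 b1.
Proof.
(* By [end_level], an upward dart has [q (dart_opp h) + sndc (dart_shift h) - q h] crossings; the
   three functions are the contributions of these three terms. *)
pose f1 (h : 'rV[R]_2 * 'rV[int]_2) : R := if 0 < sndc (rv h.2) then
  (w h.1 h.2)%:~R * sndc (rv h.2) * (q (dart_opp h))%:~R else 0.
pose f2 (h : 'rV[R]_2 * 'rV[int]_2) : R := if 0 < sndc (rv h.2) then
  (w h.1 h.2)%:~R * sndc (rv h.2) * sndc (dart_shift h) else 0.
pose f3 (h : 'rV[R]_2 * 'rV[int]_2) : R := if 0 < sndc (rv h.2) then
  (w h.1 h.2)%:~R * sndc (rv h.2) * (q h)%:~R else 0.
have E1 : dot (a b1) b1 = `|det2 b1 b2| *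
    \sum_(h <- darts) (f1 h + f2 h - f3 h).
  rewrite crossing_sum /crossings big_allpairs_dep /= /H big_filter.
  rewrite big_seq_cond mulr_sumr [RHS]big_seq_cond.
  rewrite [RHS](eq_bigr (fun h => if 0 < sndc (rv h.2) then `|det2 b1 b2| *
    (f1 h + f2 h - f3 h) else 0)); last first.
    by move=> h _; rewrite /f1 /f2 /f3; case: ifP => //; rewrite !(addr0, subr0, mulr0).
  rewrite -big_mkcondr /=; apply: eq_big => [h|h /andP[hd h0]].
    by rewrite andbT.
  rewrite (eq_bigr (fun=> jmp (h, 0%N)))//.
  rewrite big_const_seq count_predT size_iota iter_addr_0.
  have -> : jmp (h, 0%N) = `|det2 b1 b2| * ((w h.1 h.2)%:~R * sndc (rv h.2)).
    rewrite /jmp /= det2C normrN.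
    have -> : det2 b1 (rv h.2) = det2 b1 b2 * sndc (rv h.2).
      by rewrite /sndc mulrCA divff// mulr1.
    by rewrite normrM (gtr0_norm h0) mulrCA.
  rewrite /f1 /f2 /f3 h0.
  have hH : h \in H by rewrite mem_filter h0.
  rewrite -mulr_natr.
  have -> : (`|q' h - q h|%N)%:R = (q' h)%:~R - (q h)%:~R :> R.
    by rewrite -intrB -[LHS]/((Posz _)%:~R) gez0_abs// subr_ge0 q_le.
  by rewrite (end_level hd); ring.
have sopp h : h \in darts -> sndc (rv (dart_opp h).2) = - sndc (rv h.2).
  by move=> _; rewrite /= rvN sndcN.
(* Reversing the darts in the first sum turns the difference into one sum over all darts, in which
   the height of the initial vertex is a factor; it vanishes by balancing. *)
have F13 : \sum_(h <- darts) f1 h - \sum_(h <- darts) f3 h = 0.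
  rewrite -(dart_sum_opp f1) -sumrB.
  transitivity ((det2 b1 b2)^-1 * \sum_(h <- darts)
      (w h.1 h.2)%:~R * ((q h)%:~R * det2 (rv h.2) b1)); last first.
    by rewrite (dart_balance (fun x => (Num.floor (sndc x - t0))%:~R)) mulr0.
  rewrite mulr_sumr big_seq [RHS]big_seq; apply: eq_bigr => h hd.
  have [_ Eoo _ Ew _] := dart_oppP hd; rewrite /f1 /f3 Eoo Ew sopp// oppr_gt0.
  have -> : det2 (rv h.2) b1 = - (det2 b1 b2 * sndc (rv h.2)).
    by rewrite det2C /sndc mulrCA divff// mulr1.
  by have [h0|h0|h0] := ltgtP (sndc (rv h.2)) 0; rewrite ?h0; field.
(* Reversal changes the sign of both the direction and the shift, so upward and downward darts
   contribute equally. *)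
have F2 : \sum_(h <- darts) f2 h * 2 =
    \sum_(h <- darts) (w h.1 h.2)%:~R * sndc (rv h.2) * sndc (dart_shift h).
  rewrite -mulr_suml mulr2n mulrDr mulr1 -{2}(dart_sum_opp f2) -big_split /=.
  rewrite big_seq [RHS]big_seq; apply: eq_bigr => h hd.
  have [_ _ Es Ew _] := dart_oppP hd; rewrite /f2 Es Ew sopp// oppr_gt0 sndcN.
  by have [h0|h0|h0] := ltgtP (sndc (rv h.2)) 0; rewrite ?h0; ring.
rewrite E1 sumrB big_split /= addrAC F13 add0r.
transitivity (`|det2 b1 b2| ^+ 2 * ((\sum_(h <- darts) f2 h) * 2)); first by ring.
rewrite real_normK ?num_real// mulr_suml F2 mulr_sumr /shift_form.
apply: eq_bigr => h _.
by rewrite [det2 (rv h.2) b1]det2C [det2 (dart_shift h) b1]det2C /sndc; field.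
Qed.

End Line.

Lemma basis_form : dot (a b1) b1 * (2 * `|det2 b1 b2|) = shift_form b1 b1.
Proof.
have [t0 t0P] := generic_height; have [z0 z0t z0A] := generic_base t0P.
exact (crossing_form t0P z0t z0A).
Qed.

End Crossings.

Lemma shift_form_sym p q : shift_form p q = shift_form q p.
Proof.
rewrite !shift_formE; apply: eq_bigr => h _.
by rewrite [det2 (rv h.2) p * _]mulrC.
Qed.

Lemma shift_formDr p q r : shift_form p (q + r) = shift_form p q + shift_form p r.
Proof.
rewrite /shift_form -big_split /=; apply: eq_bigr => h _.
by rewrite det2Dr; ring.
Qed.

(* [F] is affine along a dart, so its two ends contribute together the slope
   [dot (a (dart_shift h)) (rv h.2)] of the period between them; in the basis
   [b1, b2] the sum over all darts becomes a combination of values of [shift_form]. *)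
Lemma weight_phi_sum (b1 b2 : 'rV[R]_2) : lattice_set L b1 -> lattice_set L b2 ->
  det2 b1 b2 != 0 ->
  (forall l, lattice_set L l ->
    exists k1 k2 : int, l = k1%:~R *: b1 + k2%:~R *: b2) ->
  (\sum_(h <- darts) (w h.1 h.2)%:~R * phi h.1 (rv h.2)) * `|det2 b1 b2| =
  2 * (dot (a b1) b1 * dot (a b2) b2 - dot (a b1) b2 ^+ 2).
Proof.
move=> Lb1 Lb2 b12 genL; set D := det2 b1 b2 in b12 *.
have E11 := basis_form Lb1 Lb2 b12 genL.
have E22 : dot (a b2) b2 * (2 * `|D|) = shift_form b2 b2.
  rewrite /D -normrN -det2C; apply: basis_form => //.
    by rewrite det2C oppr_eq0.
  by move=> l /genL[k1 [k2 ->]]; exists k2, k1; rewrite addrC.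
have L12 : lattice_set L (b1 + b2) by exact: latticeD.
have D12 : det2 (b1 + b2) b2 = D by rewrite /D /det2 !mxE; ring.
(* Polarization: [b1 + b2] completes to a basis with the same determinant, and both sides are
   symmetric forms. *)
have Esum : dot (a (b1 + b2)) (b1 + b2) * (2 * `|D|) =
    shift_form (b1 + b2) (b1 + b2).
  rewrite -D12; apply: (basis_form L12 Lb2); first by rewrite D12.
  move=> l /genL[k1 [k2 ->]]; exists k1, (k2 - k1).
  by rewrite intrB; apply/rowP => c; rewrite !mxE; ring.
have sym := period_slope_sym Fab Lb1 Lb2.
have E12 : dot (a b1) b2 * (2 * `|D|) = shift_form b1 b2.
  move: Esum; rewrite (period_slopeD Fab)// dotDl !dotDr -sym.
  rewrite shift_formDr [shift_form _ b1]shift_form_sym.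
  rewrite [shift_form _ b2]shift_form_sym !shift_formDr -E11 -E22.
  by rewrite [shift_form b2 b1]shift_form_sym; lra.
have E h : h \in darts -> dot (a (dart_shift h)) (rv h.2) * D ^+ 2 =
    dot (a b1) b1 * (det2 (dart_shift h) b2 * det2 (rv h.2) b2) -
    dot (a b1) b2 * (det2 (dart_shift h) b2 * det2 (rv h.2) b1) -
    dot (a b1) b2 * (det2 (dart_shift h) b1 * det2 (rv h.2) b2) +
    dot (a b2) b2 * (det2 (dart_shift h) b1 * det2 (rv h.2) b1).
  move=> _; have [k1 [k2 El]] := genL (dart_shift h) (rep_lattice _).
  rewrite El.
  rewrite (period_slopeD Fab) ?(period_slopeZ Fab)//; try exact: latticeZ.
  rewrite dotDl !dotZl; set x := rv h.2.
  rewrite [X in dot (a b1) X](cramer2 x b12) [X in dot (a b2) X](cramer2 x b12).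
  rewrite !dotDr !dotZr -sym -/D.
  have -> : det2 (k1%:~R *: b1 + k2%:~R *: b2) b2 = k1%:~R * D.
    by rewrite det2_lin.
  have -> : det2 (k1%:~R *: b1 + k2%:~R *: b2) b1 = - (k2%:~R * D).
    by rewrite det2C det2_linr.
  by rewrite [det2 b1 x]det2C; field.
have S : (\sum_(h <- darts) (w h.1 h.2)%:~R * dot (a (dart_shift h)) (rv h.2)) *
    D ^+ 2 = dot (a b1) b1 * shift_form b2 b2 -
    2 * dot (a b1) b2 * shift_form b1 b2 + dot (a b2) b2 * shift_form b1 b1.
  transitivity (dot (a b1) b1 * shift_form b2 b2 -
    dot (a b1) b2 * shift_form b2 b1 - dot (a b1) b2 * shift_form b1 b2 +
    dot (a b2) b2 * shift_form b1 b1); last first.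
    by rewrite [shift_form b2 b1]shift_form_sym; ring.
  rewrite /shift_form mulr_suml !mulr_sumr -!sumrB -big_split /=.
  rewrite big_seq [RHS]big_seq; apply: eq_bigr => h hd.
  by rewrite -mulrA E//; ring.
rewrite dart_phi_sum; move: S; set X := \sum_(h <- darts) _ => S.
have DD : D ^+ 2 = `|D| * `|D| by rewrite -expr2 real_normK ?num_real.
have D0 : `|D| != 0 by rewrite normr_eq0.
apply: (mulfI D0).
transitivity (2^-1 * (X * D ^+ 2)); first by rewrite DD; ring.
by rewrite S -E11 -E22 -E12; field.
Qed.

End EdgeEnds.

(** * The self-intersection number as a determinant of periods *)

Section SelfIntersection.
Context {R : realType} (L : lattice R 2) (D : divisor L).
Local Notation pi := (@torus_pi R 2 L).

Lemma intersection_number_form (F : 'rV[R]_2 -> R) a b (b1 b2 : 'rV[R]_2) (m : int) :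
  is_lift D F -> quasi_periodic L F a b ->
  lattice_set L b1 -> lattice_set L b2 -> det2 b1 b2 != 0 ->
  (forall l, lattice_set L l ->
    exists k1 k2 : int, l = k1%:~R *: b1 + k2%:~R *: b2) ->
  is_intersection_number D D m ->
  m%:~R * `|det2 b1 b2| =
  2 * (dot (a b1) b1 * dot (a b2) b2 - dot (a b1) b2 ^+ 2).
Proof.
move=> DF Fab Lb1 Lb2 b12 genL [V [V2 [mu [[sub1 sub2 VV _] loc ->]]]].
(* Vertices lie in the support, and both complexes have the same support here, so a common
   subdivision of [D] with itself has a single vertex set. *)
have EV : V2 = V.
  apply/seteqP; split=> c; have [x <-] := torus_pi_surj c => Vx.
    by apply/(VV x) => //; case: sub2 => _ + _ _; exact.
  by apply/(VV x) => //; case: sub1 => _ + _ _; exact.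
rewrite {V2 VV sub2}EV in loc *.
case: sub1 => finV Vsupp Vfacet Vfollow.
have facetV q : ~ V (pi q) -> ~ loc_affine F q -> exists u w, facet F q u w.
  move=> Vq nA; have [|u [w Hu]] := Vfacet q _ Vq.
    exact/(lift_support DF).
  by exists u, w; apply/(lift_facet DF).
have followV q u w (v : 'rV[R]_2) : ~ V (pi q) -> facet F q u w ->
    dot u v = 0 -> v != 0 -> exists2 t : R, 0 < t & V (pi (q + t *: v)).
  by move=> Vq /(lift_facet DF) Hu uv v0; exact: Vfollow Hu uv v0.
pose data := (('rV[R]_2 -> R) * (seq 'rV[int]_2 * ('rV[int]_2 -> int) *
  (('rV[int]_2 -> 'rV[int]_2) * ('rV[int]_2 -> 'rV[int]_2))))%type.
have H x : exists t : data, is_cone F x t.1 /\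
    is_fan t.1 t.2.1.1 t.2.1.2 t.2.2.1 t.2.2.2.
  have [phi Hphi] := lift_cone DF x.
  have [|ds [w [A [B HAB]]]] := cone_fan Hphi; last by exists (phi, (ds, w, (A, B))).
  by apply: filterS (finite_set_isolated x finV) => y Vy /Vy; exact: facetV.
pose T x := projT1 (cid (H x)).
have Tcone x : is_cone F x (T x).1 by have [] := projT2 (cid (H x)).
have Tfan x : is_fan (T x).1 (T x).2.1.1 (T x).2.1.2 (T x).2.2.1 (T x).2.2.2.
  by have [] := projT2 (cid (H x)).
have [sV0 EsV0] := (finite_seqP V).1 finV.
pose sV := undup sV0.
have EsV : V = [set` sV].
  by rewrite EsV0; apply/seteqP; split=> c /=; rewrite mem_undup.
have UsV : uniq sV by exact: undup_uniq.
rewrite -(weight_phi_sum Fab finV facetV followV Tcone Tfan EsV UsV Lb1 Lb2 b12 genL).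
congr (_ * _); rewrite setIid {1}EsV -fsbig_seq// rmorph_sum /=.
rewrite /darts big_allpairs_dep /= /vertices big_map.
rewrite big_seq [RHS]big_seq; apply: eq_bigr => s sVs.
have Es : pi (repr s) = s by rewrite /torus_pi reprK.
have Vs : V (pi (repr s)) by rewrite Es EsV.
have := loc (repr s) Vs Vs; rewrite Es.
apply: (local_multiplicity_fan DF (Tcone _) (Tfan _)).
exact: finite_set_isolated.
Qed.

End SelfIntersection.

(** * Effective divisors from convex quasi-periodic functions *)

Section RegularSections.
Context {R : realType} (L : lattice R 2).
Implicit Types (x y z v l : 'rV[R]_2) (G F : 'rV[R]_2 -> R).
Local Notation pi := (@torus_pi R 2 L).

Definition loc_max_affine G : Prop := forall x, exists k s,
  \forall y \near x, G y = max_affine k s y.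

Lemma loc_max_cone G x : loc_max_affine G -> exists phi, is_cone G x phi.
Proof.
move=> /(_ x)[k [s H]]; have [phi Hphi] := cone_max_affine k s x.
by exists phi; apply: cone_ext Hphi; apply: filterS H => y ->.
Qed.

Lemma loc_max_affineD G k : loc_max_affine G ->
  loc_max_affine (fun x => G x + affine_fun k x).
Proof.
move=> HG x; have [k1 [s H]] := HG x.
have [k2 [t E]] := @max_affineD R 2 k1 s k [::]; exists k2, t.
by apply: filterS H => y ->; rewrite -E {3}/max_affine big_nil.
Qed.

Lemma loc_max_affine_translate G l x : loc_max_affine G ->
  exists k s, \forall y \near x, G (y - l) = max_affine k s y.
Proof.
move=> /(_ (x - l))[k [s /near_translate H]].
pose sh (m : 'rV[int]_2 * R) := (m.1, m.2 - dot m.1 l).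
exists (sh k), (map sh s); apply: filterS H => y ->; rewrite /max_affine big_map.
have E m : affine_fun m (y - l) = affine_fun (sh m) y.
  by rewrite /affine_fun /= dotBr; ring.
by rewrite E; apply: eq_bigr => m _; exact: E.
Qed.

Definition section_radius : R := projT1 (cid2 (lattice_separated L)) / 2.

Lemma section_radius_gt0 : 0 < section_radius.
Proof. by rewrite divr_gt0//; case: (cid2 _). Qed.

Lemma section_radius_inj x y y' : `|y - x| < section_radius ->
  `|y' - x| < section_radius -> pi y = pi y' -> y = y'.
Proof.
rewrite /section_radius; case: (cid2 _) => e /= e0 He h h' /torus_piP Ly.
apply/eqP; rewrite -subr_eq0; apply/eqP/He => //.
have -> : y - y' = (y - x) - (y' - x) by rewrite opprB addrA subrK.
by rewrite (le_lt_trans (ler_normB _ _))// [e]splitr ltrD.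
Qed.

(** The inverse of the quotient map on a ball small enough for it to be injective. The default [x]
    is taken only outside of [chart x]. *)
Definition local_section x (q : torus L) : 'rV[R]_2 :=
  xget x [set y | `|y - x| < section_radius /\ pi y = q].

Definition chart x : set (torus L) := pi @` [set y | `|y - x| < section_radius].

Lemma local_sectionK x y : `|y - x| < section_radius ->
  local_section x (pi y) = y.
Proof.
move=> yx; apply: xget_unique => // z [zx E].
exact: section_radius_inj zx yx E.
Qed.

Lemma near_section x y : `|y - x| < section_radius ->
  \forall z \near y, `|z - x| < section_radius.
Proof.
move=> yx; have d0 : 0 < section_radius - `|y - x| by rewrite subr_gt0.
apply: filterS (near_rV y d0) => z; rewrite ltrBrDr => /(le_lt_trans _); apply.
by rewrite (le_trans _ (ler_normD _ _))// addrA subrK.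
Qed.

Lemma chart_open x : open (chart x).
Proof.
apply: torus_pi_open; rewrite openE => y /= yx.
exact: near_section.
Qed.

Lemma chartP x y : chart x (pi y) -> exists2 l, lattice_set L l &
  `|y - l - x| < section_radius /\
  \forall z \near y, local_section x (pi z) = z - l.
Proof.
move=> [y0 /= y0x Ey]; exists (y - y0); first exact/torus_piP/esym.
have -> : y - (y - y0) = y0 by rewrite opprB subrKC.
split=> //; have Ll : lattice_set L (y - y0) by exact/torus_piP/esym.
have /near_translate : \forall z \near y + - (y - y0), `|z - x| < section_radius.
  by rewrite opprB subrKC; exact: near_section.
apply: filterS => z zx.
by rewrite -[in LHS](torus_piD z (latticeN Ll)) local_sectionK.
Qed.

Definition grid_center (jk : int * int) : 'rV[R]_2 :=
  \row_i ((if i == 0 then jk.1 else jk.2)%:~R * section_radius).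

Lemma chart_cover (q : torus L) : exists jk, chart (grid_center jk) q.
Proof.
have [x <-] := torus_pi_surj q; have e0 := section_radius_gt0.
pose j i := Num.floor (x 0 i / section_radius).
exists (j 0, j 1); exists x => //=; apply: norm_lt_coord => // i.
have : `|x 0 i - (j i)%:~R * section_radius| < section_radius.
  have /andP[] := floor_itv (x 0 i / section_radius).
  rewrite -/(j i) ler_pdivlMr// ltr_pdivrMr// intrD mulrDl mul1r => h1 h2.
  by rewrite ltr_norml; lra.
by elim/ord2P: i; rewrite !mxE.
Qed.

Lemma regular_section G x : loc_max_affine G ->
  regular_on (chart x) (fun q => G (local_section x q)).
Proof.
move=> HG; split=> [q [y /= yx <-]|y /chartP[l Ll [_ Hy]]].
  apply: torus_continuous => e e0; have [phi Hphi] := loc_max_cone y HG.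
  rewrite local_sectionK//; apply: filterS2 (near_section yx) (cone_near Hphi e0).
  by move=> z zx; rewrite local_sectionK// distrC.
have [k [s H]] := loc_max_affine_translate l y HG; exists k, s.
by apply: filterS2 H Hy => z <- ->.
Qed.

Lemma regular_rational (U : set (torus L)) f : open U ->
  regular_on U f -> rational_on U f.
Proof.
move=> oU rf; split; first by case: rf.
move=> p Up; exists U, f, (fun=> 0).
split=> //; [by split| |by move=> q _; rewrite subr0].
split=> [q _|y _]; first exact: cst_continuous.
exists (0, 0), [::]; near=> z; rewrite /max_affine big_nil /affine_fun /=.
by rewrite dot0l addr0.
Unshelve. all: by end_near. Qed.

End RegularSections.

Section DivisorOfSection.
Context {R : realType} (L : lattice R 2) (D : divisor L).
Local Notation pi := (@torus_pi R 2 L).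
Context (F Theta : 'rV[R]_2 -> R) (a : 'rV[R]_2 -> 'rV[int]_2) (b : 'rV[R]_2 -> R)
  (DF : is_lift D F) (Fab : quasi_periodic L F a b)
  (Tab : quasi_periodic L Theta a b) (Tmax : loc_max_affine Theta).

Definition section_ratio (p : torus L) : R := Theta (repr p) - F (repr p).

Lemma section_ratioE x : section_ratio (pi x) = Theta x - F x.
Proof.
have Ll : lattice_set L (x - repr (pi x)).
  by apply/torus_piP; rewrite /torus_pi reprK.
rewrite /section_ratio -{3 4}(subrKC (repr (pi x)) x) (Tab Ll) (Fab Ll).
by rewrite opprD addrACA subrr addr0.
Qed.

Lemma section_ratio_rational : rational_on setT section_ratio.
Proof.
split=> [p _|p _].
  have [x <-] := torus_pi_surj p; apply: torus_continuous => e e0.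
  have e20 : 0 < e / 2 by rewrite divr_gt0.
  have [phi Hphi] := loc_max_cone x Tmax; have [psi Hpsi] := lift_cone DF x.
  apply: filterS2 (cone_near Hphi e20) (cone_near Hpsi e20) => y h1 h2.
  rewrite !section_ratioE.
  have -> : Theta x - F x - (Theta y - F y) = (F y - F x) - (Theta y - Theta x).
    by ring.
  by rewrite (le_lt_trans (ler_normB _ _))// [e]splitr ltrD.
have [x <-] := torus_pi_surj p; have [i Ui] := div_cover D (pi x).
have [l Hl] := DF Ui.
have [_ /(_ _ Ui)[W [g [h [oW [Wx WU] rg rh E]]]]] := div_rational i.
pose k := (- l.1, - l.2).
have rs := regular_section L x (loc_max_affineD k Tmax).
pose B := [set y | `|y - x| < section_radius L /\
  \forall z \near y, F z - div_fun i (pi z) = affine_fun l z].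
have oB : open B.
  rewrite openE => y [yx /near_join Hy].
  suff : \forall z \near y, B z by [].
  by apply: filterS2 (near_section yx) Hy => z.
have Bx : B x by split=> //; rewrite subrr normr0 section_radius_gt0.
have BC : pi @` B `<=` chart x by move=> _ [y [yx _] <-]; exists y.
(* With [F] equal to the local equation [g - h] plus the affine function [l], the difference
   [Theta - F] is [(Theta - l + h) - g]. *)
exists (W `&` pi @` B),
  (fun q => (Theta (local_section x q) + affine_fun k (local_section x q)) + h q), g.
split.
- by apply: openI => //; exact: torus_pi_open.
- by split=> //; split=> //; exists x.
- apply: regular_onD; last by apply: (regular_onS _ rh); exact: subIsetl.
  by apply: (regular_onS _ rs) => q [_ /BC].
- by apply: (regular_onS _ rg); exact: subIsetl.
- move=> q [Wq [y [yx Hy] Ey]]; rewrite -Ey in Wq *.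
  rewrite local_sectionK// section_ratioE [affine_fun k y]affine_funN.
  by rewrite -(nbhs_singleton Hy) E//; ring.
Qed.

(** The divisor of [Theta], presented as [D] plus a principal divisor so that linear equivalence is
    immediate. The presentation [chart_divisor] of the same divisor, with local equations [Theta]
    itself, shows that it is effective. *)
Program Definition section_divisor : divisor L := @Divisor R 2 L
  (div_index D) (@div_dom _ _ _ D) (fun i p => div_fun i p + section_ratio p)
  (@div_open _ _ _ D) (@div_cover _ _ _ D) _ _.
Next Obligation.
move=> i; have := rational_onD (div_rational i) section_ratio_rational.
by rewrite setIT.
Qed.
Next Obligation.
move=> i j x Ux; have := div_compat Ux; apply: loc_affine_ext; near=> y.
by rewrite opprD addrACA subrr addr0.
Unshelve. all: by end_near. Qed.

Lemma section_chart_affine x (i : div_index D) z :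
  div_dom i (pi z) -> chart x (pi z) ->
  loc_affine (fun y => div_fun i (pi y) + section_ratio (pi y) -
    Theta (local_section x (pi y))) z.
Proof.
move=> Uz /chartP[l Ll [_ Hz]].
have A1 : loc_affine (fun y => - (F y - div_fun i (pi y)) +
    affine_fun (a (- l), b (- l)) y * -1) z.
  apply: loc_affineD; first exact/loc_affineN/DF.
  apply: loc_affine_ext (loc_affineN (loc_affine_fun (a (- l), b (- l)) z)).
  by near=> y; rewrite mulrN1.
apply: loc_affine_ext A1; near=> y.
have -> : local_section x (pi y) = y - l by near: y.
rewrite (Tab (latticeN Ll)) section_ratioE /affine_fun /=; ring.
Unshelve. all: by end_near. Qed.

(* The index set is [int * int] rather than the plane because the latter lives
   in a universe that is too large for [div_index]. *)
Program Definition chart_divisor : divisor L := @Divisor R 2 L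
  (int * int) (fun jk => chart (grid_center L jk))
  (fun jk q => Theta (local_section (grid_center L jk) q))
  (fun jk => @chart_open R L _) (@chart_cover R L) _ _.
Next Obligation.
move=> jk; apply: regular_rational; first exact: chart_open.
exact: regular_section.
Qed.
Next Obligation.
move=> jk jk' z [/= cx cx']; have [i Ui] := div_cover D (pi z).
have := loc_affineB (section_chart_affine Ui cx') (section_chart_affine Ui cx).
by apply: loc_affine_ext; near=> y; ring.
Unshelve. all: by end_near. Qed.

Lemma section_divisor_linear_system : linear_system D section_divisor.
Proof.
split.
  exists chart_divisor => [i jk z [/= Uz cz]|jk]; last exact: regular_section.
  exact: section_chart_affine.
exists section_ratio, section_ratio_rational => -[i j] [] z [[/= Ui Uj] _].
have := div_compat (conj Ui Uj : (div_dom i `&` div_dom j) (pi z)).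
by apply: loc_affine_ext; near=> y; rewrite /=; ring.
Unshelve. all: by end_near. Qed.

Lemma section_divisor_passes x : ~ loc_affine Theta x ->
  passes_through section_divisor (pi x).
Proof.
move=> nA; exists x => //; have [i Ui] := div_cover D (pi x); exists i => // A.
apply: nA; have := loc_affineD (DF Ui) A.
apply: loc_affine_ext; near=> y.
by rewrite /= section_ratioE; ring.
Unshelve. all: by end_near. Qed.

End DivisorOfSection.

(** * Theta series through prescribed points *)

Section Cosets.
Implicit Types (u v : 'rV[int]_2).

Definition zdet u v : int := u 0 0 * v 0 1 - u 0 1 * v 0 0.

Lemma small_multiple (x y : nat) (m t : int) : (x < `|m|)%N -> (y < `|m|)%N ->
  x%:Z - y%:Z = t * m -> t = 0.
Proof.
move=> xm ym E; apply/eqP; apply: contraT => t0.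
have : (absz (t * m)%R < absz m)%N by rewrite -E; lia.
by rewrite abszM ltnNge leq_pmull// absz_gt0.
Qed.

(* The row lattice of [u, v] has a triangular basis [(g, x), (0, h)] with
   [g h = zdet u v]. *)
Lemma incongruent_vectors u v : zdet u v != 0 -> exists e : nat -> 'rV[int]_2,
  forall i j (k1 k2 : int), (i < `|zdet u v|)%N -> (j < `|zdet u v|)%N ->
    e i - e j = k1 *: u + k2 *: v -> i = j.
Proof.
move=> d0; pose g : int := gcdz (u 0 0) (v 0 0).
have [al [be Eg]] := Bezoutz (u 0 0) (v 0 0); rewrite -/g in Eg.
have g0 : g != 0.
  apply: contra d0; rewrite gcdz_eq0 => /andP[/eqP h1 /eqP h2].
  by rewrite /zdet h1 h2 mul0r mulr0 subrr.
pose p := divz (u 0 0) g; pose r := divz (v 0 0) g.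
have Ep : u 0 0 = p * g by rewrite divzK// dvdz_gcdl.
have Er : v 0 0 = r * g by rewrite divzK// dvdz_gcdr.
have E1 : al * p + be * r = 1.
  by apply: (mulIf g0); rewrite mulrDl -!mulrA -Ep -Er mul1r.
pose h := p * v 0 1 - r * u 0 1.
have Ed : zdet u v = g * h by rewrite /zdet Ep Er /h; ring.
have h0 : h != 0 by apply: contra d0 => /eqP; rewrite Ed => ->; rewrite mulr0.
have hn0 : (0 < `|h|)%N by rewrite absz_gt0.
(* The integral points of a box with sides [|g|] and [|h|] represent the classes modulo the
   triangular basis; quotient and remainder by [|h|] enumerate them. *)
exists (fun i => \row_c (if c == 0 then (i %/ `|h|)%N%:Z else (i %% `|h|)%N%:Z)).
move=> i j k1 k2; rewrite Ed abszM => ilt jlt E.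
have := congr1 (fun M : 'rV[int]_2 => M 0 0) E.
have := congr1 (fun M : 'rV[int]_2 => M 0 1) E.
rewrite !mxE /= => F1 F0.
have iq : (i %/ `|h| < `|g|)%N by rewrite ltn_divLR.
have jq : (j %/ `|h| < `|g|)%N by rewrite ltn_divLR.
have K : k1 * p + k2 * r = 0.
  by apply: (small_multiple iq jq); rewrite F0 Ep Er; ring.
(* As [p] and [r] are coprime, the solutions of [k1 * p + k2 * r = 0] are the multiples of
   [(- r, p)], and [t] is the factor. *)
pose t := al * k2 - be * k1.
have Ek1 : k1 = - r * t.
  by rewrite -[LHS]mulr1 -E1 -[RHS]addr0 -(mulr0 al) -K /t; ring.
have Ek2 : k2 = p * t.
  by rewrite -[LHS]mulr1 -E1 -[RHS]addr0 -(mulr0 be) -K /t; ring.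
have im : (i %% `|h| < `|h|)%N by rewrite ltn_mod.
have jm : (j %% `|h| < `|h|)%N by rewrite ltn_mod.
have T0 : t = 0.
  by apply: (small_multiple im jm); rewrite F1 Ek1 Ek2 /h; ring.
move: F0 F1; rewrite Ek1 Ek2 T0 !mulr0 !mul0r !addr0 => /eqP; rewrite subr_eq0.
move=> /eqP[Eq] /eqP; rewrite subr_eq0 => /eqP[Em].
by rewrite (divn_eq i `|h|) Eq Em -divn_eq.
Qed.

End Cosets.

(** * The tropical Cramer rule *)

Section TropicalCramer.
Context {R : realType} (n : nat) (T : 'I_n -> 'I_n.+1 -> R).

(** A matching of the [n] rows with [n] of the columns is encoded as a permutation whose value at
    [ord0] is the column left out. *)
Let weight (s : 'S_n.+1) : R := \sum_r T r (s (lift ord0 r)).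

(* The tropical minors, as in Cramer's rule.  Expanding the tropical determinant
   of [T] with row [j] repeated, an optimal permutation and its composition with
   the transposition of the two equal rows give two maximal terms. *)
Lemma tropical_cramer : exists c : 'I_n.+1 -> R, forall j, exists i i',
  [/\ i != i', forall i'', c i'' + T j i'' <= c i + T j i &
      c i + T j i = c i' + T j i'].
Proof.
pose best (i : 'I_n.+1) :=
  [arg max_(s > tperm ord0 i | s ord0 == i) weight s]%O.
have bestP i : best i ord0 = i /\ forall s : 'S_n.+1, s ord0 = i ->
    weight s <= weight (best i).
  rewrite /best; case: arg_maxP; first by rewrite tpermL.
  by move=> s /eqP -> Hs; split=> // s' /eqP; exact: Hs.
exists (fun i => weight (best i)) => j.
pose s := [arg max_(s > (1%g : 'S_n.+1)) (T j (s ord0) + weight s)]%O.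
have sP (s' : 'S_n.+1) : T j (s' ord0) + weight s' <= T j (s ord0) + weight s.
  by rewrite /s; case: arg_maxP => // s'' _; exact.
pose s2 : 'S_n.+1 := (tperm ord0 (lift ord0 j) * s)%g.
have s20 : s2 ord0 = s (lift ord0 j) by rewrite permM tpermL.
have Es2 : T j (s2 ord0) + weight s2 = T j (s ord0) + weight s.
  rewrite s20 /weight (bigD1 j)//= [in RHS](bigD1 j)//= permM tpermR.
  rewrite addrCA; congr (_ + (_ + _)); apply: eq_bigr => r rj.
  rewrite permM tpermD ?neq_lift//.
  by rewrite (inj_eq lift_inj) eq_sym.
have top (s' : 'S_n.+1) : T j (s' ord0) + weight s' = T j (s ord0) + weight s ->
    weight (best (s' ord0)) + T j (s' ord0) = T j (s ord0) + weight s.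
  move=> E; apply/le_anti; apply/andP; split.
    by have := sP (best (s' ord0)); rewrite (bestP _).1 addrC.
  by rewrite -E addrC lerD2r; have [_] := bestP (s' ord0); apply.
exists (s ord0), (s2 ord0); split.
- by rewrite s20 (inj_eq perm_inj) neq_lift.
- by move=> i; have := sP (best i); rewrite (bestP i).1 (top s)// addrC.
- by rewrite (top s)// (top s2).
Qed.

End TropicalCramer.

Section MaxAffine.
Context {R : realType} {n : nat}.
Implicit Types (k l : 'rV[int]_n * R) (x : 'rV[R]_n).

Lemma max_affine_ub k s l x : l \in k :: s -> affine_fun l x <= max_affine k s x.
Proof.
rewrite /max_affine; elim: s => [|m s IH].
  by rewrite inE => /eqP ->; rewrite big_nil.
rewrite big_cons !inE le_max orbCA => /predU1P[->|ls]; first by rewrite lexx.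
by rewrite IH ?orbT// inE.
Qed.

Lemma max_affine_attained k s x :
  exists2 l, l \in k :: s & max_affine k s x = affine_fun l x.
Proof.
rewrite /max_affine; elim: s => [|m s [l ls E]].
  by exists k; rewrite ?mem_head// big_nil.
rewrite big_cons E; case: leP => _.
  by exists l => //; move: ls; rewrite !inE orbCA => ->; rewrite orbT.
by exists m => //; rewrite !inE eqxx orbT.
Qed.

End MaxAffine.

(** * Convergence, periods and kinks of theta series *)

Section ThetaSeries.
Context {R : realType} (L : lattice R 2) (F : 'rV[R]_2 -> R)
  (a : 'rV[R]_2 -> 'rV[int]_2) (b : 'rV[R]_2 -> R)
  (Fab : quasi_periodic L F a b).
Context (b1 b2 : 'rV[R]_2) (Lb1 : lattice_set L b1) (Lb2 : lattice_set L b2)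
  (genL : forall l, lattice_set L l ->
    exists k1 k2 : int, l = k1%:~R *: b1 + k2%:~R *: b2).
Context (pos1 : 0 < dot (a b1) b1)
  (pos2 : 0 < dot (a b1) b1 * dot (a b2) b2 - dot (a b1) b2 ^+ 2).
Implicit Types (x l m : 'rV[R]_2).

(** The constant [b] is quadratic in the period, with polar form [dot (a l) m]; subtracting the
    quadratic part leaves an additive function. *)
Let beta l : R := b l - 2^-1 * dot (a l) l.

Let betaD l m : lattice_set L l -> lattice_set L m ->
  beta (l + m) = beta l + beta m.
Proof.
move=> Ll Lm; rewrite /beta (period_constD Fab)// (period_slopeD Fab)//.
by rewrite dotDl !dotDr (period_slope_sym Fab Ll Lm); field.
Qed.

Let beta0 : beta 0 = 0.
Proof.
have := betaD (lattice_0 L) (lattice_0 L).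
by rewrite addr0 => /eqP; rewrite -subr_eq0 opprD addNKr oppr_eq0 => /eqP.
Qed.

Let betaZ (k : int) l : lattice_set L l -> beta (k%:~R *: l) = k%:~R * beta l.
Proof.
move=> Ll.
have bn (m : nat) : beta (m%:R *: l) = m%:R * beta l.
  elim: m => [|m IH]; first by rewrite scale0r mul0r.
  rewrite !mulrS scalerDl scale1r betaD ?IH//; first by ring.
  by rewrite scaler_nat; exact: latticeMn.
case: k => m; first exact: bn.
rewrite NegzE mulrNz scaleNr mulNr -bn; apply/eqP; rewrite -addr_eq0.
have Lm : lattice_set L (m.+1%:R *: l) by rewrite scaler_nat; exact: latticeMn.
by rewrite -betaD ?addNr ?beta0//; exact: latticeN.
Qed.

Let a0 : a 0 = 0.
Proof. by have := period_slopeZ Fab 0 (lattice_0 L); rewrite !scale0r. Qed.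

Let b0 : b 0 = 0.
Proof. by have := beta0; rewrite /beta a0 dot0r mulr0 subr0. Qed.

(** A lower bound of determinant over trace for the form. If [G] is its Gram matrix, the difference
    of the two sides is the squared length of [G] applied to [(k1, k2)], because
    [G^2 = tr G * G - det G] by Cayley and Hamilton. *)
Let pos_def (k1 k2 : R) :
  (dot (a b1) b1 * dot (a b2) b2 - dot (a b1) b2 ^+ 2) * (k1 ^+ 2 + k2 ^+ 2) <=
  (dot (a b1) b1 + dot (a b2) b2) *
  (dot (a b1) b1 * k1 ^+ 2 + 2 * dot (a b1) b2 * k1 * k2 + dot (a b2) b2 * k2 ^+ 2).
Proof.
rewrite -subr_ge0; set p := dot _ _; set q := dot (a b2) b2; set r := dot (a b1) b2.
rewrite (_ : _ - _ = (p * k1 + r * k2) ^+ 2 + (r * k1 + q * k2) ^+ 2); last by ring.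
by rewrite addr_ge0// sqr_ge0.
Qed.

Context (n : nat) (e : 'I_n.+1 -> 'rV[int]_2).
Implicit Types (c : 'I_n.+1 -> R) (i : 'I_n.+1).

(* The translate by [l] of [x |-> e i x + c i] under the action of the lattice for
   which the functions with periods [a], [b] are the invariant ones. *)
Definition theta_term c i l : 'rV[int]_2 * R :=
  (e i + a l, c i + b l - dot (e i) l - dot (a l) l).

Lemma theta_termE c i l x : affine_fun (theta_term c i l) x =
  dot (e i) (x - l) + c i + (dot (a l) (x - l) + b l).
Proof. by rewrite /affine_fun /= dotDl !dotBr; ring. Qed.

Lemma theta_term_shift c i l m x : lattice_set L l -> lattice_set L m ->
  affine_fun (theta_term c i (l + m)) (x + m) =
  affine_fun (theta_term c i l) x + (dot (a m) x + b m).
Proof.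
move=> Ll Lm; rewrite !theta_termE (period_slopeD Fab)// (period_constD Fab)//.
have -> : x + m - (l + m) = x - l by rewrite opprD addrACA subrr addr0.
by rewrite dotDl !dotBr; ring.
Qed.

(** Compared with the term for [l = 0], the term for [l] gains an expression linear in the
    coordinates of [l], bounded on the ball, and loses half of the definite form [dot (a l) l]. For
    large [l] the loss wins. The constant [c i] cancels, so the list serves all [c]. *)
Lemma theta_term_dominated i (r : R) : exists Ls : seq 'rV[R]_2,
  (forall l, l \in Ls -> lattice_set L l) /\
  forall c x l, `|x| <= r -> lattice_set L l -> exists2 l', l' \in Ls &
    affine_fun (theta_term c i l) x <= affine_fun (theta_term c i l') x.
Proof.
have [K1 K10 HK1] := @dot_bound R 2 (a b1).
have [K2 K20 HK2] := @dot_bound R 2 (a b2).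
pose C := `|dot (e i) b1| + `|dot (e i) b2| + `|beta b1| + `|beta b2| +
  (K1 + K2) * `|r|.
have C0 : 0 <= C by rewrite !addr_ge0// mulr_ge0// addr_ge0 ?ltW.
pose tr := dot (a b1) b1 + dot (a b2) b2.
pose de := dot (a b1) b1 * dot (a b2) b2 - dot (a b1) b2 ^+ 2.
have tr0 : 0 < tr.
  rewrite addr_gt0// -(pmulr_rgt0 _ pos1).
  by have := sqr_ge0 (dot (a b1) b2); move: pos2; lra.
(* With [S] the sum of the absolute coordinates, [pos_def] gives a loss of at least
   [de * S ^+ 2 / (4 * tr)], and the gain is at most [C * S]; so [S >= 4 * C * tr / de] is
   enough. *)
pose M := Num.bound (4 * C * tr / de).
have MP : 4 * C * tr / de < M%:R.
  apply: archi_boundP; apply: divr_ge0; last exact: ltW.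
  by rewrite mulr_ge0 ?(ltW tr0)// mulr_ge0.
have [s Hs] := int_interval M.
exists [seq k1%:~R *: b1 + k2%:~R *: b2 | k1 <- s, k2 <- s]; split.
  move=> l /allpairsP[[k1 k2] [_ _ ->]].
  by apply: latticeD; exact: latticeZ.
move=> c x l xr Ll; have [k1 [k2 El]] := genL Ll.
have [small|big] := boolP ((`|k1| <= M%:Z) && (`|k2| <= M%:Z)).
  exists l => //; apply/allpairsP; exists (k1, k2); split=> //=.
    by apply: Hs; case/andP: small.
  by apply: Hs; case/andP: small.
exists 0.
  apply/allpairsP; exists (0, 0); split; rewrite /= ?scale0r ?addr0//;
    by apply: Hs; rewrite normr0.
pose t1 : R := k1%:~R; pose t2 : R := k2%:~R.
pose S := `|t1| + `|t2|.
have SM : M%:R <= S.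
  have H (k k' : int) : ~~ (`|k| <= M%:Z) -> M%:R <= `|k%:~R| + `|k'%:~R| :> R.
    rewrite -ltNge => h; apply: (@le_trans _ _ `|k%:~R|); last by rewrite lerDl.
    by rewrite -intr_norm -[M%:R]/((M%:Z)%:~R) ler_int ltW.
  move: big; rewrite negb_and => /orP[/H|/H]; first exact.
  by rewrite /S addrC; apply.
have Q : dot (a l) l = dot (a b1) b1 * t1 ^+ 2 + 2 * dot (a b1) b2 * t1 * t2 +
    dot (a b2) b2 * t2 ^+ 2.
  rewrite El (period_slopeD Fab) ?(period_slopeZ Fab)//; try exact: latticeZ.
  rewrite dotDl !dotZl !dotDr !dotZr -(period_slope_sym Fab Lb1 Lb2) -/t1 -/t2.
  by ring.
have Eb : b l = 2^-1 * dot (a l) l + (t1 * beta b1 + t2 * beta b2).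
  have : beta l = t1 * beta b1 + t2 * beta b2.
    by rewrite El betaD ?betaZ//; exact: latticeZ.
  by rewrite {1}/beta => <-; rewrite subrKC.
have Ea : dot (a l) x = t1 * dot (a b1) x + t2 * dot (a b2) x.
  rewrite El (period_slopeD Fab) ?(period_slopeZ Fab)//; try exact: latticeZ.
  by rewrite dotDl !dotZl.
have Ee : dot (e i) l = t1 * dot (e i) b1 + t2 * dot (e i) b2.
  by rewrite El dotDr !dotZr.
rewrite !theta_termE !dotBr a0 b0 !dot0r !dot0l Ee Ea Eb.
have lin (t u v y D : R) : `|u| + `|v| + `|y| <= D ->
    t * u + t * v - t * y <= `|t| * D.
  move=> h; rewrite -mulrDr -mulrBr (le_trans (ler_norm _))// normrM.
  rewrite ler_wpM2l// (le_trans _ h)// (le_trans (ler_normB _ _))//.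
  by rewrite lerD2r ler_normD.
have nr : `|x| <= `|r| by rewrite (le_trans xr)// ler_norm.
have l1 : t1 * dot (a b1) x + t1 * beta b1 - t1 * dot (e i) b1 <= `|t1| * C.
  apply: lin; rewrite /C; have := HK1 x.
  have : K1 * `|x| <= K1 * `|r| by rewrite ler_wpM2l// ltW.
  have : 0 <= K2 * `|r| by rewrite mulr_ge0// ltW.
  have := normr_ge0 (dot (e i) b2); have := normr_ge0 (beta b2); rewrite mulrDl.
  lra.
have l2 : t2 * dot (a b2) x + t2 * beta b2 - t2 * dot (e i) b2 <= `|t2| * C.
  apply: lin; rewrite /C; have := HK2 x.
  have : K2 * `|x| <= K2 * `|r| by rewrite ler_wpM2l// ltW.
  have : 0 <= K1 * `|r| by rewrite mulr_ge0// ltW.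
  have := normr_ge0 (dot (e i) b1); have := normr_ge0 (beta b1); rewrite mulrDl.
  lra.
have main : S * C <= 2^-1 * dot (a l) l.
  have S0 : 0 <= S by rewrite addr_ge0.
  have SS : S ^+ 2 <= 2 * (t1 ^+ 2 + t2 ^+ 2).
    rewrite /S -(real_normK (num_real t1)) -(real_normK (num_real t2)).
    by have := sqr_ge0 (`|t1| - `|t2|); lra.
  have CS : 4 * C * tr <= S * de.
    by rewrite -ler_pdivrMr// (le_trans (ltW MP)).
  have h1 := pos_def t1 t2; rewrite -Q -/tr -/de in h1.
  rewrite -(ler_pM2l tr0).
  have h2 : S * (4 * C * tr) <= S * (S * de) by rewrite ler_wpM2l.
  have h3 : de * S ^+ 2 <= de * (2 * (t1 ^+ 2 + t2 ^+ 2)) by rewrite ler_wpM2l// ltW.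
  lra.
have SC : S * C = `|t1| * C + `|t2| * C by rewrite mulrDl.
lra.
Qed.

Definition theta c x : R :=
  sup [set t | exists i l, lattice_set L l /\ t = affine_fun (theta_term c i l) x].

Lemma theta_bounded c (r : R) : exists k s, forall x, `|x| <= r ->
  [/\ theta c x = max_affine k s x,
      forall i l, lattice_set L l -> affine_fun (theta_term c i l) x <= theta c x &
      exists i, exists2 l, lattice_set L l &
        theta c x = affine_fun (theta_term c i l) x].
Proof.
pose Ls i := projT1 (cid (theta_term_dominated i r)).
have LsL i l : l \in Ls i -> lattice_set L l.
  by have [+ _] := projT2 (cid (theta_term_dominated i r)); apply.
have LsD i c' x l : `|x| <= r -> lattice_set L l -> exists2 l', l' \in Ls i &
    affine_fun (theta_term c' i l) x <= affine_fun (theta_term c' i l') x.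
  by have [_ +] := projT2 (cid (theta_term_dominated i r)); apply.
pose s := [seq theta_term c i l | i <- enum 'I_n.+1, l <- Ls i].
pose k := theta_term c ord0 0.
exists k, s => x xr.
have top i l : lattice_set L l ->
    affine_fun (theta_term c i l) x <= max_affine k s x.
  move=> Ll; have [l' l'Ls /le_trans] := LsD i c x l xr Ll; apply.
  apply: max_affine_ub; rewrite inE; apply/orP; right.
  by apply/allpairsPdep; exists i, l'; rewrite mem_enum.
have [i [l Ll Em]] : exists i, exists2 l, lattice_set L l &
    max_affine k s x = affine_fun (theta_term c i l) x.
  have [t + ->] := max_affine_attained k s x.
  rewrite inE => /predU1P[->|/allpairsPdep[i [l [_ lL ->]]]].
    by exists ord0, 0 => //; exact: lattice_0.
  by exists i, l => //; exact: LsL lL.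
have Et : theta c x = max_affine k s x.
  apply/le_anti/andP; split.
    apply: sup_le_ub; first by exists (affine_fun (theta_term c i l) x), i, l.
    by move=> _ [i' [l' [Ll' ->]]]; exact: top.
  apply: ub_le_sup; last by exists i, l.
  by exists (max_affine k s x) => _ [i' [l' [Ll' ->]]]; exact: top.
split=> //; first by rewrite Et; exact: top.
by exists i, l => //; rewrite Et.
Qed.

Lemma theta_ub c x i l : lattice_set L l ->
  affine_fun (theta_term c i l) x <= theta c x.
Proof. by have [k [s H]] := theta_bounded c `|x|; have [_ + _] := H x (lexx _); apply. Qed.

Lemma theta_attained c x : exists i, exists2 l, lattice_set L l &
  theta c x = affine_fun (theta_term c i l) x.
Proof. by have [k [s H]] := theta_bounded c `|x|; have [] := H x (lexx _). Qed.

Lemma theta_loc_max c : loc_max_affine (theta c).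
Proof.
move=> x; have [k [s H]] := theta_bounded c (`|x| + 1); exists k, s.
apply: filterS (near_rV x ltr01) => y yx; have [] // := H y.
have := ler_normD (y - x) x; rewrite subrK => /le_trans; apply.
by rewrite addrC lerD2l ltW.
Qed.

Lemma theta_quasi_periodic c : quasi_periodic L (theta c) a b.
Proof.
move=> m Lm x; apply/le_anti/andP; split.
  have [i [l Ll ->]] := theta_attained c (x + m).
  rewrite -(subrK m l) theta_term_shift//; last exact: lattice_sub.
  by rewrite lerD2r theta_ub//; exact: lattice_sub.
have [i [l Ll ->]] := theta_attained c x.
by rewrite -theta_term_shift//; apply: theta_ub; exact: latticeD.
Qed.

Context (incong : forall i i' (k1 k2 : int),
  e i - e i' = k1 *: a b1 + k2 *: a b2 -> i = i').

(** If [theta c] were affine at [x], every term attaining the maximum there would lie below this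
    affine function and touch it, hence equal it. Two equal terms have equal covectors, which makes
    [e i] and [e i'] congruent modulo the slopes of the periods. *)
Lemma theta_not_affine c x i i' l l' : i != i' ->
  lattice_set L l -> lattice_set L l' ->
  theta c x = affine_fun (theta_term c i l) x ->
  theta c x = affine_fun (theta_term c i' l') x -> ~ loc_affine (theta c) x.
Proof.
move=> ii' Ll Ll' E E' [k Hk]; move/negP: ii'; apply.
have Ek := nbhs_singleton Hk.
have same j m : lattice_set L m -> theta c x = affine_fun (theta_term c j m) x ->
    theta_term c j m = k.
  move=> Lm Ej; apply: (@affine_le_near R 2 _ _ x); last by rewrite -Ej.
  by apply: filterS Hk => y <-; exact: theta_ub.
have Ett : e i + a l = e i' + a l'.
  exact: (congr1 fst (etrans (same i l Ll E) (esym (same i' l' Ll' E')))).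
have Es : e i - e i' = a l' - a l.
  by apply/eqP; rewrite subr_eq addrAC eq_sym subr_eq eq_sym Ett addrC.
have Lll : lattice_set L (l' - l) by exact: lattice_sub.
have [k1 [k2 Ell]] := genL Lll.
apply/eqP/(@incong _ _ k1 k2); rewrite Es.
have -> : a l' - a l = a (l' - l).
  by apply/eqP; rewrite subr_eq -(period_slopeD Fab)// subrK.
rewrite Ell (period_slopeD Fab) ?(period_slopeZ Fab)//; exact: latticeZ.
Qed.

Lemma theta_term_const c i l x : affine_fun (theta_term c i l) x =
  c i + affine_fun (theta_term (fun=> 0) i l) x.
Proof. by rewrite !theta_termE; ring. Qed.

Lemma theta_term_max i x : exists2 l, lattice_set L l &
  forall l', lattice_set L l' -> affine_fun (theta_term (fun=> 0) i l') x <=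
    affine_fun (theta_term (fun=> 0) i l) x.
Proof.
have [Ls [LsL H]] := theta_term_dominated i `|x|.
have [l0 l0s _] := H (fun=> 0) x 0 (lexx _) (lattice_0 L).
have [l ls Hl] := seq_argmin (fun l => - affine_fun (theta_term (fun=> 0) i l) x) l0s.
exists l; first exact: LsL.
move=> l' Ll'; have [l2 l2s /le_trans] := H (fun=> 0) x l' (lexx _) Ll'; apply.
by rewrite -lerN2; exact: Hl.
Qed.

Lemma theta_through (x : 'I_n -> 'rV[R]_2) : exists Theta : 'rV[R]_2 -> R,
  [/\ quasi_periodic L Theta a b, loc_max_affine Theta &
      forall j, ~ loc_affine Theta (x j)].
Proof.
(* The best translate of class [i] at the point [x j]. It does not depend on [c], which shifts the
   whole class by a constant, so the values at these translates form the matrix of a tropical linear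
   system for [c]. *)
pose lm j i := projT1 (cid2 (theta_term_max i (x j))).
have lmL j i : lattice_set L (lm j i) by rewrite /lm; case: cid2.
have lmP j i l' : lattice_set L l' ->
    affine_fun (theta_term (fun=> 0) i l') (x j) <=
    affine_fun (theta_term (fun=> 0) i (lm j i)) (x j).
  by rewrite /lm; case: cid2 => l Ll; apply.
have [c Hc] := tropical_cramer
  (fun j i => affine_fun (theta_term (fun=> 0) i (lm j i)) (x j)).
exists (theta c); split=> [||j].
- exact: theta_quasi_periodic.
- exact: theta_loc_max.
have [i [i' [ii' top E]]] := Hc j.
have Etheta : theta c (x j) =
    c i + affine_fun (theta_term (fun=> 0) i (lm j i)) (x j).
  apply/le_anti/andP; split.
    have [i2 [l2 Ll2 ->]] := theta_attained c (x j).
    rewrite theta_term_const (le_trans _ (top i2))// lerD2l.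
    exact: lmP.
  by rewrite -theta_term_const; exact: theta_ub.
apply: (theta_not_affine ii' (lmL j i) (lmL j i')).
  by rewrite theta_term_const.
by rewrite Etheta E -theta_term_const.
Qed.

End ThetaSeries.

(** * The lower bound for one divisor, and the inequality *)

Section RiemannRoch.
Context {R : realType} (L : lattice R 2).
Local Notation pi := (@torus_pi R 2 L).

Lemma h0_ge0 (D : divisor L) : (0 <= h0 D)%E.
Proof. by apply: le_ereal_inf_tmp => _ [k _ <-]; rewrite lee_fin. Qed.

(** Multiplicativity of the determinant, for the matrix of the pairings of [u, v] with [x, y]. *)
Lemma zdet_form (u v : 'rV[int]_2) (x y : 'rV[R]_2) :
  dot u x * dot v y - dot u y * dot v x = (zdet u v)%:~R * det2 x y.
Proof. by rewrite !dot2 /zdet /det2 intrB !intrM; ring. Qed.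

Context (b1 b2 : 'rV[R]_2) (Lb1 : lattice_set L b1) (Lb2 : lattice_set L b2)
  (b12 : det2 b1 b2 != 0)
  (genL : forall l, lattice_set L l ->
    exists k1 k2 : int, l = k1%:~R *: b1 + k2%:~R *: b2).

Lemma h0_lower_bound (D : divisor L) F (a : 'rV[R]_2 -> 'rV[int]_2) b :
  is_lift D F -> quasi_periodic L F a b -> 0 < dot (a b1) b1 ->
  0 < dot (a b1) b1 * dot (a b2) b2 - dot (a b1) b2 ^+ 2 ->
  (((absz (zdet (a b1) (a b2)))%:R)%:E <= h0 D)%E.
Proof.
move=> DF Fab pos1 pos2.
have d0 : zdet (a b1) (a b2) != 0.
  apply: contraTneq pos2 => d0.
  rewrite expr2 {2}(period_slope_sym Fab Lb1 Lb2) zdet_form d0 mul0r.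
  by rewrite ltxx.
have [e He] := incongruent_vectors d0.
apply: le_ereal_inf_tmp => _ [k [P HP] <-]; rewrite lee_fin ler_nat leqNgt.
(* For [k] points the Cramer rule needs [k + 1] incongruent covectors, which exist since [k] is
   smaller than the number of classes. *)
apply/negP => kN; apply: HP.
have incong (i i' : 'I_k.+1) (k1 k2 : int) :
    e i - e i' = k1 *: a b1 + k2 *: a b2 -> i = i'.
  by move=> E; apply: val_inj; apply: (He _ _ k1 k2) E;
    exact: leq_ltn_trans (leq_ord _) kN.
have [T [Tab Tmax Tn]] := theta_through Fab Lb1 Lb2 genL pos1 pos2 incong
  (fun j => repr (P j)).
exists (section_divisor DF Fab Tab Tmax).
  exact: section_divisor_linear_system.
move=> j; have -> : P j = pi (repr (P j)) by rewrite /torus_pi reprK.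
exact: section_divisor_passes (Tn j).
Qed.

End RiemannRoch.

Theorem theorem1 (R : realType) (L : lattice R 2) (hX : tropical_abelian L)
    (D : divisor L) :
  ((((self_intersection D)%:~R / 2)%R)%:E <= h0 D + h0 (opp_divisor D))%E.
Proof.
have h0D := h0_ge0 D; have h0N := h0_ge0 (opp_divisor D).
set m := self_intersection D.
(* The case of a nonpositive number includes the default value of [xget], so in the other case [m]
   satisfies the defining predicate. *)
have [m0|m0] := leP m 0.
  apply: (@le_trans _ _ 0%E); last exact: adde_ge0.
  by rewrite lee_fin pmulr_lle0 ?invr_gt0// lerz0.
have Dm : is_intersection_number D D m.
  apply: contrapT => H; move: m0; rewrite /m /self_intersection.
  rewrite /intersection_number; case: xgetP => [k -> //|_].
  by rewrite ltxx.
have [b1 [b2 [Lb1 Lb2 b12 genL]]] := lattice_basis L.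
have [F DF] := divisor_lift D; have [a [b Fab]] := lift_quasi_periodic DF.
have Em := intersection_number_form DF Fab Lb1 Lb2 b12 genL Dm.
set c := _ - _ in Em.
have nb : 0 < `|det2 b1 b2| by rewrite normr_gt0.
have c0 : 0 < c.
  by rewrite -(pmulr_rgt0 _ (ltr0Sn R 1)) -Em mulr_gt0// ltr0z.
have Ec : c = (zdet (a b1) (a b2))%:~R * det2 b1 b2.
  by rewrite -zdet_form /c expr2 {2}(period_slope_sym Fab Lb1 Lb2).
(* Both sides are compared after multiplication by the absolute value of [det2 b1 b2], where each
   becomes the Gram determinant [c]. *)
have EN : m%:~R / 2 = (absz (zdet (a b1) (a b2)))%:R :> R.
  rewrite -[RHS]/((Posz _)%:~R) abszE intr_norm; apply: (mulIf (lt0r_neq0 nb)).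
  by rewrite -normrM -Ec (gtr0_norm c0) mulrAC Em; field.
have c11 : dot (a b1) b1 != 0.
  apply: contraTneq c0 => h; rewrite /c h mul0r sub0r oppr_gt0 -leNgt.
  exact: sqr_ge0.
rewrite EN; have [cn|cp|c1] := ltgtP (dot (a b1) b1) 0; last by rewrite c1 eqxx in c11.
- rewrite -[_%:E]add0e; apply: leeD => //.
  have -> : zdet (a b1) (a b2) = zdet (- a b1) (- a b2).
    by rewrite /zdet !mxE; ring.
  apply: (h0_lower_bound Lb1 Lb2 genL (is_lift_opp DF) (quasi_periodicN Fab)).
    by rewrite dotNl oppr_gt0.
  by move: c0; rewrite /c !dotNl mulrNN sqrrN.
- by rewrite -[_%:E]adde0; apply: leeD => //; exact: h0_lower_bound Fab cp c0.
Qed.
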